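(* Let $N\ge6$ and consider a perturbed global solution with sufficiently small $\mathring\varepsilon$ (as described in the context). Then the variables $\widehat k_{IJ},\widehat\gamma_{IJB},\widehat e^i_I,\widehat n,\widehat{e_0\psi},\widehat{e_I\psi}$ admit the following finite expansions: there exist functions $\widehat n^\infty(x),\widehat k_{IJ}^\infty(x),(\widehat{e_0\psi})^\infty(x)\in C^{N-6}(\mathbb T^3)$, $\widehat\gamma_{IJB}^\infty(x),(\widehat{e_I\psi})^\infty(x)\in C^{N-5}(\mathbb T^3)$, $(\widehat e_I^i)^\infty(x)\in C^{N-4}(\mathbb T^3)$ and a constant $C>0$ depending on $N$ and the FLRW background such that, for all $t\in[0,+\infty)$, $$\|\widehat n-\widehat n^\infty(x)e^{-2Ht}\|_{C^{N-6}(\Sigma_t)}\le C\mathring\varepsilon e^{-4Ht},$$ $$\|\widehat e_I^i-(\widehat e_I^i)^\infty(x)e^{-Ht}\|_{C^{N-4}(\Sigma_t)}\le C\mathring\varepsilon e^{-3Ht},$$ $$\|\widehat\gamma_{IJB}-\widehat\gamma_{IJB}^\infty(x)e^{-Ht}\|_{C^{N-5}(\Sigma_t)}\le C\mathring\varepsilon e^{-3Ht},$$ $$\|\widehat k_{IJ}-(F_{\widehat k})_{IJ}(x)e^{-2Ht}-\widehat k_{IJ}^\infty(x)e^{-3Ht}\|_{C^{N-6}(\Sigma_t)}\le C\mathring\varepsilon e^{-4Ht},$$ $$\|\widehat{e_0\psi}-F_{\widehat{e_0\psi}}(x)e^{-2Ht}-(\widehat{e_0\psi})^\infty(x)e^{-3Ht}\|_{C^{N-6}(\Sigma_t)}\le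 C\mathring\varepsilon e^{-4Ht},$$ $$\|\widehat{e_I\psi}-(\widehat{e_I\psi})^\infty(x)e^{-Ht}\|_{C^{N-5}(\Sigma_t)}\le C\mathring\varepsilon e^{-3Ht},$$ where $$\begin{aligned}(F_{\widehat k})_{IJ}(x)=\frac1H\Big\{&(e_C^a)^\infty\partial_a\widehat\gamma_{IJC}^\infty-(e_I^a)^\infty\partial_a\widehat\gamma_{CJC}^\infty-\frac23\delta_{IJ}(e_C^a)^\infty\partial_a\widehat\gamma_{DDC}^\infty-\widehat\gamma_{CID}^\infty\widehat\gamma_{DJC}^\infty-\widehat\gamma_{IJD}^\infty\widehat\gamma_{CCD}^\infty\\&+\frac13\delta_{IJ}\big(\widehat\gamma_{CED}^\infty\widehat\gamma_{DEC}^\infty+\widehat\gamma_{EED}^\infty\widehat\gamma_{CCD}^\infty\big)-(\widehat{e_I\psi})^\infty(\widehat{e_J\psi})^\infty+\frac13\delta_{IJ}(\widehat{e_C\psi})^\infty(\widehat{e_C\psi})^\infty\Big\}(x),\end{aligned}$$ $$F_{\widehat{e_0\psi}}(x)=\frac1H\big\{(e_C^a)^\infty\partial_a(\widehat{e_C\psi})^\infty-\widehat\gamma^\infty_{CCD}(\widehat{e_D\psi})^\infty\big\}(x),$$ $$(e_I^i)^\infty(x):=(\widehat e_I^i)^\infty(x)+\delta_I^i\,\mathring a^{-1}\bigg(\frac12\sqrt{\frac{\mathring\varphi_{FLRW}^2}{\Lambda}+1}+\frac12\bigg)^{-\frac13}.$$ These functions are the renormalised limits, as $t\to+\infty$, of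 the corresponding variables or algebraic expressions above (i.e. of $e^{2Ht}\widehat n$, $e^{Ht}\widehat e^i_I$, $e^{Ht}\widehat\gamma_{IJB}$, $e^{3Ht}[\widehat k_{IJ}-(F_{\widehat k})_{IJ}e^{-2Ht}]$, $e^{3Ht}[\widehat{e_0\psi}-F_{\widehat{e_0\psi}}e^{-2Ht}]$, $e^{Ht}\widehat{e_I\psi}$ respectively), and each of $$\|\widehat n^\infty\|_{C^{N-6}(\mathbb T^3)},\ \|(\widehat e_I^i)^\infty\|_{C^{N-4}(\mathbb T^3)},\ \|\widehat\gamma_{IJB}^\infty\|_{C^{N-5}(\mathbb T^3)},\ \|\widehat k_{IJ}^\infty\|_{C^{N-6}(\mathbb T^3)},\ \|(\widehat{e_0\psi})^\infty\|_{C^{N-6}(\mathbb T^3)},\ \|(\widehat{e_I\psi})^\infty\|_{C^{N-5}(\mathbb T^3)}$$ is at most $C\mathring\varepsilon$.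
   Context: Conventions. $\Lambda>0$ is fixed and $H=\sqrt{\Lambda/3}$. Indices $i,j,a,b,I,J,B,C,D,E,\dots$ range over $\{1,2,3\}$ and Greek indices over $\{0,1,2,3\}$; repeated indices are summed; lower-case Latin indices are coordinate indices, capital ones refer to a spatial orthonormal frame and are never raised. Equations and data. The Einstein-massless-scalar field system for a 4-dimensional Lorentzian metric $\mathbf g$ and a scalar field $\psi$ is $\mathbf{Ric}_{\mu\nu}=\Lambda\mathbf g_{\mu\nu}+\partial_\mu\psi\,\partial_\nu\psi$, $\square_{\mathbf g}\psi=0$. Initial data are $(\Sigma_0=\mathbb T^3,\mathring g,\mathring k,\mathring\psi,\mathring\varphi)$, with $\mathring g$ a Riemannian metric, $\mathring k$ a symmetric 2-tensor (second fundamental form) and $\mathring\psi,\mathring\varphi$ functions (initial values of $\psi$ and of its derivative along the future unit normal), satisfying the constraints $\mathring R-|\mathring k|^2+(\mathrm{tr}\mathring k)^2=2\Lambda+\mathring\varphi^2+|\mathring\nabla\mathring\psi|^2$ and $\mathring{\mathrm{div}}\,\mathring k-d\,\mathrm{tr}\mathring k=-\mathring\varphi\mathring\nabla\mathring\psi$ (operations with respect to $\mathring g$, with $\mathring R$ its scalar curvature). To such data corresponds a unique (up to isometry) maximal development $(\mathcal M,\mathbf g,\psi)$, in which $\Sigma_0$ is embedded as a Cauchy hypersurface, identified with $\{t=0\}$. FLRW background. On $\mathbb R\times\mathbb T^3$: $\mathbf g_{FLRW}=-dt^2+a^2(t)\sum_{i=1}^3(dx^i)^2$, $\psi_{FLRW}(t)=\mathring\psi_{FLRW}+\mathring\varphi_{FLRW}\int_0^t\frac{\mathring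 a^3}{a^3(\tau)}d\tau$, with $a(t)=\mathring a\big(\sqrt{\tfrac{\mathring\varphi_{FLRW}^2}{\Lambda}+1}\,\sinh(\sqrt{3\Lambda}t)+\cosh(\sqrt{3\Lambda}t)\big)^{1/3}$, where $\mathring a=a(0)>0$, $\mathring\psi_{FLRW}=\psi_{FLRW}(0)$, $\mathring\varphi_{FLRW}=\partial_t\psi_{FLRW}(0)$ are given real constants. Its reduced variables are $(k_{IJ})_{FLRW}=-\delta_{IJ}\frac{\partial_ta}{a}$ (so $\mathrm{tr}k_{FLRW}=-3\frac{\partial_ta}{a}$), $(\gamma_{IJB})_{FLRW}=0$, $n_{FLRW}=1$, $(e^i_I)_{FLRW}=\delta^i_Ia(t)^{-1}$, $(e_0\psi)_{FLRW}=\partial_t\psi_{FLRW}$, $(e_I\psi)_{FLRW}=0$. Gauge and reduced variables. The metric is written $\mathbf g=-n^2dt^2+g_{ij}dx^idx^j$ (zero shift), with $\Sigma_t=\{t\}\times\mathbb T^3$, lapse $n$, induced Riemannian metric $g$ with Levi-Civita connection $\nabla$, and globally defined coordinate fields $\partial_1,\partial_2,\partial_3$ on $\mathbb T^3$. The time function is normalized by $n-1=\mathrm{tr}k_{FLRW}-\mathrm{tr}k$. The frame $e_0=n^{-1}\partial_t$, $e_I=e_I^i\partial_i$ is $\mathbf g$-orthonormal, with $e_I$ tangent to $\Sigma_t$ and Fermi propagated: $\mathbf D_{e_0}e_I=n^{-1}(e_In)e_0$, where $\mathbf D$ is the Levi-Civita connection of $\mathbf g$; on $\Sigma_0$, $e_1,e_2,e_3$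 is obtained from $\partial_1,\partial_2,\partial_3$ by the Gram-Schmidt process. Set $k_{IJ}=-\mathbf g(\mathbf D_{e_I}e_0,e_J)=k_{JI}$ and $\gamma_{IJB}=g(\nabla_{e_I}e_J,e_B)=-\gamma_{IBJ}$. The differences are $\widehat k_{IJ}=k_{IJ}-\frac13\delta_{IJ}\mathrm{tr}k$ (which equals $k_{IJ}-(k_{IJ})_{FLRW}+\frac13\delta_{IJ}(n-1)$), $\widehat n=n-1$, $\widehat\gamma_{IJB}=\gamma_{IJB}$, $\widehat e^i_I=e^i_I-(e^i_I)_{FLRW}$, $\widehat\psi=\psi-\psi_{FLRW}$, $\widehat{e_0\psi}=e_0\psi-\partial_t\psi_{FLRW}$, $\widehat{e_I\psi}=e_I\psi$. Norms. $\|v\|_{L^2(\Sigma_t)}^2=\int_{\Sigma_t}v^2(t,x)\,dx^1dx^2dx^3$, $\|v\|^2_{H^M(\Sigma_t)}=\sum_{|\iota|\le M}\|\partial^\iota v\|^2_{L^2(\Sigma_t)}$, $\|v\|_{C^M(\Sigma_t)}=\sum_{|\iota|\le M}\|\partial^\iota v\|_{C^0(\Sigma_t)}$, where $\iota$ is a spatial multi-index and $\partial^\iota$ differentiates with respect to $\partial_1,\partial_2,\partial_3$. For the indexed variables $\widehat k,\widehat\gamma,\widehat e$ and $\widehat{e\psi}=(\widehat{e_\mu\psi})_{\mu=0}^3$, the squared norm is the sum of the squared norms of the components. The perturbed global solution. Set $\mathring\varepsilon^2:=\|\widehat k\|_{H^N(\Sigma_0)}^2+\|\widehat\gamma\|_{H^N(\Sigma_0)}^2+\|\widehat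 e\|_{H^N(\Sigma_0)}^2+\|\widehat n\|_{H^N(\Sigma_0)}^2+\|\widehat{e\psi}\|_{H^N(\Sigma_0)}^2+\|\widehat\psi\|_{H^N(\Sigma_0)}^2$. The solution considered is the maximal solution of data, satisfying the constraints, with $\mathring\varepsilon$ sufficiently small; it exists for all $t\in[0,+\infty)$ in the gauge above and satisfies, with $C$ depending on $N$ and the FLRW background, $e^{2Ht}\{\|\widehat k\|_{H^N(\Sigma_t)}^2+\|\widehat\gamma\|_{H^N(\Sigma_t)}^2+\|\widehat e\|_{H^N(\Sigma_t)}^2+e^{Ht}\|\widehat n\|_{H^N(\Sigma_t)}^2+\|\widehat{e\psi}\|_{H^N(\Sigma_t)}^2\}\le C\mathring\varepsilon^2$ and $\|\widehat k\|_{C^{N-4}(\Sigma_t)}+\|\widehat n\|_{C^{N-4}(\Sigma_t)}+\|\widehat{e_0\psi}\|_{C^{N-4}(\Sigma_t)}\le C\mathring\varepsilon e^{-2Ht}$ for all $t\ge0$.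
   Formalization: The printed coefficient √(φ̊²/Λ+1) in a(t) and in (e_I^i)^∞ violates the constraints when φ̊_FLRW≠0 (2Λ+2φ̊² instead of 2Λ+φ̊²), so no small perturbation exists; the theorem is proved for the printed coefficient and also for the corrected one √(φ̊²/(2Λ)+1). *)

(* Defs.v *)
From mathcomp Require Import all_boot all_order all_algebra.
From mathcomp Require Import all_classical all_reals all_analysis.

Set Implicit Arguments.
Unset Strict Implicit.
Unset Printing Implicit Defensive.

Import Order.TTheory GRing.Theory Num.Theory.
Import numFieldNormedType.Exports.

Local Open Scope classical_set_scope.
Local Open Scope ring_scope.

Section Calculus.
Context {R : realType} {d : nat}.
Implicit Types (f : 'rV[R]_d -> R) (x : 'rV[R]_d).

Definition pd (i : 'I_d) f : 'rV[R]_d -> R := fun x => 'D_(delta_mx 0 i) f x.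

(* iterated partial derivative of multi-index iota, the last coordinate first *)
Definition pdm (iota : 'I_d -> nat) f : 'rV[R]_d -> R :=
  foldr (fun i h => iter (iota i) (pd i) h) f (enum 'I_d).

Fixpoint Ck (k : nat) f : Prop :=
  continuous f /\
  match k with
  | 0%N => True
  | k'.+1 => forall i, (forall x, derivable f x (delta_mx 0 i)) /\ Ck k' (pd i f)
  end.

Definition smooth f := forall k, Ck k f.

Definition sup_norm f : \bar R := ereal_sup [set (`|f x|)%:E | x in setT].

(* +oo outside of C^M, so that a finite bound contains membership in C^M *)
Definition CM_norm (M : nat) f : \bar R :=
  if `[< Ck M f >] then
    (\sum_(iota : {ffun 'I_d -> 'I_M.+1} | (\sum_i iota i <= M)%N)
       sup_norm (pdm (fun i => iota i) f))%E
  else +oo%E.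

End Calculus.

Section Torus.
Context {R : realType}.
Local Notation mu := (@lebesgue_measure R).
Local Notation T3 := 'rV[R]_3.
Implicit Types (f : T3 -> R).

(* Functions on the torus R^3/Z^3 are represented by Z^3-periodic functions. *)
Definition z3_periodic f := forall (x : T3) (i : 'I_3), f (x + delta_mx 0 i) = f x.

Definition C_torus (M : nat) f := z3_periodic f /\ Ck M f.

Definition vec3 (a b c : R) : T3 :=
  \row_(i < 3) (if val i == 0%N then a else if val i == 1%N then b else c).

Definition L2_sq f : \bar R :=
  (\int[mu]_(a in `[0%R, 1%R]) \int[mu]_(b in `[0%R, 1%R])
     \int[mu]_(c in `[0%R, 1%R]) ((f (vec3 a b c)) ^+ 2)%:E)%E.

Definition smooth_HM_sq (M : nat) f : \bar R :=
  (\sum_(iota : {ffun 'I_3 -> 'I_M.+1} | (\sum_i iota i <= M)%N)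
     L2_sq (pdm (fun i => iota i) f))%E.

(* H^M of the torus is the completion of the smooth functions for the norm
   above: f belongs to it, with squared norm s, when f is the L^2 limit of an
   H^M-Cauchy sequence of smooth functions whose squared norms tend to s.
   For smooth f the constant sequence gives back smooth_HM_sq M f. *)
Definition is_HM_sq (M : nat) f (s : R) :=
  exists u : nat -> T3 -> R,
    [/\ forall j, smooth (u j) /\ z3_periodic (u j),
        forall e : R, 0 < e -> exists m : nat, forall i j : nat,
          (m <= i)%N -> (m <= j)%N ->
          (smooth_HM_sq M (fun x => u i x - u j x)%R <= e%:E)%E,
        L2_sq (fun x => u j x - f x) @[j --> \oo] --> 0%E
      & smooth_HM_sq M (u j) @[j --> \oo] --> s%:E].

(* +oo outside of H^M; at most one s satisfies is_HM_sq M f s *)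
Definition HM_sq (M : nat) f : \bar R :=
  ereal_inf [set s%:E | s in [set s : R | is_HM_sq M f s]].

End Torus.

(* Pseudo-Riemannian geometry of a metric G in global coordinates of R^d. *)
Section Geometry.
Context {R : realType} {d : nat}.
Local Notation pt := 'rV[R]_d.
Implicit Types (G : pt -> 'M[R]_d) (X Y : pt -> pt) (f : pt -> R).

Definition christoffel G (l m n : 'I_d) : pt -> R := fun x =>
  2^-1 * \sum_s invmx (G x) l s *
    (pd m (fun y => G y s n) x + pd n (fun y => G y s m) x
     - pd s (fun y => G y m n) x).

Definition ricci G (m n : 'I_d) : pt -> R := fun x =>
  \sum_l (pd l (christoffel G l m n) x - pd n (christoffel G l m l) x)
  + \sum_l \sum_s (christoffel G l l s x * christoffel G s m n x
                   - christoffel G l n s x * christoffel G s m l x).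

Definition scalar_curv G : pt -> R := fun x =>
  \sum_m \sum_n invmx (G x) m n * ricci G m n x.

Definition box G f : pt -> R := fun x =>
  \sum_m \sum_n invmx (G x) m n *
    (pd m (pd n f) x - \sum_l christoffel G l m n x * pd l f x).

Definition inner G X Y : pt -> R := fun x => (X x *m G x *m (Y x)^T) 0 0.

Definition deriv_along X f : pt -> R := fun x => \sum_m X x 0 m * pd m f x.

(* D_X Y *)
Definition cov G X Y : pt -> pt := fun x => \row_l \sum_m X x 0 m *
  (pd m (fun y => Y y 0 l) x + \sum_n christoffel G l m n x * Y x 0 n).

(* (cov2 G k l i j) is nabla_l k_ij *)
Definition cov2 G (k : pt -> 'M[R]_d) (l i j : 'I_d) : pt -> R := fun x =>
  pd l (fun y => k y i j) x
  - \sum_s christoffel G s l i x * k x s j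
  - \sum_s christoffel G s l j x * k x i s.

Definition tr2 G (k : pt -> 'M[R]_d) : pt -> R := fun x =>
  \sum_i \sum_j invmx (G x) i j * k x i j.

Definition norm2_sq G (k : pt -> 'M[R]_d) : pt -> R := fun x =>
  \sum_i \sum_j \sum_p \sum_q
    invmx (G x) i p * invmx (G x) j q * k x i j * k x p q.

Definition div2 G (k : pt -> 'M[R]_d) (j : 'I_d) : pt -> R := fun x =>
  \sum_l \sum_i invmx (G x) l i * cov2 G k l i j x.

Definition grad_sq G f : pt -> R := fun x =>
  \sum_i \sum_j invmx (G x) i j * pd i f x * pd j f x.

End Geometry.

Definition sym_posdef {R : realType} {d : nat} (A : 'M[R]_d) :=
  A^T = A /\ forall v : 'rV[R]_d, v != 0 -> 0 < (v *m A *m v^T) 0 0.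

Section InitialData.
Context {R : realType}.
Local Notation T3 := 'rV[R]_3.

Record initial_data := InitialData {
  data_g : T3 -> 'M[R]_3;
  data_k : T3 -> 'M[R]_3;
  data_psi : T3 -> R;
  data_phi : T3 -> R }.

Definition constraints (Lambda : R) (D : initial_data) :=
  let g := data_g D in let k := data_k D in
  (forall x, scalar_curv g x - norm2_sq g k x + tr2 g k x ^+ 2
     = 2 * Lambda + data_phi D x ^+ 2 + grad_sq g (data_psi D) x) /\
  (forall j x, div2 g k j x - pd j (tr2 g k) x
     = - data_phi D x * pd j (data_psi D) x).

Definition data_ok (Lambda : R) (D : initial_data) :=
  [/\ forall i j, z3_periodic (fun x => data_g D x i j) /\
                  z3_periodic (fun x => data_k D x i j),
      z3_periodic (data_psi D) /\ z3_periodic (data_phi D),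
      forall x, sym_posdef (data_g D x),
      forall x, (data_k D x)^T = data_k D x
    & constraints Lambda D].

End InitialData.
Arguments initial_data : clear implicits.

Section FLRW.
Context {R : realType}.
Local Notation mu := (@lebesgue_measure R).

Record flrw := Flrw {
  Lambda : R;
  a_init : R;
  psi_init : R;
  phi_init : R;
  sinh_coef : R }.

Variable b : flrw.

(* The Hamiltonian constraint on the homogeneous slices, which reads
   6 (a'/a)^2 = 2 Lambda + phi^2 at t = 0, determines the coefficient of sinh in
   the scale factor below as sqrt (phi^2 / (2 Lambda) + 1).  The source prints
   sqrt (phi^2 / Lambda + 1).  Both values are admitted; they agree if phi = 0,
   and for phi != 0 the printed one gives a reference scale factor near which
   the constraints have no solution. *)
Definition flrw_coef :=
  sinh_coef b = Num.sqrt (phi_init b ^+ 2 / Lambda b + 1) \/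
  sinh_coef b = Num.sqrt (phi_init b ^+ 2 / (2 * Lambda b) + 1).

Definition hubble : R := Num.sqrt (Lambda b / 3).

Definition sinh (x : R) : R := (expR x - expR (- x)) / 2.
Definition cosh (x : R) : R := (expR x + expR (- x)) / 2.

Definition scale (t : R) : R :=
  a_init b *
  (sinh_coef b * sinh (Num.sqrt (3 * Lambda b) * t)
   + cosh (Num.sqrt (3 * Lambda b) * t)) `^ (3^-1).

(* the oriented integral of f from 0 to t *)
Definition int0 (f : R -> R) (t : R) : R :=
  if 0 <= t then (\int[mu]_(s in `[0, t]) f s)%R
  else - (\int[mu]_(s in `[t, 0]) f s)%R.

Definition psi_flrw (t : R) : R :=
  psi_init b + phi_init b * int0 (fun s => a_init b ^+ 3 / scale s ^+ 3) t.

Definition trk_flrw (t : R) : R := - 3 * (derive1 scale t / scale t).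

(* the limit of e^{Ht} / a(t) as t tends to infinity *)
Definition inv_scale_limit : R :=
  (a_init b)^-1 * (2^-1 * sinh_coef b + 2^-1) `^ (- 3^-1).

End FLRW.
Arguments flrw : clear implicits.

Section Spacetime.
Context {R : realType}.
Local Notation T3 := 'rV[R]_3.
Local Notation M4 := 'rV[R]_(1 + 3).

(* Coordinate 0 of a point of spacetime is t, the other three are x. *)
Definition lift4 {A : Type} (f : R -> T3 -> A) : M4 -> A :=
  fun z => f (z 0 0) (rsubmx z).
Definition event (t : R) (x : T3) : M4 := row_mx t%:M x.

(* Row I of frame is the component vector (e_I^1, e_I^2, e_I^3). *)
Record fields := Fields {
  lapse : R -> T3 -> R;
  gmet : R -> T3 -> 'M[R]_3;
  frame : R -> T3 -> 'M[R]_3;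
  scal : R -> T3 -> R }.

Variable S : fields.

Definition metric4 : M4 -> 'M[R]_(1 + 3) :=
  lift4 (fun t x => block_mx (- lapse S t x ^+ 2)%:M 0 0 (gmet S t x)).

Definition e0_vec : M4 -> M4 :=
  lift4 (fun t x => (lapse S t x)^-1 *: delta_mx 0 0).
Definition e_vec (I : 'I_3) : M4 -> M4 :=
  lift4 (fun t x => row_mx 0 (row I (frame S t x))).
Definition coord_vec (i : 'I_3) : M4 -> M4 := fun _ => row_mx 0 (delta_mx 0 i).

Definition second_form (X Y : M4 -> M4) (t : R) (x : T3) : R :=
  - inner metric4 (cov metric4 X e0_vec) Y (event t x).

Definition kk (I J : 'I_3) : R -> T3 -> R := second_form (e_vec I) (e_vec J).
Definition trk (t : R) (x : T3) : R := \sum_I kk I I t x.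

Definition gam (I J B : 'I_3) (t : R) (x : T3) : R :=
  let e (K : 'I_3) (y : T3) := row K (frame S t y) in
  inner (gmet S t) (cov (gmet S t) (e I) (e J)) (e B) x.

Definition e0_psi (t : R) (x : T3) : R :=
  deriv_along e0_vec (lift4 (scal S)) (event t x).
Definition e_psi (I : 'I_3) (t : R) (x : T3) : R :=
  deriv_along (e_vec I) (lift4 (scal S)) (event t x).

(* The fields are C^2 up to the boundary {t = 0}: as usual on a manifold with
   boundary, this means that they extend to C^2 functions across it.  Their
   values for t < 0 are such an extension and carry no other meaning. *)
Definition regular :=
  [/\ Ck 2 (lift4 (lapse S)) /\ (forall t, z3_periodic (lapse S t)),
      Ck 2 (lift4 (scal S)) /\ (forall t, z3_periodic (scal S t)),
      forall i j, Ck 2 (lift4 (fun t x => gmet S t x i j)) /\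
                  (forall t, z3_periodic (fun x => gmet S t x i j))
    & forall I i, Ck 2 (lift4 (fun t x => frame S t x I i)) /\
                  (forall t, z3_periodic (fun x => frame S t x I i))].

Definition einstein_scalar (Lam : R) :=
  forall (t : R) x, 0 <= t ->
  (forall m n, ricci metric4 m n (event t x)
     = Lam * metric4 (event t x) m n
       + pd m (lift4 (scal S)) (event t x) * pd n (lift4 (scal S)) (event t x))
  /\ box metric4 (lift4 (scal S)) (event t x) = 0.

Definition orthonormal_frame := forall (t : R) x I J, 0 <= t ->
  inner metric4 (e_vec I) (e_vec J) (event t x) = (I == J)%:R.

Definition fermi_propagated := forall (t : R) x I, 0 <= t ->
  cov metric4 e0_vec (e_vec I) (event t x)
  = ((lapse S t x)^-1 * deriv_along (e_vec I) (lift4 (lapse S)) (event t x))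
      *: e0_vec (event t x).

(* e_I is the normalization of the component of the I-th coordinate field
   orthogonal to the e_J with J < I *)
Definition gram_schmidt_initially := forall x (I : 'I_3),
  let g := gmet S 0 x in
  let e (J : 'I_3) := row J (frame S 0 x) in
  let dI : T3 := delta_mx 0 I in
  let u := dI - \sum_(J < 3 | (J < I)%N) (dI *m g *m (e J)^T) 0 0 *: e J in
  e I = (Num.sqrt ((u *m g *m u^T) 0 0))^-1 *: u.

Definition induces (D : initial_data R) := forall x : T3,
  [/\ gmet S 0 x = data_g D x,
      forall i j, second_form (coord_vec i) (coord_vec j) 0 x = data_k D x i j,
      scal S 0 x = data_psi D x
    & e0_psi 0 x = data_phi D x].

Definition gauge_solution (b : flrw R) (D : initial_data R) :=
  [/\ [/\ regular,
          forall (t : R) x, 0 <= t -> 0 < lapse S t x /\ sym_posdef (gmet S t x),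
          einstein_scalar (Lambda b)
        & induces D],
      forall (t : R) x, 0 <= t -> lapse S t x - 1 = trk_flrw b t - trk t x
    & [/\ orthonormal_frame, fermi_propagated & gram_schmidt_initially]].

Section Differences.
Variable b : flrw R.

Definition hat_k (I J : 'I_3) (t : R) (x : T3) : R :=
  kk I J t x - 3^-1 * (I == J)%:R * trk t x.
Definition hat_n (t : R) (x : T3) : R := lapse S t x - 1.
Definition hat_gam : 'I_3 -> 'I_3 -> 'I_3 -> R -> T3 -> R := gam.
Definition hat_e (I i : 'I_3) (t : R) (x : T3) : R :=
  frame S t x I i - (I == i)%:R * (scale b t)^-1.
Definition hat_psi (t : R) (x : T3) : R := scal S t x - psi_flrw b t.
Definition hat_e0psi (t : R) (x : T3) : R := e0_psi t x - derive1 (psi_flrw b) t.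
Definition hat_epsi : 'I_3 -> R -> T3 -> R := e_psi.

Local Open Scope ereal_scope.

Definition k_energy (N : nat) (t : R) := \sum_I \sum_J HM_sq N (hat_k I J t).
Definition gam_energy (N : nat) (t : R) :=
  \sum_I \sum_J \sum_B HM_sq N (hat_gam I J B t).
Definition e_energy (N : nat) (t : R) := \sum_I \sum_i HM_sq N (hat_e I i t).
Definition n_energy (N : nat) (t : R) := HM_sq N (hat_n t).
Definition epsi_energy (N : nat) (t : R) :=
  HM_sq N (hat_e0psi t) + \sum_I HM_sq N (hat_epsi I t).

Definition initial_energy (N : nat) : \bar R :=
  k_energy N 0%R + gam_energy N 0%R + e_energy N 0%R + n_energy N 0%R
  + epsi_energy N 0%R + HM_sq N (hat_psi 0%R).

Definition global_bounds (N : nat) (C eps : R) := forall t : R, (0 <= t)%R ->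
  (expR (2 * hubble b * t))%:E *
    (k_energy N t + gam_energy N t + e_energy N t
     + (expR (hubble b * t))%:E * n_energy N t + epsi_energy N t)
  <= (C * eps ^+ 2)%:E /\
  sqrte (\sum_I \sum_J CM_norm (N - 4) (hat_k I J t) ^+ 2)
    + CM_norm (N - 4) (hat_n t) + CM_norm (N - 4) (hat_e0psi t)
  <= (C * eps * expR (- (2 * hubble b * t)))%:E.

End Differences.
End Spacetime.
Arguments fields : clear implicits.

Section Asymptotics.
Context {R : realType}.
Local Notation T3 := 'rV[R]_3.
Variable b : flrw R.
Implicit Types (e : 'I_3 -> 'I_3 -> T3 -> R)
  (g : 'I_3 -> 'I_3 -> 'I_3 -> T3 -> R) (p : 'I_3 -> T3 -> R).

(* e_I^i at infinity from its renormalized difference *)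
Definition e_infty (ehat : 'I_3 -> 'I_3 -> T3 -> R) (I i : 'I_3) (x : T3) : R :=
  ehat I i x + (I == i)%:R * inv_scale_limit b.

Definition F_k e g p (I J : 'I_3) (x : T3) : R :=
  let delta : R := (I == J)%:R in
  (hubble b)^-1 *
  ( \sum_C \sum_a e C a x * pd a (g I J C) x
  - \sum_C \sum_a e I a x * pd a (g C J C) x
  - 2 / 3 * delta * (\sum_C \sum_D \sum_a e C a x * pd a (g D D C) x)
  - \sum_C \sum_D g C I D x * g D J C x
  - \sum_C \sum_D g I J D x * g C C D x
  + 3^-1 * delta * (\sum_C \sum_D \sum_E (g C E D x * g D E C x
                                          + g E E D x * g C C D x))
  - p I x * p J x
  + 3^-1 * delta * (\sum_C p C x * p C x)).

Definition F_e0psi e g p (x : T3) : R :=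
  (hubble b)^-1 *
  ( \sum_C \sum_a e C a x * pd a (p C) x - \sum_C \sum_D g C C D x * p D x).

End Asymptotics.

(* Main.v *)
(* The renormalized variables a e_I^i, a gamma_IJB and a e_I psi satisfy transport
   equations in which no background term survives: with
   A_IJ = n k_IJ + (a'/a) delta_IJ = O(eps e^{-2Ht}) one has, for instance,
   d_t (a e_I^i) = A_IC (a e_C^i). Their time derivatives are thus O(eps e^{-2Ht})
   in C^{N-4} or C^{N-5}, and they converge at that rate. For gamma the equation is
   that of the structure coefficients of the frame, [e_I, e_J] = c_IJK e_K, which
   determine gamma through the Koszul formula.

   The Ricci tensor of the slices and the wave operator applied to psi are
   quadratic in these variables and one more derivative, hence equal to a profile
   times e^{-2Ht} up to O(eps e^{-4Ht}) in C^{N-6}. Inserted as sources in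
   d_t k = -3H k + ... and d_t e_0 psi = -3H e_0 psi + ..., they give the terms
   F e^{-2Ht}; after their subtraction e^{3Ht} times the unknown has an integrable
   derivative, which gives the next term. The lapse satisfies
   d_t n = -6H (n - 1) - (trace of the source) + ..., hence e^{2Ht} (n - 1) relaxes
   to a multiple of the trace of the profile.

   Spatial C^m bounds come from the energy bounds by the embedding of H^{m+3} in
   C^m. The evolution equations are those of the Ricci tensor in a moving frame;
   they are used at positive times only, and the estimates at t = 0 follow from the
   bounds assumed there. *)

Require Import Defs.
From mathcomp Require Import all_boot all_order all_algebra.
From mathcomp Require Import all_classical all_reals all_analysis.
From mathcomp Require Import ring lra zify.

Set Implicit Arguments.
Unset Strict Implicit.
Unset Printing Implicit Defensive.

Import Order.TTheory GRing.Theory Num.Theory.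
Import numFieldNormedType.Exports.

Local Open Scope classical_set_scope.
Local Open Scope ring_scope.

(** * Partial derivatives and C^m bounds *)

(** The fields are only C^2 in spacetime, whereas up to N - 4 spatial derivatives have to be
    controlled in time. The evolution equations cannot be differentiated in space that often: they
    are used undifferentiated, and bounds on higher spatial derivatives are carried along in time
    through difference quotients ([time_increment]). The constant C must not depend on the solution.
    All solutions obeying the a priori bounds with the same [C0] are therefore collected in one
    type, [perturbed], and [OO] carries one constant for the whole family, so that estimates are
    uniform by construction. [OO] also records a power of eps: background quantities have power 0,
    perturbations power 1, and eps <= 1 lets quadratic terms count as linear ones. The restriction
    to positive times has this cause: the identities between the fields are known for t >= 0, and
    differentiating them in time requires a neighbourhood. *)

Section DirectionalCalculus.
Context {R : realType} {d : nat}.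
Implicit Types (f g : 'rV[R]_d -> R) (x u v : 'rV[R]_d).

Lemma derivable_line f x v s : derivable f (x + s *: v) v ->
  is_derive s (1 : R) (fun r : R => f (x + r *: v)) ('D_v f (x + s *: v)).
Proof.
move=> df.
have E : (fun h : R => h^-1 *: (((fun r => f (x + r *: v)) \o shift s) (h *: (1:R))
    - f (x + s *: v)))
  = (fun h : R => h^-1 *: ((f \o shift (x + s *: v)) (h *: v) - f (x + s *: v))).
  apply/funext => h /=; rewrite scalerDl addrCA [h *: 1]mulr1; congr (_ *: (f _ - _)).
split; first by rewrite /derivable E.
by rewrite /derive E.
Qed.

(** Only the derivative in the direction [v] enters; for negative [h] the one-variable theorem is
    applied on the interval from [h] to 0. *)
Lemma mvt_line f x v (h : R) : (forall y, derivable f y v) ->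
  exists2 s : R, `|s| <= `|h| & f (x + h *: v) - f x = h * 'D_v f (x + s *: v).
Proof.
move=> df.
set g := fun r : R => f (x + r *: v).
have dg (s : R) : is_derive s (1:R) g ('D_v f (x + s *: v)) by exact: derivable_line.
have cg : forall r, {for r, continuous g}.
  move=> r; apply: differentiable_continuous; apply/derivable1_diffP.
  by case: (dg r).
have g0 : g 0 = f x by rewrite /g scale0r addr0.
have [h0|h0|->] := ltgtP h 0; last first.
- by exists 0; rewrite ?normr0// scale0r addr0 subrr mul0r.
- have [c] := @MVT R g (fun s => 'D_v f (x + s *: v)) 0 h h0 (fun s _ => dg s)
    (continuous_subspaceT (fun r => cg r)).
  rewrite in_itv /= => /andP[c0 ch] E; exists c.
    by rewrite !gtr0_norm// ltW.
  by rewrite -g0 -/(g h) E subr0 mulrC.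
- have [c] := @MVT R g (fun s => 'D_v f (x + s *: v)) h 0 h0 (fun s _ => dg s)
    (continuous_subspaceT (fun r => cg r)).
  rewrite in_itv /= => /andP[ch c0] E; exists c.
    by rewrite !ltr0_norm// lerN2 ltW.
  by rewrite -g0 -/(g h) -opprB E sub0r mulrN opprK mulrC.
Qed.

Lemma continuous_modulus f x (e : R) : continuous_at x f -> 0 < e ->
  exists2 r : R, 0 < r & forall y, `|y| < r -> `|f (x + y) - f x| < e.
Proof.
move=> cf e0.
have [r /= r0 H] : nbhs_ball_ (ball_ (@Num.norm R 'rV[R]_d)) x (fun y => `|f x - f y| < e).
  by apply/nbhs_normP; exact: (@cvgr_dist_lt _ _ _ _ _ f (f x) cf e e0).
exists r => // y Hy; rewrite distrC; apply: H => /=.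
by rewrite opprD addrA subrr add0r normrN.
Qed.

(** The mean value theorem twice: for the increment of [f] by [h *: v], in the direction [u], then
    for ['D_u f] in the direction [v]. *)
Lemma second_difference f x u v (h : R) :
  (forall y, derivable f y u) -> (forall y, derivable ('D_u f) y v) ->
  exists s r : R, [/\ `|s| <= `|h|, `|r| <= `|h| &
    f (x + h *: u + h *: v) - f (x + h *: u) - (f (x + h *: v) - f x)
    = h * h * 'D_v ('D_u f) (x + s *: u + r *: v)].
Proof.
move=> du dvu.
pose g y := f (y + h *: v) - f y.
have dfs y : is_derive y u (fun y => f (y + h *: v)) ('D_u f (y + h *: v)).
  have E : (fun k : R => k^-1 *: (((fun y => f (y + h *: v)) \o shift y) (k *: u)
      - f (y + h *: v)))
    = (fun k : R => k^-1 *: ((f \o shift (y + h *: v)) (k *: u) - f (y + h *: v))).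
    by apply/funext => k /=; rewrite addrA.
  by split; [rewrite /derivable E; exact: du | rewrite /derive E].
have dg y : is_derive y u g ('D_u f (y + h *: v) - 'D_u f y).
  apply: is_deriveB; exact/derivableP/du.
have [s sh Es] := @mvt_line g x u h (fun y => @ex_derive _ _ _ _ _ _ _ (dg y)).
have [r rh Er] := @mvt_line ('D_u f) (x + s *: u) v h dvu.
exists s, r; split => //.
transitivity (g (x + h *: u) - g x); first by rewrite /g.
by rewrite Es (@derive_val _ _ _ _ _ _ _ (dg _)) Er mulrA.
Qed.

(** Schwarz's theorem. The second difference is symmetric in [u] and [v], so the two mixed
    derivatives agree at a pair of points as close to [x] as desired; continuity brings both points
    to [x]. *)
Lemma derive_comm f u v :
  (forall y, derivable f y u) -> (forall y, derivable f y v) ->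
  (forall y, derivable ('D_u f) y v) -> (forall y, derivable ('D_v f) y u) ->
  continuous ('D_v ('D_u f)) -> continuous ('D_u ('D_v f)) ->
  'D_v ('D_u f) = 'D_u ('D_v f).
Proof.
move=> du dv dvu duv c1 c2; apply/funext => x.
apply/eqP; rewrite -subr_eq0 -normr_le0; apply/ler_addgt0Pl => e e0; rewrite addr0.
have e20 : 0 < e / 2 by rewrite divr_gt0.
have [r1 r10 H1] := continuous_modulus (c1 x) e20.
have [r2 r20 H2] := continuous_modulus (c2 x) e20.
pose r := Num.min r1 r2; have r0 : 0 < r by rewrite lt_min r10.
(* With this [h] both intermediate points lie within [r] of [x]; the summand 1 keeps the denominator
   positive when [u] and [v] vanish. *)
pose h := r / (2 * (1 + `|u| + `|v|)).
have nn : 0 < 2 * (1 + `|u| + `|v|).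
  by have := normr_ge0 u; have := normr_ge0 v; lra.
have h0 : 0 < h by rewrite divr_gt0.
have small (a b : R) (a' b' : 'rV[R]_d) : `|a| <= `|h| -> `|b| <= `|h| ->
    `|a'| + `|b'| = `|u| + `|v| -> `|a *: a' + b *: b'| < r.
  move=> ah bh E; apply: (le_lt_trans (ler_normD _ _)); rewrite !normrZ.
  rewrite (gtr0_norm h0) in ah bh.
  apply: (@le_lt_trans _ _ (h * (`|u| + `|v|))).
    by rewrite -E mulrDr lerD// ler_wpM2r.
  rewrite /h mulrAC ltr_pdivrMr// ltr_pM2l//.
  by have := normr_ge0 u; have := normr_ge0 v; lra.
have [s1 [t1 [s1h t1h E1]]] := second_difference x h du dvu.
have [s2 [t2 [s2h t2h E2]]] := second_difference x h dv duv.
have E : 'D_v ('D_u f) (x + s1 *: u + t1 *: v) = 'D_u ('D_v f) (x + s2 *: v + t2 *: u).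
  apply: (@mulfI _ (h * h)); first by rewrite mulf_neq0// gt_eqF.
  apply: (etrans (esym E1)); apply: (etrans _ E2).
  have -> : x + h *: v + h *: u = x + h *: u + h *: v by rewrite addrAC.
  by rewrite !opprB !addrA; ring.
have B1 := H1 (s1 *: u + t1 *: v).
have B2 := H2 (s2 *: v + t2 *: u).
rewrite !addrA in B1 B2.
have {}B1 := B1 (lt_le_trans (small _ _ _ _ s1h t1h erefl) _).
have {}B2 := B2 (lt_le_trans (small _ _ _ _ s2h t2h (addrC _ _)) _).
have {}B1 := B1 ltac:(by rewrite ge_min lexx).
have {}B2 := B2 ltac:(by rewrite ge_min lexx orbT).
rewrite E in B1.
move: B1 B2; set a := 'D_v _ x; set b := 'D_u _ x; set c := 'D_u _ _ => B1 B2.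
clear E; clearbody a b c.
have -> : a - b = (c - b) - (c - a) by ring.
rewrite (le_trans (ler_normB _ _))// [leRHS]splitr; apply: lerD; exact: ltW.
Qed.

End DirectionalCalculus.

(** * Iterated partial derivatives along words of indices *)

Section Words.
Context {R : realType} {d : nat}.
Implicit Types (f g : 'rV[R]_d -> R) (x : 'rV[R]_d) (w : seq 'I_d).

(** A word can be peeled at both ends, the head being the outermost derivative and the last letter
    the innermost, which suits inductions on the order. Multi-indices are recovered through
    [pdw_pdm]. *)
Definition pdw w f := foldr (@pd R d) f w.

Lemma pdw_rcons w i f : pdw (rcons w i) f = pdw w (pd i f).
Proof. by rewrite /pdw -cats1 foldr_cat. Qed.

Lemma Ck_cont m f : Ck m f -> continuous f.
Proof. by case: m => [|m] []. Qed.

Lemma CkS m f : Ck m.+1 f <->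
  [/\ continuous f, forall i x, derivable f x (delta_mx 0 i) & forall i, Ck m (pd i f)].
Proof.
split=> [[cf H]|[cf H1 H2]]; last by split=> // i; split.
split=> //.
- by move=> i; case: (H i).
- by move=> i; case: (H i).
Qed.

Lemma CkW m n f : (n <= m)%N -> Ck m f -> Ck n f.
Proof.
elim: m n f => [|m IH] [|n] f //; first by move=> _ /Ck_cont.
by move=> nm /CkS[cf df H]; apply/CkS; split => // i; exact: IH (H i).
Qed.

Lemma Ck_pdw m w f : Ck (size w + m) f -> Ck m (pdw w f).
Proof.
elim/last_ind: w f => [|w i IH] f; first by rewrite add0n.
rewrite pdw_rcons size_rcons addSn => /CkS[_ _ H]; exact: IH.
Qed.

Lemma Ck_cst m (c : R) : Ck m (fun _ : 'rV[R]_d => c).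
Proof.
elim: m c => [|m IH] c; first by split=> //; exact: cst_continuous.
apply/CkS; split; [exact: cst_continuous|by move=> i x; exact: derivable_cst|].
move=> i; have -> : pd i (fun _ : 'rV[R]_d => c) = fun _ => 0 :> R.
  by apply/funext => x; exact: derive_cst.
exact: IH.
Qed.

Lemma pdD i f g x : derivable f x (delta_mx 0 i) -> derivable g x (delta_mx 0 i) ->
  pd i (fun y => f y + g y) x = pd i f x + pd i g x.
Proof. exact: deriveD. Qed.

Lemma pdB i f g x : derivable f x (delta_mx 0 i) -> derivable g x (delta_mx 0 i) ->
  pd i (fun y => f y - g y) x = pd i f x - pd i g x.
Proof. exact: deriveB. Qed.

Lemma pdM i f g x : derivable f x (delta_mx 0 i) -> derivable g x (delta_mx 0 i) ->
  pd i (fun y => f y * g y) x = pd i f x * g x + f x * pd i g x.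
Proof.
by move=> df dg; rewrite /pd (deriveM df dg) addrC mulrC.
Qed.

Lemma pdZ i (c : R) f x : derivable f x (delta_mx 0 i) ->
  pd i (fun y => c * f y) x = c * pd i f x.
Proof. exact: deriveZ. Qed.

Lemma continuous_add f g : continuous f -> continuous g ->
  continuous (fun x => f x + g x).
Proof. by move=> cf cg x; exact: (@continuousD _ _ _ f g x (cf x) (cg x)). Qed.

Lemma continuous_mul f g : continuous f -> continuous g ->
  continuous (fun x => f x * g x).
Proof. by move=> cf cg x; exact: (@continuousM _ _ f g x (cf x) (cg x)). Qed.

Lemma Ck_add m f g : Ck m f -> Ck m g -> Ck m (fun x => f x + g x).
Proof.
elim: m f g => [|m IH] f g.
  by move=> [cf _] [cg _]; split=> //; exact: continuous_add.
move=> /CkS[cf df Hf] /CkS[cg dg Hg]; apply/CkS; split.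
- exact: continuous_add.
- by move=> i x; exact: derivableD.
move=> i; have -> : pd i (fun x => f x + g x) = fun x => pd i f x + pd i g x.
  by apply/funext => x; exact: pdD.
exact: IH.
Qed.

Lemma Ck_mul m f g : Ck m f -> Ck m g -> Ck m (fun x => f x * g x).
Proof.
elim: m f g => [|m IH] f g.
  by move=> [cf _] [cg _]; split=> //; exact: continuous_mul.
move=> Hf' Hg'.
move: (Hf') (Hg') => /CkS[cf df Hf] /CkS[cg dg Hg]; apply/CkS; split.
- exact: continuous_mul.
- by move=> i x; exact: derivableM.
move=> i; have -> : pd i (fun x => f x * g x) = fun x => pd i f x * g x + f x * pd i g x.
  by apply/funext => x; exact: pdM.
by apply: Ck_add; apply: IH => //; exact: CkW (leqnSn m) _.
Qed.

Lemma Ck_scale m c f : Ck m f -> Ck m (fun x => c * f x).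
Proof. by apply: Ck_mul; exact: Ck_cst. Qed.

Lemma Ck_sub m f g : Ck m f -> Ck m g -> Ck m (fun x => f x - g x).
Proof.
move=> Hf Hg; have -> : (fun x => f x - g x) = (fun x => f x + (-1) * g x).
  by apply/funext => x; rewrite mulN1r.
by apply: Ck_add => //; exact: Ck_scale.
Qed.

Lemma pdw_lin m w f g c : (size w <= m)%N -> Ck m f -> Ck m g ->
  pdw w (fun x => f x + c * g x) = fun x => pdw w f x + c * pdw w g x.
Proof.
elim: w => [//|i w IH] /= wm Hf Hg; rewrite IH ?(ltnW wm)//.
have [cf df _] : [/\ continuous (pdw w f), forall i x, derivable (pdw w f) x (delta_mx 0 i) & forall i, Ck 0 (pd i (pdw w f))].
  by apply/CkS/Ck_pdw/(CkW _ Hf); rewrite addn1.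
have [cg dg _] : [/\ continuous (pdw w g), forall i x, derivable (pdw w g) x (delta_mx 0 i) & forall i, Ck 0 (pd i (pdw w g))].
  by apply/CkS/Ck_pdw/(CkW _ Hg); rewrite addn1.
apply/funext => x; rewrite pdD//; last exact: derivableZ.
by rewrite pdZ.
Qed.

Lemma pdw_sub m w f g : (size w <= m)%N -> Ck m f -> Ck m g ->
  pdw w (fun x => f x - g x) = fun x => pdw w f x - pdw w g x.
Proof.
move=> wm Hf Hg; have := @pdw_lin m w f g (-1) wm Hf Hg.
by under eq_fun do rewrite mulN1r; under [in RHS]eq_fun do rewrite mulN1r.
Qed.

Lemma pdw_scale m w c f : (size w <= m)%N -> Ck m f ->
  pdw w (fun x => c * f x) = fun x => c * pdw w f x.
Proof.
move=> wm Hf; have := @pdw_lin m w (fun=> 0) f c wm (Ck_cst _ _) Hf.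
under eq_fun do rewrite add0r; move=> ->; apply/funext => x.
suff -> : pdw w (fun=> 0) = fun=> 0 :> R by rewrite add0r.
elim: w {wm} => //= i w ->; apply/funext => y; exact: derive_cst.
Qed.

Lemma pd_comm i j f : Ck 2 f -> pd i (pd j f) = pd j (pd i f).
Proof.
move=> /CkS[_ df H].
have [/CkS[_ di Hi] /CkS[_ dj Hj]] := (H i, H j).
apply: derive_comm => //.
- by have [] := Hj i.
- by have [] := Hi j.
Qed.

Lemma pd_pdw_comm i w f : Ck (size w).+1 f -> pd i (pdw w f) = pdw w (pd i f).
Proof.
elim: w f => [//|j w IH] f Hf; rewrite /= -IH; last exact: CkW Hf.
by apply: pd_comm; apply: Ck_pdw; rewrite addn2.
Qed.

(** The first letter of [w] is located in [w'] and moved across the prefix [a] by commuting partial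
    derivatives one at a time. *)
Lemma pdw_perm w w' f : Ck (size w) f -> perm_eq w w' -> pdw w f = pdw w' f.
Proof.
elim: w w' f => [|i w IH] w' f Hf.
  by rewrite perm_sym => /perm_nilP ->.
move=> p; have iw' : i \in w' by rewrite -(perm_mem p) mem_head.
have sw : size w' = (size w).+1 by rewrite -(perm_size p).
case/splitPr: iw' p sw => a b p sw.
have {}p : perm_eq w (a ++ b).
  move: p; rewrite -cat1s -[_ :: b]cat1s perm_sym perm_catCA perm_sym perm_cat2l.
  by [].
have sab : size w = (size a + size b)%N by rewrite (perm_size p) size_cat.
rewrite /= (IH (a ++ b))//; last exact: CkW Hf.
rewrite /pdw !foldr_cat /= -/(pdw a _) -/(pdw b _) -/(pdw a (pdw b f)) pd_pdw_comm//.
by apply: Ck_pdw; apply: CkW Hf; rewrite /= sab addnS ltnS addnC.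
Qed.

Definition word_of (iota : 'I_d -> nat) := flatten [seq nseq (iota i) i | i <- enum 'I_d].

Lemma pdm_word (iota : 'I_d -> nat) f : pdm iota f = pdw (word_of iota) f.
Proof.
rewrite /pdm /word_of /pdw; elim: (enum _) => //= i s ->.
by rewrite foldr_cat; elim: (iota i) => //= n ->.
Qed.

Lemma size_word_of (iota : 'I_d -> nat) : size (word_of iota) = (\sum_i iota i)%N.
Proof.
rewrite /word_of size_flatten /shape -map_comp sumnE big_map big_enum /=.
by apply: eq_bigr => i _; rewrite size_nseq.
Qed.

Lemma perm_word_count w : perm_eq w (word_of (fun i => count_mem i w)).
Proof.
apply/allP => i _ /=; apply/eqP.
rewrite /word_of count_flatten -map_comp sumnE big_map big_enum /=.
rewrite (bigD1 i)//= count_nseq /= eqxx mul1n big1 ?addn0// => j ji.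
by rewrite count_nseq /= (negbTE ji).
Qed.

Lemma pdw_pdm w f : Ck (size w) f -> pdw w f = pdm (fun i => count_mem i w) f.
Proof. by move=> Hf; rewrite pdm_word (pdw_perm Hf (perm_word_count w)). Qed.

End Words.

(** * Uniform bounds on all derivatives up to a given order *)

Section Bounded.
Context {R : realType} {d : nat}.
Implicit Types (f g : 'rV[R]_d -> R) (x : 'rV[R]_d) (w : seq 'I_d).

(** Real-valued counterpart of a bound on [CM_norm], with a supremum over words in place of the sum
    over multi-indices. The two agree up to the factor [nb_iota m] ([CM_normP], [Cb_CM_norm]). *)
Definition Cb m (B : R) f := Ck m f /\
  forall w, (size w <= m)%N -> forall x, `|pdw w f x| <= B.

Lemma CbS m B f : Cb m.+1 B f <->
  [/\ continuous f, forall x, `|f x| <= B, forall i x, derivable f x (delta_mx 0 i)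
    & forall i, Cb m B (pd i f)].
Proof.
split=> [[/CkS[cf df Hf] H]|[cf bf df H]].
  split=> //; first by move=> x; exact: (H [::]).
  by move=> i; split=> // w wm x; rewrite -pdw_rcons; apply: H; rewrite size_rcons.
split; first by apply/CkS; split=> // i; case: (H i).
move=> w; case/lastP: w => [|w i] wm x; first exact: bf.
by rewrite pdw_rcons; apply: (H i).2; rewrite size_rcons in wm.
Qed.

Lemma Cb_ge0 m B f : Cb m B f -> 0 <= B.
Proof. by move=> [_ /(_ [::] (leq0n _) 0)]; exact: le_trans. Qed.

Lemma CbW m n B B' f : (n <= m)%N -> B <= B' -> Cb m B f -> Cb n B' f.
Proof.
move=> nm BB [Hf H]; split; first exact: CkW Hf.
by move=> w wn x; apply: le_trans BB; apply: H; exact: leq_trans nm.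
Qed.

Lemma Cb_ext m B f g : f =1 g -> Cb m B f -> Cb m B g.
Proof. by move=> /funext ->. Qed.

Lemma Cb_pd m B f i : Cb m.+1 B f -> Cb m B (pd i f).
Proof. by case/CbS. Qed.

Lemma Cb_cst m (c : R) : Cb m `|c| (fun _ : 'rV[R]_d => c).
Proof.
split; first exact: Ck_cst.
move=> w _ x; case/lastP: w => [//|w i].
rewrite pdw_rcons; have -> : pd i (fun _ : 'rV[R]_d => c) = fun _ => 0 :> R.
  by apply/funext => y; exact: derive_cst.
suff -> : pdw w (fun=> 0) = fun=> 0 :> R by rewrite normr0.
by elim: w => //= j w ->; apply/funext => y; exact: derive_cst.
Qed.

Lemma Cb_add m A B f g : Cb m A f -> Cb m B g -> Cb m (A + B) (fun x => f x + g x).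
Proof.
move=> [Hf bf] [Hg bg]; split; first exact: Ck_add.
move=> w wm x; have := @pdw_lin _ _ m w f g 1 wm Hf Hg.
under eq_fun do rewrite mul1r; move=> ->; rewrite mul1r.
by apply: le_trans (ler_normD _ _) _; rewrite lerD// ?bf ?bg.
Qed.

(** Each derivative of the product has two terms, which doubles the constant at each order. *)
Lemma Cb_mul m A B f g : Cb m A f -> Cb m B g ->
  Cb m (2 ^+ m * (A * B)) (fun x => f x * g x).
Proof.
elim: m A B f g => [|m IH] A B f g.
  move=> [Hf bf] [Hg bg]; split; first exact: Ck_mul.
  move=> [|//] _ x; rewrite /= normrM expr0 mul1r ler_pM//.
  - exact: (bf [::]).
  - exact: (bg [::]).
move=> Hf Hg; have A0 := Cb_ge0 Hf; have B0 := Cb_ge0 Hg.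
case/CbS: (Hf) => cf bf df Df; case/CbS: (Hg) => cg bg dg Dg.
apply/CbS; split.
- exact: continuous_mul.
- move=> x; rewrite normrM; apply: (@le_trans _ _ (A * B)); first exact: ler_pM.
  by rewrite ler_peMl ?mulr_ge0// exprn_ege1// ler1n.
- by move=> i x; exact: derivableM.
move=> i; have -> : pd i (fun x => f x * g x) = fun x => pd i f x * g x + f x * pd i g x.
  by apply/funext => x; exact: pdM.
rewrite exprS -mulrA mulr_natl mulr2n; apply: Cb_add; apply: IH => //.
- exact: CbW (leqnSn m) (lexx _) Hg.
- exact: CbW (leqnSn m) (lexx _) Hf.
Qed.

Lemma Cb_scale m B f c : Cb m B f -> Cb m (`|c| * B) (fun x => c * f x).
Proof.
move=> [Hf bf]; split; first exact: Ck_scale.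
by move=> w wm x; rewrite (pdw_scale c wm Hf) normrM ler_wpM2l// bf.
Qed.

Lemma Cb_opp m B f : Cb m B f -> Cb m B (fun x => - f x).
Proof.
move=> /(@Cb_scale _ _ _ (-1)); rewrite normrN1 mul1r.
by apply: Cb_ext => x; rewrite mulN1r.
Qed.

Local Open Scope ereal_scope.

Lemma sup_norm_ge0 f : 0 <= sup_norm f.
Proof.
apply: (@le_trans _ _ (`|f 0%R|%:E)); first by rewrite lee_fin.
by apply: ereal_sup_ubound; exists 0%R.
Qed.

Lemma CM_norm_ge0 M f : 0 <= CM_norm M f.
Proof.
rewrite /CM_norm; case: asboolP => // _; apply: sume_ge0 => i _; exact: sup_norm_ge0.
Qed.

Lemma pdw_index M w f : (size w <= M)%N -> Ck (size w) f ->
  exists2 iota : {ffun 'I_d -> 'I_M.+1}, (\sum_i iota i <= M)%N &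
    pdw w f = pdm (fun i => iota i) f.
Proof.
move=> wM Hf.
have cM i : (count_mem i w < M.+1)%N by rewrite ltnS (leq_trans (count_size _ _)).
pose io : {ffun 'I_d -> 'I_M.+1} := [ffun i => Ordinal (cM i)].
exists io; last first.
  by rewrite pdw_pdm//; congr pdm; apply/funext => i; rewrite ffunE.
apply: leq_trans wM.
rewrite (perm_size (perm_word_count w)) size_word_of.
by under eq_bigr do rewrite ffunE.
Qed.

Lemma CM_normP M f (B : R) : CM_norm M f <= B%:E -> Cb M B f.
Proof.
(* Outside of C^M the norm is [+oo], which no real number bounds. *)
rewrite /CM_norm; case: asboolP => [Hf|_]; last by rewrite leye_eq.
move=> H; split=> // w wM x; have [io sio ->] := pdw_index wM (CkW wM Hf).
rewrite -lee_fin; apply: le_trans H.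
rewrite (bigD1 io)//=.
apply: (@le_trans _ _ (sup_norm (pdm (fun i => nat_of_ord (io i)) f))).
  by apply: ereal_sup_ubound; exists x.
by rewrite leeDl// sume_ge0// => i _; exact: sup_norm_ge0.
Qed.

Definition nb_iota M : R := #|[pred iota : {ffun 'I_d -> 'I_M.+1} | (\sum_i iota i <= M)%N]|%:R.

Lemma Cb_CM_norm M f (B : R) : Cb M B f -> CM_norm M f <= (nb_iota M * B)%:E.
Proof.
move=> [Hf H]; rewrite /CM_norm asboolT//.
rewrite /nb_iota mulr_natl -sumr_const -sumEFin.
apply: lee_sum => io ioM; apply: ge_ereal_sup => _ [x _ <-].
by rewrite lee_fin pdm_word; apply: H; rewrite size_word_of.
Qed.

End Bounded.

(** * Functions depending on time *)

Section TimeIncrement.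
Context {R : realType} {d : nat}.
Implicit Types (f g : 'rV[R]_d -> R) (x v : 'rV[R]_d) (w : seq 'I_d).

Lemma increment_le (h H : R -> R) (s t : R) : s <= t ->
  (forall r, s <= r <= t -> is_derive r (1:R) h (H r)) ->
  (forall r, s <= r <= t -> 0 <= H r) -> h s <= h t.
Proof.
move=> st dh H0.
have dh' r : r \in `[s, t] -> is_derive r (1:R) h (H r) by rewrite in_itv; exact: dh.
have ch : {within `[s, t], continuous h}.
  by apply: derivable_within_continuous => r rst; have [] := dh' r rst.
have dho r : r \in `]s, t[ -> is_derive r (1:R) h (H r).
  by move=> /subset_itv_oo_cc; exact: dh'.
have [c] := MVT_segment st dho ch.
rewrite in_itv /= => cst E; rewrite -subr_ge0 E mulr_ge0 ?subr_ge0//; exact: H0.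
Qed.

(** [Phi + g] and [Phi - g] are nondecreasing. This takes the place of integrating the bound [phi],
    of which [Phi] is a primitive. *)
Lemma scalar_increment (g G Phi phi : R -> R) (s t : R) : s <= t ->
  (forall r, s <= r <= t -> is_derive r (1:R) g (G r)) ->
  (forall r, s <= r <= t -> is_derive r (1:R) Phi (phi r)) ->
  (forall r, s <= r <= t -> `|G r| <= phi r) ->
  `|g t - g s| <= Phi t - Phi s.
Proof.
move=> st dg dP bG; rewrite ler_norml; apply/andP; split.
  have := @increment_le (Phi + g) (fun r => phi r + G r) s t st.
  have D r : s <= r <= t -> is_derive r (1:R) (Phi + g) (phi r + G r).
    by move=> rst; have := dg r rst; have := dP r rst => ? ?; exact: is_deriveD.
  move=> /(_ D) /=; have P r : s <= r <= t -> 0 <= phi r + G r.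
    by move=> /bG; rewrite ler_norml => /andP[]; lra.
  by move=> /(_ P); rewrite !fctE; lra.
have := @increment_le (Phi - g) (fun r => phi r - G r) s t st.
have D r : s <= r <= t -> is_derive r (1:R) (Phi - g) (phi r - G r).
  by move=> rst; have := dg r rst; have := dP r rst => ? ?; exact: is_deriveB.
move=> /(_ D) /=; have P r : s <= r <= t -> 0 <= phi r - G r.
  by move=> /bG; rewrite ler_norml => /andP[]; lra.
by move=> /(_ P); rewrite !fctE; lra.
Qed.

Lemma is_deriveP f x v (l : R) : is_derive x v f l <->
  forall e : R, 0 < e -> exists2 r : R, 0 < r &
    forall h : R, h != 0 -> `|h| < r -> `|h^-1 * (f (x + h *: v) - f x) - l| < e.
Proof.
have E : (fun h : R => h^-1 *: ((f \o shift x) (h *: v) - f x))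
    = (fun h : R => h^-1 * (f (x + h *: v) - f x)).
  by apply/funext => h /=; rewrite [h *: v + x]addrC.
split=> [[df <-] e e0|H].
  have [r /= r0 Hr] : nbhs_ball (0:R) (fun h => h != 0 ->
      `|'D_v f x - h^-1 *: ((f \o shift x) (h *: v) - f x)| < e).
    by apply/nbhs_ballP; exact: (@cvgr_dist_lt _ _ _ _ _ _ _ df e e0).
  exists r => // h h0 hr.
  have : ball (0:R) r h by rewrite -ball_normE /= sub0r normrN.
  move=> /Hr/(_ h0).
  by rewrite distrC -/(derive f x v) [h *: v + x]addrC.
have c : (fun h : R => h^-1 *: ((f \o shift x) (h *: v) - f x)) @ 0^' --> l.
  apply/cvgrPdist_lt => e /H[r r0 Hr]; apply/nbhs_ballP; exists r => // h /=.
  rewrite -ball_normE /= sub0r normrN distrC => hr h0.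
  by have := Hr h h0 hr; rewrite [h *: v + x]addrC.
by split; [apply/cvg_ex; exists l | exact: cvg_lim c].
Qed.

Lemma derive_bound f x v (B : R) : derivable f x v ->
  (forall h : R, h != 0 -> `|h^-1 * (f (x + h *: v) - f x)| <= B) -> `|'D_v f x| <= B.
Proof.
move=> /derivableP/is_deriveP df H.
apply/ler_addgt0Pl => e /df[r r0 Hr].
have r20 : r / 2 != 0 by rewrite gt_eqF// divr_gt0.
have := Hr _ r20; rewrite gtr0_norm ?divr_gt0// ltr_pdivrMr// => /(_ ltac:(lra)).
have := H _ r20; set q := _^-1 * _; clearbody q; move=> qB qe.
have -> : 'D_v f x = q - (q - 'D_v f x) by ring.
by apply: (le_trans (ler_normB _ _)); rewrite addrC; apply: lerD => //; exact: ltW.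
Qed.

Lemma pd_shift i f (a : 'rV[R]_d) :
  pd i (fun x => f (x + a)) = fun x => pd i f (x + a).
Proof.
apply/funext => x; rewrite /pd /derive.
by under eq_fun do rewrite /= -addrA.
Qed.

Lemma pdw_shift w f (a : 'rV[R]_d) :
  pdw w (fun x => f (x + a)) = fun x => pdw w f (x + a).
Proof. by elim: w => //= i w ->; exact: pd_shift. Qed.

Lemma derivable_shift f x v (a : 'rV[R]_d) :
  derivable f (x + a) v -> derivable (fun x => f (x + a)) x v.
Proof.
by rewrite /derivable; under eq_fun do rewrite /= addrA.
Qed.

Lemma Ck_shift m f (a : 'rV[R]_d) : Ck m f -> Ck m (fun x => f (x + a)).
Proof.
have ca g : continuous g -> continuous (fun x => g (x + a)).
  move=> cg x; apply: (@continuous_comp _ _ _ (fun x => x + a) g); last exact: cg.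
  apply/(@cvgrPdist_lt _ _ _ (nbhs x) (nbhs_filter x)) => e e0.
  suff : nbhs_ball_ (ball_ (@Num.norm R 'rV[R]_d)) x (fun t => `|x + a - (t + a)| < e).
    by move/nbhs_normP.
  by exists e => // y /=; rewrite opprD addrACA subrr addr0.
elim: m f => [|m IH] f; first by move=> [cf _]; split=> //; exact: ca.
move=> /CkS[cf df Hf]; apply/CkS; split; [exact: ca| |].
- by move=> i x; exact: derivable_shift.
- by move=> i; rewrite pd_shift; exact: IH.
Qed.

(* Only [f] itself is differentiated in time; the bound reaches its spatial
   derivatives through their difference quotients, by induction on [w]. *)
Lemma time_increment m (f F : R -> 'rV[R]_d -> R) (Phi phi : R -> R) (s t : R) w :
  s <= t -> (size w <= m)%N -> Ck m (f s) -> Ck m (f t) ->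
  (forall r, s <= r <= t -> Ck m (F r)) ->
  (forall x r, s <= r <= t -> is_derive r (1:R) (fun r => f r x) (F r x)) ->
  (forall r, s <= r <= t -> is_derive r (1:R) Phi (phi r)) ->
  (forall x r, s <= r <= t -> `|pdw w (F r) x| <= phi r) ->
  forall x, `|pdw w (f t) x - pdw w (f s) x| <= Phi t - Phi s.
Proof.
move=> st wm Hs Ht HF df dP; elim: w f F wm Hs Ht HF df => [|i w IH] f F wm Hs Ht HF df bF x.
  by apply: (@scalar_increment (fun r => f r x) (fun r => F r x) _ phi) => // r; exact: bF.
have dw g : Ck m g -> forall x, derivable (pdw w g) x (delta_mx 0 i).
  move=> Hg; have /CkS[_ dg _] : Ck 1 (pdw w g).
    by apply: Ck_pdw; apply: CkW Hg; rewrite addn1.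
  exact: dg.
pose v : 'rV[R]_d := delta_mx 0 i.
have E : pdw (i :: w) (f t) x - pdw (i :: w) (f s) x
    = 'D_v (fun x => pdw w (f t) x - pdw w (f s) x) x.
  by rewrite /= -(pdB (dw _ Ht x) (dw _ Hs x)).
rewrite {}E.
apply: derive_bound; first by apply: derivableB; exact: dw.
move=> h h0.
(* The induction hypothesis is applied to the difference quotients [q (f r)]. Their time derivative
   is [q (F r)], whose derivative along [w] is, by the mean value theorem, a value of the derivative
   of [F r] along [i :: w], hence bounded by [phi r]. *)
pose q g x := h^-1 * (g (x + h *: v) - g x) : R.
have Hq g : Ck m g -> Ck m (q g).
  by move=> Hg; apply: Ck_scale; apply: Ck_sub => //; exact: Ck_shift.
have qw g : Ck m g -> pdw w (q g) = q (pdw w g).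
  move=> Hg; rewrite /q (@pdw_scale _ _ m) ?(ltnW wm)//; last first.
    by apply: Ck_sub => //; exact: Ck_shift.
  by rewrite (@pdw_sub _ _ m) ?(ltnW wm) ?pdw_shift//; exact: Ck_shift.
have := @IH (fun r => q (f r)) (fun r => q (F r)) (ltnW wm) (Hq _ Hs) (Hq _ Ht)
  (fun r rst => Hq _ (HF r rst)) _ _ x.
rewrite !qw// /q => IHx.
have -> : pdw w (f t) (x + h *: v) - pdw w (f s) (x + h *: v)
    - (pdw w (f t) x - pdw w (f s) x)
  = pdw w (f t) (x + h *: v) - pdw w (f t) x - (pdw w (f s) (x + h *: v) - pdw w (f s) x).
  by ring.
rewrite mulrBr; apply: IHx.
- move=> y r rst; have d1 := df (y + h *: v) r rst; have d2 := df y r rst.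
  exact: is_deriveZ.
- move=> y r rst; rewrite -/(q (F r)) qw; last exact: HF.
  rewrite /q; have [c _ ->] := mvt_line y h (dw _ (HF r rst)).
  by rewrite mulrA mulVf// mul1r; exact: bF.
Qed.

Lemma nbhs_oo_cvg (u : nat -> R) (l : R) : u @ \oo --> l ->
  forall e : R, 0 < e -> exists N, forall n, (N <= n)%N -> `|u n - l| < e.
Proof.
move=> /cvgrPdist_lt H e /H[N _ HN]; exists N => n Nn.
by rewrite distrC; exact: HN.
Qed.

Lemma real_limit (u e : nat -> R) : e @ \oo --> 0 ->
  (forall j n, (n <= j)%N -> `|u j - u n| <= e n) ->
  u @ \oo --> lim (u @ \oo) /\ forall n, `|lim (u @ \oo) - u n| <= e n.
Proof.
move=> e0 H.
have cu : cvgn u.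
  apply: cauchy_cvg; apply: cauchy_exP => d' d0.
  have [N HN] := nbhs_oo_cvg e0 d0.
  exists (u N); exists N => // j Nj /=; rewrite -ball_normE /= distrC.
  apply: le_lt_trans (H _ _ Nj) _.
  by have := HN N (leqnn _); rewrite subr0; apply: le_lt_trans; exact: ler_norm.
split=> // n; apply/ler_addgt0Pl => d' d0.
have [N HN] := nbhs_oo_cvg cu d0.
have := HN (maxn N n) (leq_maxl _ _); have := H (maxn N n) n (leq_maxr _ _).
set a := u (maxn _ _); clearbody a => an al.
have -> : lim (u @ \oo) - u n = (a - u n) - (a - lim (u @ \oo)) by ring.
by apply: (le_trans (ler_normB _ _)); rewrite addrC; apply: lerD => //; exact: ltW.
Qed.

Lemma uniform_limit_continuous (g : nat -> 'rV[R]_d -> R) G (e : nat -> R) :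
  e @ \oo --> 0 -> (forall n, continuous (g n)) ->
  (forall n x, `|G x - g n x| <= e n) -> continuous G.
Proof.
move=> e0 cg H x; apply/(@cvgrPdist_lt _ _ _ (nbhs x) (nbhs_filter x)) => d' d0.
have d30 : 0 < d' / 3 by rewrite divr_gt0.
have [N HN] := nbhs_oo_cvg e0 d30.
have {}HN : e N < d' / 3.
  by have := HN N (leqnn _); rewrite subr0; apply: le_lt_trans; exact: ler_norm.
apply: (@filterS _ (nbhs x) (nbhs_filter x) _ _ _
  (@cvgr_dist_lt _ _ _ _ _ _ _ (cg N x) _ d30)) => y Hy.
have -> : G x - G y = (G x - g N x) - (G y - g N y) + (g N x - g N y) by ring.
apply: le_lt_trans (ler_normD _ _) _.
have := ler_normB (G x - g N x) (G y - g N y); have := H N x; have := H N y; lra.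
Qed.

(** By the mean value theorem the difference quotients of [g j - g N] are at most [e N], uniformly
    in [h]; hence j can tend to infinity with [h] fixed, before [h] tends to 0. *)
Lemma uniform_limit_derive (g : nat -> 'rV[R]_d -> R) G L v (e : nat -> R) :
  e @ \oo --> 0 -> (forall n x, derivable (g n) x v) ->
  (forall x, g n x @[n --> \oo] --> G x) ->
  (forall j n, (n <= j)%N -> forall x, `|'D_v (g j) x - 'D_v (g n) x| <= e n) ->
  (forall n x, `|L x - 'D_v (g n) x| <= e n) ->
  forall x, is_derive x v G (L x).
Proof.
move=> e0 dg cG H HL x; apply/is_deriveP => d' d0.
have d30 : 0 < d' / 3 by rewrite divr_gt0.
have [N HN] := nbhs_oo_cvg e0 d30.
have {}HN : e N < d' / 3.
  by have := HN N (leqnn _); rewrite subr0; apply: le_lt_trans; exact: ler_norm.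
have [r r0 Hr] := (is_deriveP _ _ _ _).1 (derivableP (dg N x)) _ d30.
exists r => // h h0 hr.
have Q j : (N <= j)%N -> `|h^-1 * (g j (x + h *: v) - g j x) - h^-1 * (g N (x + h *: v) - g N x)| <= e N.
  move=> Nj; have dd y : derivable (fun y => g j y - g N y) y v by exact: derivableB.
  have [c _ E] := mvt_line x h dd.
  rewrite -mulrBr.
  have -> : g j (x + h *: v) - g j x - (g N (x + h *: v) - g N x)
    = g j (x + h *: v) - g N (x + h *: v) - (g j x - g N x) by ring.
  rewrite E mulrA mulVf// mul1r.
  by have -> := deriveB (dg j (x + c *: v)) (dg N (x + c *: v)); exact: H.
have Q' : `|h^-1 * (G (x + h *: v) - G x) - h^-1 * (g N (x + h *: v) - g N x)| <= e N.
  have c : (fun j => `|h^-1 * (g j (x + h *: v) - g j x) - h^-1 * (g N (x + h *: v) - g N x)|)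
     @ \oo --> `|h^-1 * (G (x + h *: v) - G x) - h^-1 * (g N (x + h *: v) - g N x)|.
    apply: cvg_norm; apply: cvgB; last exact: cvg_cst.
    by apply: cvgM; [exact: cvg_cst|apply: cvgB; exact: cG].
  apply: (@closed_cvg _ _ _ _ _ [set y | y <= e N] _ _ _ c); first exact: closed_le.
  by exists N.
have := Hr h h0 hr; have := HL N x.
move: Q'; set a := h^-1 * (G _ - _); set b := h^-1 * (g N _ - _); clearbody a b.
set D := 'D_v _ x; clearbody D => B1 B2 B3.
have -> : a - L x = (a - b) - (L x - D) + (b - D) by ring.
apply: le_lt_trans (ler_normD _ _) _.
have := ler_normB (a - b) (L x - D); lra.
Qed.

(** Completeness of C^m, the Cauchy modulus [e] being kept as the rate of convergence. It serves for
    Sobolev approximations as well as for limits as t tends to infinity. The induction is applied to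
    the sequences of first derivatives. *)
Lemma Ck_limit m (g : nat -> 'rV[R]_d -> R) (e : nat -> R) :
  e @ \oo --> 0 -> (forall n, Ck m (g n)) ->
  (forall w, (size w <= m)%N -> forall j n, (n <= j)%N ->
     forall x, `|pdw w (g j) x - pdw w (g n) x| <= e n) ->
  let G := fun x => lim (g n x @[n --> \oo]) in
  Ck m G /\ forall w, (size w <= m)%N -> forall n x, `|pdw w G x - pdw w (g n) x| <= e n.
Proof.
move=> e0; elim: m g => [|m IH] g Hg H G.
  have bG n x : `|G x - g n x| <= e n.
    by apply: (real_limit e0 (fun j n jn => H [::] isT j n jn x)).2.
  split; last by move=> [].
  split=> //; apply: (uniform_limit_continuous e0) => [n|n x]; last exact: bG.
  exact: Ck_cont (Hg n).
have cG x : g n x @[n --> \oo] --> G x.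
  by apply: (real_limit e0 (fun j n jn => H [::] isT j n jn x)).1.
have bG n x : `|G x - g n x| <= e n.
  by apply: (real_limit e0 (fun j n jn => H [::] isT j n jn x)).2.
pose L i x := lim (pd i (g n) x @[n --> \oo]).
have IHi i : Ck m (L i) /\ forall w, (size w <= m)%N -> forall n x, `|pdw w (L i) x - pdw w (pd i (g n)) x| <= e n.
  apply: IH => [n|w wm j n nj x]; first by have [_ _] := (CkS _ _).1 (Hg n); exact.
  by rewrite -!pdw_rcons; apply: H => //; rewrite size_rcons.
have dG i x : is_derive x (delta_mx 0 i) G (L i x).
  apply: (uniform_limit_derive e0 _ cG) => [n y|j n nj y|n y].
  - by have [_ + _] := (CkS _ _).1 (Hg n); exact.
  - exact: (H [:: i]).
  - exact: ((IHi i).2 [::]).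
have EL i : pd i G = L i by apply/funext => x; have [] := dG i x.
split.
  apply/CkS; split.
  - apply: (uniform_limit_continuous e0) => [n|n x]; last exact: bG.
    exact: Ck_cont (Hg n).
  - by move=> i x; have [] := dG i x.
  - by move=> i; rewrite EL; exact: (IHi i).1.
move=> w; case/lastP: w => [|w i] wm n x; first exact: bG.
by rewrite !pdw_rcons EL; apply: (IHi i).2; rewrite size_rcons in wm.
Qed.

End TimeIncrement.

(** * Sobolev embedding on the torus *)

Section UnitInterval.
Context {R : realType}.
Local Notation mu := (@lebesgue_measure R).
Implicit Types f g : R -> R.

Definition avg f : R := (\int[mu]_(x in `[0%R, 1%R]) f x)%R.

Lemma measurable01 : measurable (`[0%R, 1%R] : set R).
Proof. exact: measurable_itv. Qed.

Lemma integrable_seg f (p q : R) : continuous f -> mu.-integrable `[p, q] (EFin \o f).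
Proof.
move=> cf; apply: continuous_compact_integrable; first exact: segment_compact.
exact: continuous_subspaceT.
Qed.

Lemma avgE f : continuous f -> (\int[mu]_(x in `[0%R, 1%R]) (f x)%:E)%E = (avg f)%:E.
Proof.
move=> cf; rewrite /avg /Rintegral fineK//; apply: integrable_fin_num; first exact: measurable01.
exact: integrable_seg.
Qed.

Lemma avg_le f g : continuous f -> continuous g ->
  (forall x, 0 <= x <= 1 -> f x <= g x) -> avg f <= avg g.
Proof.
move=> cf cg H; apply: le_Rintegral; [exact: measurable01|exact: integrable_seg..|].
by move=> x; rewrite /= in_itv; exact: H.
Qed.

Lemma avgD f g : continuous f -> continuous g -> avg (fun x => f x + g x) = avg f + avg g.
Proof.
by move=> cf cg; apply: RintegralD; [exact: measurable01|exact: integrable_seg..].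
Qed.

Lemma avgZ f (c : R) : continuous f -> avg (fun x => c * f x) = c * avg f.
Proof.
by move=> cf; apply: RintegralZl; [exact: measurable01|exact: integrable_seg..].
Qed.

Lemma avg_cst (c : R) : avg (fun=> c) = c.
Proof.
rewrite /avg Rintegral_cst; last exact: measurable01.
rewrite -[RHS]mulr1; congr (_ * _); rewrite -[RHS]/(fine 1%:E); congr fine.
by apply: (etrans (lebesgue_measure_itv _)); rewrite /= lte_fin ltr01 oppr0 adde0.
Qed.

Lemma cst_cont (c : R) : continuous (fun _ : R => c).
Proof. by move=> x; exact: cst_continuous. Qed.

Lemma avg_norm f (M : R) : continuous f -> (forall x, `|f x| <= M) -> `|avg f| <= M.
Proof.
move=> cf fM; have cc := cst_cont.
rewrite ler_norml -{1}(avg_cst (- M)) -{2}(avg_cst M); apply/andP; split.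
  by apply: avg_le => // x _; have := fM x; rewrite ler_norml => /andP[].
by apply: avg_le => // x _; have := fM x; rewrite ler_norml => /andP[].
Qed.

(** Continuity under the integral sign, with the constant [M] as integrable majorant. *)
Lemma avg_param (F : R -> R -> R) (M : R) : (forall x y, `|F x y| <= M) ->
  (forall y, continuous (F ^~ y)) -> (forall x, continuous (F x)) ->
  continuous (fun x => avg (F x)).
Proof.
move=> FM c1 c2 x.
have H : {in `]x - 1, x + 1[%classic, continuous (fun l => \int[mu]_(y in `[0%R, 1%R]) F l y)%R}.
  apply: (@continuity_under_integral R _ _ mu F `[0%R, 1%R] measurable01 _ _ _ _ (fun=> M)).
  - by move=> z _; exact: integrable_seg.
  - by apply: aeW => y _ z _; exact: c1.
  - exact: (@integrable_seg (fun=> M) 0 1 (@cst_cont M)).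
  - by move=> z _; apply: aeW => y _; exact: FM.
by apply: H; rewrite inE /= in_itv /=; apply/andP; split; lra.
Qed.

Lemma avg_eq0 f : continuous f -> (forall x, 0 <= f x) -> avg f <= 0 ->
  forall x, 0 <= x <= 1 -> f x = 0.
Proof.
move=> cf f0 A x /andP[x0 x1]; apply/eqP; rewrite eq_le f0 andbT leNgt; apply/negP => fx.
have fx2 : 0 < f x / 2 by rewrite divr_gt0.
have : nbhs_ball_ (ball_ (@Num.norm R R)) x (fun y => `|f x - f y| < f x / 2).
  by apply/nbhs_normP; exact: (@cvgr_dist_lt _ _ _ _ _ f (f x) (cf x) _ fx2).
move=> [r /= r0 Hr].
have [p [q [pq p0 q1 Hpq]]] : exists p q, [/\ p < q, 0 <= p, q <= 1 &
    forall y, p <= y <= q -> `|x - y| < r].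
  (* The subinterval lies on the side of [x] that faces 1/2 and has length at most 1/2, so it stays
     in [0, 1]. *)
  pose r' := Num.min (r / 2) (1 / 2).
  have r'0 : 0 < r' by rewrite lt_min !divr_gt0.
  have r'r : r' < r by rewrite gt_min ltr_pdivrMr//; apply/orP; left; lra.
  have r'2 : r' <= 1/2 by rewrite ge_min lexx orbT.
  have [xh|xh] := leP x (1/2).
    exists x, (x + r'); split; [lra|lra|lra|] => y /andP[??].
    by rewrite distrC ger0_norm; lra.
  exists (x - r'), x; split; [lra|lra|lra|] => y /andP[??].
  by rewrite ger0_norm; lra.
have sub : `[p, q] `<=` `[0%R, 1%R].
  by move=> y /=; rewrite !in_itv /= => /andP[? ?]; apply/andP; split; lra.
have H1 : (\int[mu]_(y in `[p, q]) (f y)%:E <= (avg f)%:E)%E.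
  rewrite -avgE//; apply: ge0_subset_integral => //; try exact: measurable_itv.
  - by have /integrableP[] := integrable_seg 0 1 cf.
  - by move=> y _; rewrite lee_fin.
have H2 : ((f x / 2 * (q - p))%:E <= \int[mu]_(y in `[p, q]) (f y)%:E)%E.
  have -> : (f x / 2 * (q - p))%:E = (\int[mu]_(y in `[p, q]) (cst (f x / 2)%:E y))%E.
    rewrite integral_cst; last exact: measurable_itv.
    rewrite EFinM; congr mule; apply/esym/(etrans (lebesgue_measure_itv _)).
    by rewrite /= lte_fin pq -EFinB.
  apply: ge0_le_integral => //; try exact: measurable_itv.
  - by move=> y _; rewrite lee_fin ltW.
  - by have /integrableP[] := integrable_seg p q cf.
  - move=> y /=; rewrite in_itv => /Hpq/Hr; rewrite lee_fin ltr_norml => /andP[_].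
    by lra.
have := le_trans H2 H1; rewrite lee_fin => /le_trans/(_ A).
rewrite leNgt => /negP; apply; rewrite mulr_gt0//; lra.
Qed.

(** As |2 f f'| <= f^2 + f'^2, the values of f^2 at two points of [0, 1] differ by at most the
    integral of f^2 + f'^2. Averaging over the second point gives the factor 2. *)
Lemma sobolev1 f (df : R -> R) : (forall x, is_derive x (1:R) f (df x)) -> continuous df ->
  forall x, 0 <= x <= 1 -> f x ^+ 2 <= 2 * avg (fun y => f y ^+ 2 + df y ^+ 2).
Proof.
move=> Df cdf.
have cf : continuous f.
  by move=> x; apply: differentiable_continuous; apply/derivable1_diffP; case: (Df x).
have csq (g : R -> R) : continuous g -> continuous (fun x => g x ^+ 2).
  by move=> cg x; exact: (@continuousM _ _ g g x (cg x) (cg x)).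
pose Q y := f y ^+ 2 + df y ^+ 2.
have cQ : continuous Q.
  by move=> x; exact: (@continuousD _ _ _ _ _ x (csq _ cf x) (csq _ cdf x)).
have Q0 y : 0 <= Q y by rewrite addr_ge0// sqr_ge0.
have cP : continuous (fun y => 2 * f y * df y).
  move=> x; apply: (@continuousM _ _ (fun y => 2 * f y) df x); last exact: cdf.
  by apply: (@continuousM _ _ (fun=> 2) f x); [exact: cvg_cst|exact: cf].
have DF (c : R) x : is_derive x (1:R) (fun y => c * f y ^+ 2) (c * (2 * f x * df x)).
  have -> : c * (2 * f x * df x) = c *: (f x *: df x + f x *: df x).
    by rewrite /GRing.scale /=; ring.
  apply: is_deriveZ; exact: is_deriveM.
(* The sign [c] covers both orders of the two points. *)
have step (c : R) p q : c = 1 \/ c = -1 -> 0 <= p -> p <= q -> q <= 1 ->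
    c * f q ^+ 2 - c * f p ^+ 2 <= avg Q.
  move=> hc p0; rewrite le_eqVlt => /predU1P[->|pq] q1.
    rewrite subrr; have := @avg_le (fun=> 0) Q (@cst_cont 0) cQ (fun x _ => Q0 x).
    by rewrite avg_cst.
  have cP' : continuous (fun y => c * (2 * f y * df y)).
    by move=> x; apply: (@continuousM _ _ (fun=> c) _ x); [exact: cvg_cst|exact: cP].
  have cF : continuous (fun y => c * f y ^+ 2).
    by move=> x; apply: differentiable_continuous; apply/derivable1_diffP; case: (DF c x).
  have := @continuous_FTC2 R (fun y => c * (2 * f y * df y)) (fun y => c * f y ^+ 2) p q pq.
  move=> /(_ (continuous_subspaceT cP')) FTC.
  rewrite -lee_fin EFinB -FTC; last 2 first.
  - split; first by move=> x _; case: (DF c x).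
    + exact: cvg_at_right_filter (cF p).
    + exact: cvg_at_left_filter (cF q).
  - by move=> x _; rewrite derive1E; case: (DF c x).
  apply: (@le_trans _ _ (\int[mu]_(y in `[p, q]) (Q y)%:E)%E).
    apply: le_integral; try exact: integrable_seg; first exact: measurable_itv.
    move=> x _; rewrite lee_fin /Q.
    have := sqr_ge0 (f x - df x); have := sqr_ge0 (f x + df x).
    by case: hc => ->; nra.
  rewrite -avgE//; apply: ge0_subset_integral => //; try exact: measurable_itv.
  - by have /integrableP[] := integrable_seg 0 1 cQ.
  - by move=> y _; rewrite lee_fin.
  - by move=> y /=; rewrite !in_itv /= => /andP[? ?]; apply/andP; split; lra.
move=> x /andP[x0 x1].
have P y : 0 <= y <= 1 -> f x ^+ 2 - avg Q <= f y ^+ 2.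
  move=> /andP[y0 y1]; have [xy|yx] := leP x y.
    by have := step (-1) _ _ (or_intror erefl) x0 xy y1; lra.
  by have := step 1 _ _ (or_introl erefl) y0 (ltW yx) x1; lra.
have := @avg_le (fun=> f x ^+ 2 - avg Q) _ (@cst_cont _) (csq _ cf) P; rewrite avg_cst.
have : avg (fun y => f y ^+ 2) <= avg Q.
  by apply: avg_le => // [|y _]; [exact: csq|rewrite lerDl sqr_ge0].
by rewrite -/Q; lra.
Qed.

End UnitInterval.

(** * Averages over the unit cube and the embedding of H^{m+3} in C^m *)

Section Cube.
Context {R : realType}.
Local Notation T3 := 'rV[R]_3.
Local Notation mu := (@lebesgue_measure R).
Implicit Types (F G : T3 -> R).

Definition ax0 : 'I_3 := @Ordinal 3 0 isT.
Definition ax1 : 'I_3 := @Ordinal 3 1 isT.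
Definition ax2 : 'I_3 := @Ordinal 3 2 isT.

Lemma vec3E (a b c : R) : vec3 a b c =
  a *: delta_mx 0 ax0 + b *: delta_mx 0 ax1 + c *: delta_mx 0 ax2 :> T3.
Proof.
apply/rowP => i; rewrite !mxE /=.
by case: i => -[|[|[|//]]] iP; rewrite /= ?mulr1 ?mulr0 ?addr0 ?add0r.
Qed.

Lemma vec3_coord (x : T3) : x = vec3 (x 0 ax0) (x 0 ax1) (x 0 ax2).
Proof.
apply/rowP => i; rewrite !mxE /=.
by case: i => -[|[|[|//]]] iP /=; congr (x _ _); apply/val_inj.
Qed.

Lemma continuous_line F (x v : T3) : continuous F -> continuous (fun a : R => F (x + a *: v)).
Proof.
move=> cF a; apply: (@continuous_comp R _ R (fun a : R => x + a *: v) F); last exact: cF.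
apply: (@cvgD _ _ _ _ (nbhs_filter a)); first exact: cvg_cst.
by apply: (@cvgZr_tmp _ _ _ _ (nbhs_filter a)); exact: cvg_id.
Qed.

Lemma continuous_ax0 F b c : continuous F -> continuous (fun a => F (vec3 a b c)).
Proof.
move=> cF; suff -> : (fun a => F (vec3 a b c))
    = (fun a => F (vec3 0 b c + a *: delta_mx 0 ax0)) by exact: continuous_line.
apply/funext => a; congr F; by rewrite !vec3E scale0r add0r [RHS]addrC addrA.
Qed.

Lemma continuous_ax1 F a c : continuous F -> continuous (fun b => F (vec3 a b c)).
Proof.
move=> cF; suff -> : (fun b => F (vec3 a b c))
    = (fun b => F (vec3 a 0 c + b *: delta_mx 0 ax1)) by exact: continuous_line.
apply/funext => b; congr F; by rewrite !vec3E scale0r addr0 addrAC.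
Qed.

Lemma continuous_ax2 F a b : continuous F -> continuous (fun c => F (vec3 a b c)).
Proof.
move=> cF; suff -> : (fun c => F (vec3 a b c))
    = (fun c => F (vec3 a b 0 + c *: delta_mx 0 ax2)) by exact: continuous_line.
apply/funext => c; congr F; by rewrite !vec3E scale0r addr0.
Qed.

(** The bound is the constant majorant that [avg_param] asks for, so that all partial averages are
    continuous. Periodic continuous functions qualify ([periodic_bcont]). *)
Definition bcont F := continuous F /\ exists M : R, forall x, `|F x| <= M.

Lemma bcont_add F G : bcont F -> bcont G -> bcont (fun x => F x + G x).
Proof.
move=> [cF [M FM]] [cG [N GN]]; split; first exact: continuous_add.
by exists (M + N) => x; apply: le_trans (ler_normD _ _) _; exact: lerD.
Qed.

Lemma bcont_mul F G : bcont F -> bcont G -> bcont (fun x => F x * G x).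
Proof.
move=> [cF [M FM]] [cG [N GN]]; split; first exact: continuous_mul.
by exists (M * N) => x; rewrite normrM; exact: ler_pM.
Qed.

Lemma bcont_cst (c : R) : bcont (fun=> c).
Proof. by split; [move=> x; exact: cst_continuous | exists `|c|]. Qed.

Lemma bcont_sqr F : bcont F -> bcont (fun x => F x ^+ 2).
Proof. by move=> bF; exact: bcont_mul. Qed.

Lemma bcont_sub F G : bcont F -> bcont G -> bcont (fun x => F x - G x).
Proof.
move=> bF bG; have := bcont_add bF (bcont_mul (bcont_cst (-1)) bG).
by under eq_fun do rewrite mulN1r.
Qed.

Definition avg2 F (a b : R) := avg (fun c => F (vec3 a b c)).
Definition avg3 F := avg (fun a => avg (avg2 F a)).

Lemma avg2_cont1 F a : bcont F -> continuous (avg2 F a).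
Proof.
move=> [cF [M FM]]; apply: (@avg_param _ (fun b c => F (vec3 a b c)) M) => //.
- by move=> c; exact: continuous_ax1.
- by move=> b; exact: continuous_ax2.
Qed.

Lemma avg2_cont0 F b : bcont F -> continuous (avg2 F ^~ b).
Proof.
move=> [cF [M FM]]; apply: (@avg_param _ (fun a c => F (vec3 a b c)) M) => //.
- by move=> c; exact: continuous_ax0.
- by move=> a; exact: continuous_ax2.
Qed.

Lemma avg2_avg_cont F : bcont F -> continuous (fun a => avg (avg2 F a)).
Proof.
move=> bF; have [cF [M FM]] := bF; apply: (@avg_param _ (avg2 F) M) => //.
- by move=> a b; apply: avg_norm => //; exact: continuous_ax2.
- by move=> b; exact: avg2_cont0.
- by move=> a; exact: avg2_cont1.
Qed.

Lemma avg3_le F G : bcont F -> bcont G ->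
  (forall a b c, 0 <= a <= 1 -> 0 <= b <= 1 -> 0 <= c <= 1 ->
     F (vec3 a b c) <= G (vec3 a b c)) -> avg3 F <= avg3 G.
Proof.
move=> bF bG H; apply: avg_le => [||a a01]; [exact: avg2_avg_cont..|].
apply: avg_le => [||b b01]; [exact: avg2_cont1..|].
by apply: avg_le => [||c c01]; [exact: continuous_ax2 bF.1|exact: continuous_ax2 bG.1|exact: H].
Qed.

Lemma avg3D F G : bcont F -> bcont G -> avg3 (fun x => F x + G x) = avg3 F + avg3 G.
Proof.
move=> bF bG; rewrite /avg3 -avgD; [|exact: avg2_avg_cont..].
congr avg; apply/funext => a; rewrite -avgD; [|exact: avg2_cont1..].
congr avg; apply/funext => b; rewrite /avg2 -avgD //.
- exact: continuous_ax2 bF.1.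
- exact: continuous_ax2 bG.1.
Qed.

Lemma avg3_cst (c : R) : avg3 (fun=> c) = c.
Proof.
rewrite /avg3 /avg2; under eq_fun do under eq_fun do rewrite avg_cst.
by under eq_fun do rewrite avg_cst; rewrite avg_cst.
Qed.

Lemma avg3Z F (c : R) : bcont F -> avg3 (fun x => c * F x) = c * avg3 F.
Proof.
move=> bF; rewrite /avg3 -avgZ; [|exact: avg2_avg_cont..].
congr avg; apply/funext => a; rewrite -avgZ; [|exact: avg2_cont1..].
congr avg; apply/funext => b; rewrite /avg2 -avgZ //.
exact: continuous_ax2 bF.1.
Qed.

Lemma avg_ge0 (f : R -> R) : continuous f -> (forall x, 0 <= f x) -> 0 <= avg f.
Proof.
by move=> cf f0; rewrite -(avg_cst 0); apply: avg_le => //; exact: cst_cont.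
Qed.

Lemma avg3_eq0 F : bcont F -> (forall x, 0 <= F x) -> avg3 F <= 0 ->
  forall a b c, 0 <= a <= 1 -> 0 <= b <= 1 -> 0 <= c <= 1 -> F (vec3 a b c) = 0.
Proof.
move=> bF F0 H a b c a01 b01 c01.
have G0 a' b' : 0 <= avg2 F a' b' by apply: avg_ge0 => //; exact: continuous_ax2 bF.1.
have H0 a' : 0 <= avg (avg2 F a') by apply: avg_ge0 => //; exact: avg2_cont1.
have eq_le0 (r : R) : r = 0 -> r <= 0 by move=> ->.
have Ha := avg_eq0 (avg2_avg_cont bF) H0 H a01.
have Hb := avg_eq0 (@avg2_cont1 F a bF) (G0 a) (eq_le0 _ Ha) b01.
exact: (avg_eq0 (@continuous_ax2 F a b bF.1) (fun c => F0 _) (eq_le0 _ Hb) c01).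
Qed.

Lemma L2_sqE F : bcont F -> L2_sq F = (avg3 (fun x => F x ^+ 2))%:E.
Proof.
move=> /bcont_sqr bF; rewrite /L2_sq /avg3 -avgE; last exact: avg2_avg_cont.
apply: eq_integral => a _; rewrite -avgE; last exact: avg2_cont1.
apply: eq_integral => b _; rewrite /avg2 -avgE //.
by apply: (@continuous_ax2 (fun x => F x ^+ 2)); case: bF.
Qed.

Lemma periodic_int F i (k : int) x : z3_periodic F ->
  F (x + k%:~R *: delta_mx 0 i) = F x.
Proof.
move=> pF; have P n y : F (y + n%:R *: delta_mx 0 i) = F y.
  elim: n y => [|n IH] y; first by rewrite scale0r addr0.
  by rewrite -[n.+1%:R]natr1 scalerDl scale1r addrA pF.
case: k => n; first exact: P.
by rewrite NegzE -(P n.+1) mulrNz scaleNr subrK.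
Qed.

Lemma periodic_cube F x : z3_periodic F -> exists a b c,
  [/\ 0 <= a <= 1, 0 <= b <= 1, 0 <= c <= 1 & F x = F (vec3 a b c)].
Proof.
move=> pF.
have fr (r : R) : 0 <= r - (Num.floor r)%:~R <= 1.
  have := floor_itv r; rewrite intrD => /andP[? ?]; apply/andP; split; lra.
exists (x 0 ax0 - (Num.floor (x 0 ax0))%:~R), (x 0 ax1 - (Num.floor (x 0 ax1))%:~R),
  (x 0 ax2 - (Num.floor (x 0 ax2))%:~R); split=> //.
rewrite -[RHS](@periodic_int _ ax0 (Num.floor (x 0 ax0)) _ pF).
rewrite -[RHS](@periodic_int _ ax1 (Num.floor (x 0 ax1)) _ pF).
rewrite -[RHS](@periodic_int _ ax2 (Num.floor (x 0 ax2)) _ pF).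
congr F; rewrite {1}(vec3_coord x) !vec3E !scalerBl.
set u := _ *: _; set v := x 0 ax1 *: _; set w := x 0 ax2 *: _.
set u' := _ *: delta_mx 0 ax0; set v' := _ *: delta_mx 0 ax1; set w' := _ *: delta_mx 0 ax2.
apply/rowP => i; rewrite !mxE; ring.
Qed.

(** Extreme value theorem on the closed unit cube, where every value of [F] is attained. *)
Lemma periodic_bcont F : z3_periodic F -> continuous F -> bcont F.
Proof.
move=> pF cF; split=> //.
pose A := [set v : T3 | forall i, `[0%R, 1%R]%classic (v ord0 i)].
have cA : compact A by apply: (@rV_compact R 3 (fun=> `[0%R, 1%R]%classic)) => i; exact: segment_compact.
have A0 : A !=set0 by exists (const_mx 0) => i /=; rewrite mxE in_itv /= lexx ler01.
have cN : {within A, continuous (fun x => `|F x|)}.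
  by apply: continuous_subspaceT => x; exact: (@continuous_comp _ _ _ F (@Num.norm R R) x (cF x) (@norm_continuous _ _ _)).
have [c _ Hc] := EVT_max_rV A0 cA cN.
exists `|F c| => x; have [a [b [d [a01 b01 d01 ->]]]] := periodic_cube x pF.
apply: Hc; rewrite inE => i /=; rewrite in_itv /= mxE.
by do 2?[case: ifP => _].
Qed.

Lemma periodic_pdw F w : z3_periodic F -> z3_periodic (pdw w F).
Proof.
move=> pF x i; have := congr1 (@^~ x) (pdw_shift w F (delta_mx 0 i)) => /= <-.
by congr (pdw w _ x); apply/funext => y; exact: pF.
Qed.

Lemma Ck1_line F : Ck 1 F -> forall i x (s : R),
  is_derive s (1:R) (fun r => F (x + r *: delta_mx 0 i)) (pd i F (x + s *: delta_mx 0 i)).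
Proof. by move=> /CkS[_ dF _] i x s; apply: derivable_line; exact: dF. Qed.

Lemma sobolev_ax0 F (b c : R) : Ck 1 F -> forall a, 0 <= a <= 1 ->
  F (vec3 a b c) ^+ 2 <= 2 * avg (fun a => F (vec3 a b c) ^+ 2 + pd ax0 F (vec3 a b c) ^+ 2).
Proof.
move=> HF; have E a : vec3 a b c = vec3 0 b c + a *: delta_mx 0 ax0.
  by rewrite !vec3E scale0r add0r [RHS]addrC addrA.
apply: (@sobolev1 _ (fun a => F (vec3 a b c)) (fun a => pd ax0 F (vec3 a b c))).
  by move=> a; rewrite E; under eq_fun do rewrite E; exact: Ck1_line.
by apply: continuous_ax0; case/CkS: HF => _ _ /(_ ax0) [].
Qed.

Lemma sobolev_ax1 F (a c : R) : Ck 1 F -> forall b, 0 <= b <= 1 ->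
  F (vec3 a b c) ^+ 2 <= 2 * avg (fun b => F (vec3 a b c) ^+ 2 + pd ax1 F (vec3 a b c) ^+ 2).
Proof.
move=> HF; have E b : vec3 a b c = vec3 a 0 c + b *: delta_mx 0 ax1.
  by rewrite !vec3E scale0r addr0 addrAC.
apply: (@sobolev1 _ (fun b => F (vec3 a b c)) (fun b => pd ax1 F (vec3 a b c))).
  by move=> b; rewrite E; under eq_fun do rewrite E; exact: Ck1_line.
by apply: continuous_ax1; case/CkS: HF => _ _ /(_ ax1) [].
Qed.

Lemma sobolev_ax2 F (a b : R) : Ck 1 F -> forall c, 0 <= c <= 1 ->
  F (vec3 a b c) ^+ 2 <= 2 * avg (fun c => F (vec3 a b c) ^+ 2 + pd ax2 F (vec3 a b c) ^+ 2).
Proof.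
move=> HF; have E c : vec3 a b c = vec3 a b 0 + c *: delta_mx 0 ax2.
  by rewrite !vec3E scale0r addr0.
apply: (@sobolev1 _ (fun c => F (vec3 a b c)) (fun c => pd ax2 F (vec3 a b c))).
  by move=> c; rewrite E; under eq_fun do rewrite E; exact: Ck1_line.
by apply: continuous_ax2; case/CkS: HF => _ _ /(_ ax2) [].
Qed.

Definition sqsum F (ws : seq (seq 'I_3)) : T3 -> R := fun x => \sum_(w <- ws) pdw w F x ^+ 2.

(** The words that appear when the one-dimensional inequality in the direction [i] is applied to
    every term of [sqsum F ws]. *)
Definition with_deriv (i : 'I_3) (ws : seq (seq 'I_3)) := flatten [seq [:: w; i :: w] | w <- ws].

Lemma sqsum_cons F w ws : sqsum F (w :: ws) = fun x => pdw w F x ^+ 2 + sqsum F ws x.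
Proof. by apply/funext => x; rewrite /sqsum big_cons. Qed.

Lemma sqsum_nil F : sqsum F [::] = fun=> 0.
Proof. by apply/funext => x; rewrite /sqsum big_nil. Qed.

Lemma sqsum_bcont F m ws : Ck m F -> z3_periodic F -> all (fun w => size w <= m)%N ws ->
  bcont (sqsum F ws).
Proof.
move=> HF pF; elim: ws => [_|w ws IH /= /andP[wm /IH bws]].
  by rewrite sqsum_nil; exact: bcont_cst.
rewrite sqsum_cons; apply: bcont_add bws.
apply: bcont_sqr; apply: periodic_bcont; first exact: periodic_pdw.
by apply: (@Ck_cont _ _ 0); apply: Ck_pdw; rewrite addn0; exact: CkW HF.
Qed.

Lemma continuous_add1 (f g : R -> R) : continuous f -> continuous g ->
  continuous (fun x => f x + g x).
Proof. by move=> cf cg x; exact: (@continuousD _ _ _ f g x (cf x) (cg x)). Qed.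

(** [P] stands for a line parallel to the axis [i]; its two properties are abstracted so that one
    proof serves the three axes. *)
Lemma sqsum_step F m ws i (P : R -> T3) (t : R) : Ck m F -> z3_periodic F ->
  (forall G, continuous G -> continuous (fun s => G (P s))) ->
  (forall G, Ck 1 G -> G (P t) ^+ 2 <= 2 * avg (fun s => G (P s) ^+ 2 + pd i G (P s) ^+ 2)) ->
  all (fun w => size w < m)%N ws ->
  sqsum F ws (P t) <= 2 * avg (fun s => sqsum F (with_deriv i ws) (P s)).
Proof.
move=> HF pF cP HP; elim: ws => [_|w ws IH /= /andP[wm wsm]].
  by rewrite /= !sqsum_nil avg_cst mulr0.
have Dm vs : all (fun w => size w < m)%N vs -> all (fun w => size w <= m)%N (with_deriv i vs).
  by elim: vs => //= v vs IHv /andP[vm /IHv ->]; rewrite vm (ltnW vm).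
rewrite /with_deriv /= -/(with_deriv i ws) !sqsum_cons.
have Cw : Ck 1 (pdw w F) by apply: Ck_pdw; apply: CkW HF; rewrite addn1.
have [/CkS[cw _ /(_ i) [ciw _]]] := (Cw, tt); move=> _.
have csq G : continuous G -> continuous (fun s => G (P s) ^+ 2).
  by move=> cG; apply: (cP (fun x => G x ^+ 2)); exact: continuous_mul.
have -> : (fun s => pdw w F (P s) ^+ 2 + (pdw (i :: w) F (P s) ^+ 2 + sqsum F (with_deriv i ws) (P s)))
  = (fun s => (pdw w F (P s) ^+ 2 + pd i (pdw w F) (P s) ^+ 2) + sqsum F (with_deriv i ws) (P s)).
  by apply/funext => s; rewrite addrA.
rewrite avgD ?mulrDr; [|by apply: continuous_add1; exact: csq|].
  by apply: lerD; [exact: HP|exact: IH].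
apply: cP; apply: (@sqsum_bcont F m _ HF pF (Dm _ wsm)).1.
Qed.

Lemma avg3_sqsum F m ws (S : R) : Ck m F -> z3_periodic F ->
  all (fun w => size w <= m)%N ws ->
  (forall w, (size w <= m)%N -> avg3 (fun x => pdw w F x ^+ 2) <= S) ->
  avg3 (sqsum F ws) <= (size ws)%:R * S.
Proof.
move=> HF pF + HS; elim: ws => [_|w ws IH /= /andP[wm wsm]].
  by rewrite sqsum_nil avg3_cst mul0r.
have := @sqsum_bcont F m [:: w] HF pF; rewrite sqsum_cons /= wm => /(_ isT).
rewrite sqsum_nil; under eq_fun do rewrite addr0; move=> bw.
rewrite sqsum_cons avg3D//; last exact: sqsum_bcont HF pF wsm.
by rewrite -natr1 mulrDl mul1r addrC; apply: lerD; [exact: IH|exact: HS].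
Qed.

(* The one-dimensional inequality, applied in each direction in turn, costs a
   factor 2 and doubles the number of terms: 64 = 2^3 * 2^3. *)
Lemma sobolev3 F (S : R) : Ck 3 F -> z3_periodic F ->
  (forall w, (size w <= 3)%N -> avg3 (fun x => pdw w F x ^+ 2) <= S) ->
  forall x, F x ^+ 2 <= 64 * S.
Proof.
move=> HF pF HS x.
have [a [b [c [a01 b01 c01 ->]]]] := periodic_cube x pF.
pose W0 : seq (seq 'I_3) := [:: [::]].
pose W1 := with_deriv ax0 W0; pose W2 := with_deriv ax1 W1; pose W3 := with_deriv ax2 W2.
have b1 : bcont (sqsum F W1) by exact: sqsum_bcont HF pF _.
have b2 : bcont (sqsum F W2) by exact: sqsum_bcont HF pF _.
have b3 : bcont (sqsum F W3) by exact: sqsum_bcont HF pF _.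
have s3 a' b' c' : 0 <= c' <= 1 -> sqsum F W2 (vec3 a' b' c') <= 2 * avg2 (sqsum F W3) a' b'.
  move=> c'01; apply: (@sqsum_step F 3 W2 ax2 (fun c => vec3 a' b' c) c' HF pF) => //.
  - by move=> G; exact: continuous_ax2.
  - by move=> G HG; exact: sobolev_ax2.
have s2 a' b' c' : 0 <= b' <= 1 -> 0 <= c' <= 1 ->
    sqsum F W1 (vec3 a' b' c') <= 4 * avg (avg2 (sqsum F W3) a').
  move=> b'01 c'01; apply: (@le_trans _ _ (2 * avg (fun b => sqsum F W2 (vec3 a' b c')))).
    apply: (@sqsum_step F 3 W1 ax1 (fun b => vec3 a' b c') b' HF pF) => //.
    - by move=> G; exact: continuous_ax1.
    - by move=> G HG; exact: sobolev_ax1.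
  have -> : 4 = 2 * 2 :> R by ring.
  rewrite -mulrA ler_pM2l// -avgZ; last exact: avg2_cont1.
  apply: avg_le; first exact: continuous_ax1 b2.1.
    by move=> y; apply: (@continuousM _ _ (fun=> 2) _ y); [exact: cvg_cst|exact: avg2_cont1].
  by move=> b'' _; exact: s3.
have s1 : sqsum F W0 (vec3 a b c) <= 8 * avg3 (sqsum F W3).
  apply: (@le_trans _ _ (2 * avg (fun a => sqsum F W1 (vec3 a b c)))).
    apply: (@sqsum_step F 3 W0 ax0 (fun a => vec3 a b c) a HF pF) => //.
    - by move=> G; exact: continuous_ax0.
    - by move=> G HG; exact: sobolev_ax0.
  have -> : 8 = 2 * 4 :> R by ring.
  rewrite -mulrA ler_pM2l// -avgZ; last exact: avg2_avg_cont.
  apply: avg_le; first exact: continuous_ax0 b1.1.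
    by move=> y; apply: (@continuousM _ _ (fun=> 4) _ y); [exact: cvg_cst|exact: avg2_avg_cont].
  by move=> a'' _; exact: s2.
have := @avg3_sqsum F 3 W3 S HF pF isT HS.
move: s1; rewrite {1}/sqsum big_seq1 /= => s1 s4.
apply: le_trans s1 _; have -> : 64 = 8 * 8 :> R by ring.
by rewrite -mulrA ler_pM2l.
Qed.

Lemma L2_sq_ge0 F : (0 <= L2_sq F)%E.
Proof.
apply: integral_ge0 => a _; apply: integral_ge0 => b _; apply: integral_ge0 => c _.
by rewrite lee_fin sqr_ge0.
Qed.

Lemma smooth_HM_sq_ge0 N F : (0 <= smooth_HM_sq N F)%E.
Proof. by apply: sume_ge0 => i _; exact: L2_sq_ge0. Qed.

Lemma pdw_cat w1 w2 F : pdw w1 (pdw w2 F) = pdw (w1 ++ w2) F.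
Proof. by rewrite /pdw foldr_cat. Qed.

Lemma smooth_HM_sq_sup N m F (S : R) : (m + 3 <= N)%N -> smooth F -> z3_periodic F ->
  (smooth_HM_sq N F <= S%:E)%E ->
  forall w, (size w <= m)%N -> forall x, pdw w F x ^+ 2 <= 64 * S.
Proof.
move=> mN HF pF HS w wm; apply: sobolev3.
- by apply: Ck_pdw; exact: HF.
- exact: periodic_pdw.
move=> w' w'3; rewrite pdw_cat.
have wN : (size (w' ++ w) <= N)%N by rewrite size_cat; lia.
rewrite -lee_fin -L2_sqE; last first.
  apply: periodic_bcont; first exact: periodic_pdw.
  by apply: (@Ck_cont _ _ 0); apply: Ck_pdw; exact: HF.
have [io sio ->] := pdw_index wN (HF _).
apply: le_trans HS; rewrite /smooth_HM_sq (bigD1 io)//=.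
by rewrite leeDl// sume_ge0// => i _; exact: L2_sq_ge0.
Qed.

Lemma ereal_cvg_eps (u : nat -> \bar R) (s : R) : u @ \oo --> s%:E ->
  forall e : R, 0 < e -> exists n, forall j, (n <= j)%N -> (u j <= (s + e)%:E)%E.
Proof.
move=> /fine_cvgP[[n1 _ H1] /nbhs_oo_cvg H2] e /H2[n2 {}H2].
exists (maxn n1 n2) => j; rewrite geq_max => /andP[j1 j2].
have -> : u j = (fine (u j))%:E by rewrite fineK//; exact: H1.
rewrite lee_fin; have := H2 j j2; rewrite ltr_norml => /andP[_] /=; lra.
Qed.

Lemma HM_sq_ge0 N F : (0 <= HM_sq N F)%E.
Proof.
apply: le_ereal_inf_tmp => _ [s [u [_ _ _ Hs]] <-].
rewrite lee_fin; apply/ler_addgt0Pl => e e0.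
have [n /(_ n (leqnn n)) H] := ereal_cvg_eps Hs e0.
by rewrite addrC -lee_fin; apply: le_trans H; exact: smooth_HM_sq_ge0.
Qed.

(** [HM_sq] is an infimum. Half of [d] is spent on choosing an admissible value close to it, the
    other half on the convergence of the norms of the approximating sequence. *)
Lemma HM_sq_approx N F (B d : R) : (HM_sq N F <= B%:E)%E -> 0 < d ->
  exists u : nat -> T3 -> R,
  [/\ forall j, smooth (u j) /\ z3_periodic (u j),
      forall e : R, 0 < e -> exists m : nat, forall i j : nat,
          (m <= i)%N -> (m <= j)%N ->
          (smooth_HM_sq N (fun x => u i x - u j x)%R <= e%:E)%E,
      forall e : R, 0 < e -> exists n, forall j, (n <= j)%N ->
          (L2_sq (fun x => u j x - F x)%R <= e%:E)%E
    & exists n, forall j, (n <= j)%N -> (smooth_HM_sq N (u j) <= (B + d)%:E)%E].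
Proof.
move=> HB d0; have d20 : 0 < d / 2 by rewrite divr_gt0.
have /ereal_inf_lt[_ [s [u [H1 H2 H3 H4]] <-]] : (HM_sq N F < (B + d / 2)%:E)%E.
  by apply: le_lt_trans HB _; rewrite lte_fin; lra.
rewrite lte_fin => sB.
exists u; split=> //.
- by move=> e e0; have [n H] := ereal_cvg_eps H3 e0; exists n => j /H; rewrite add0r.
- have [n H] := ereal_cvg_eps H4 d20; exists n => j /H /le_trans; apply.
  by rewrite lee_fin; lra.
Qed.

(** Sobolev embedding for the completion: a subsequence of smooth approximations is Cauchy in C^m by
    [sobolev3]; its limit [G] coincides with [F] in L^2, hence everywhere, both being continuous.
    The slack [d] is removed in [HM_sq_Cb]. *)
Lemma HM_sq_Cb_approx N m F (B K d : R) : (m + 3 <= N)%N -> continuous F -> z3_periodic F ->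
  (HM_sq N F <= B%:E)%E -> 0 <= K -> 64 * B <= K ^+ 2 -> 0 < d ->
  Cb m (K + d) F.
Proof.
move=> mN cF pF HB K0 BK d0.
(* As 64 (d/32)^2 = (d/4)^2, adding it to K^2 stays below (K + d/2)^2. *)
have dd0 : 0 < (d / 32) ^+ 2 by apply: exprn_gt0; lra.
have [u [Su Cu Lu [J Ju]]] := HM_sq_approx HB dd0.
pose e (n : nat) : R := n.+1%:R^-1.
have e0 n : 0 < e n by rewrite invr_gt0.
have ecv : e @ \oo --> 0 by exact: cvg_harmonic.
(* The 8 is the square root of the constant 64 of [sobolev3]: beyond [M n], differences are at most
   [e n] in C^m. *)
have /choice[M HM] n : exists m : nat, forall i j : nat, (m <= i)%N -> (m <= j)%N ->
    (smooth_HM_sq N (fun x => u i x - u j x)%R <= ((e n / 8) ^+ 2)%:E)%E.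
  by apply: Cu; apply: exprn_gt0; have := e0 n; lra.
(* [phi n] is at least [n] and at least every [M k] with k <= n, so this single subsequence has the
   Cauchy modulus [e]. *)
pose phi n := (n + \sum_(k < n.+1) M k)%N.
have phi_M n j : (n <= j)%N -> (M n <= phi j)%N.
  move=> nj; rewrite /phi (bigD1 (Ordinal (nj : (n < j.+1)%N)))//=; lia.
have phi_n n : (n <= phi n)%N by rewrite leq_addr.
pose g n := u (phi n).
have Sg n : smooth (g n) /\ z3_periodic (g n) by exact: Su.
have Cg n : Ck m (g n) by case: (Sg n).
have Dsm i j : smooth (fun x => u i x - u j x) /\ z3_periodic (fun x => u i x - u j x).
  split; first by move=> k; apply: Ck_sub; [case: (Su i)|case: (Su j)].
  by move=> x k; rewrite (Su i).2 (Su j).2.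
have ab_sq (a b : R) : 0 <= b -> a ^+ 2 <= b ^+ 2 -> `|a| <= b.
  by move=> b0; rewrite -real_normK ?num_real// ler_sqr// nnegrE.
have gC w : (size w <= m)%N -> forall j n, (n <= j)%N ->
    forall x, `|pdw w (g j) x - pdw w (g n) x| <= e n.
  move=> wm j n nj x; apply: ab_sq; first exact: ltW.
  have := @smooth_HM_sq_sup N m _ ((e n / 8) ^+ 2) mN (Dsm (phi j) (phi n)).1
    (Dsm (phi j) (phi n)).2 (HM n _ _ (phi_M _ _ nj) (phi_M _ _ (leqnn n))) w wm x.
  have -> : 64 * (e n / 8) ^+ 2 = e n ^+ 2 by field.
  by have := congr1 (@^~ x) (pdw_sub wm (Cg j) (Cg n)) => /= <-.
have [] := Ck_limit ecv Cg gC; set G := fun x => _ => CG HG.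
have pG : z3_periodic G.
  by move=> x i; rewrite /G; under eq_fun do rewrite (Sg _).2.
have bG : bcont G by apply: periodic_bcont => //; exact: Ck_cont CG.
have bF : bcont F by exact: periodic_bcont.
have bg n : bcont (g n) by apply: periodic_bcont; [case: (Sg n)|exact: Ck_cont (Cg n)].
(* (G - F)^2 <= 2 (G - g n)^2 + 2 (g n - F)^2, where the first term is small uniformly and the
   second in mean. *)
have EF : F = G.
  have A0 : avg3 (fun x => (G x - F x) ^+ 2) <= 0.
    apply/ler_addgt0Pl => r r0; rewrite addr0.
    have r40 : 0 < r / 4 by rewrite divr_gt0.
    have [n1 L1] := Lu _ r40.
    have mr : 0 < Num.min 1 (r / 4) by rewrite lt_min ltr01.
    have [n2 /(_ n2 (leqnn _))] := nbhs_oo_cvg ecv mr.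
    rewrite subr0 gtr0_norm; last exact: e0.
    move=> E2.
    have [e1 er] : e n2 < 1 /\ e n2 < r / 4 by move: E2; rewrite lt_min => /andP[].
    pose n := maxn n1 n2.
    have en : e n <= e n2 by rewrite lef_pV2 ?posrE// ler_nat ltnS leq_maxr.
    have L : avg3 (fun x => (g n x - F x) ^+ 2) <= r / 4.
      rewrite -lee_fin -L2_sqE; last exact: bcont_sub.
      by apply: L1; apply: leq_trans (phi_n _); rewrite leq_maxl.
    have bb1 : bcont (fun x => (G x - F x) ^+ 2) by apply: bcont_sqr; exact: bcont_sub.
    have bb2 : bcont (fun x => (g n x - F x) ^+ 2) by apply: bcont_sqr; exact: bcont_sub.
    have bb3 : bcont (fun x => 2 * (g n x - F x) ^+ 2) by apply: bcont_mul => //; exact: bcont_cst.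
    apply: (@le_trans _ _ (avg3 (fun x => 2 * (e n) + 2 * (g n x - F x) ^+ 2))).
      apply: avg3_le => //; first by apply: bcont_add => //; exact: bcont_cst.
      move=> a b c _ _ _; have := HG [::] isT n (vec3 a b c) => /= H.
      set x := vec3 a b c in H *.
      have := sqr_ge0 ((G x - g n x) - (g n x - F x)).
      have : (G x - g n x) ^+ 2 <= e n.
        rewrite -real_normK ?num_real// (@le_trans _ _ (e n ^+ 2))//.
          by rewrite ler_sqr ?nnegrE// ltW.
        have := e0 n; nra.
      nra.
    rewrite avg3D//; last exact: bcont_cst.
    by rewrite avg3_cst avg3Z//; lra.
  clear - CG HG pG bG bF pF A0; apply/funext => x.
  have pGF : z3_periodic (fun x => (G x - F x) ^+ 2) by move=> y i; rewrite pG pF.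
  have [a [b [c [a01 b01 c01 E]]]] := periodic_cube x pGF.
  have := @avg3_eq0 (fun x => (G x - F x) ^+ 2) _ (fun x => sqr_ge0 _) A0 a b c a01 b01 c01.
  rewrite -E => /(_ ltac:(by apply: bcont_sqr; exact: bcont_sub)) /eqP.
  by rewrite sqrf_eq0 subr_eq0 => /eqP.
rewrite EF; split=> // w wm x.
have d20 : 0 < d / 2 by rewrite divr_gt0.
have [n1 E1] := nbhs_oo_cvg ecv d20.
pose n := maxn J n1.
have := E1 n (leq_maxr _ _); rewrite subr0 gtr0_norm// => en.
have B2 : `|pdw w (g n) x| <= K + d / 2.
  apply: ab_sq; first by rewrite addr_ge0// ltW.
  have := @smooth_HM_sq_sup N m _ (B + (d / 32) ^+ 2) mN (Sg n).1 (Sg n).2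
    (Ju _ (leq_trans (leq_maxl _ _) (phi_n _))) w wm x.
  by move/le_trans; apply; nra.
have -> : pdw w G x = (pdw w G x - pdw w (g n) x) + pdw w (g n) x by rewrite subrK.
apply: (le_trans (ler_normD _ _)).
by have := HG w wm n x; lra.
Qed.

Lemma HM_sq_Cb N m F (B K : R) : (m + 3 <= N)%N -> continuous F -> z3_periodic F ->
  (HM_sq N F <= B%:E)%E -> 0 <= K -> 64 * B <= K ^+ 2 -> Cb m K F.
Proof.
move=> mN cF pF HB K0 BK; split.
  by have [] := HM_sq_Cb_approx mN cF pF HB K0 BK ltr01.
move=> w wm x; apply/ler_addgt0Pr => d d0.
exact: (HM_sq_Cb_approx mN cF pF HB K0 BK d0).2.
Qed.

End Cube.

(** * Curvature in moving frames *)

Section FrameGeometry.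
Context {R : realType} {d : nat}.
Local Notation pt := 'rV[R]_d.
Implicit Types (G : pt -> 'M[R]_d) (X Y Z : pt -> pt) (f g : pt -> R) (z : pt).

Definition diff1 f z := forall i, derivable f z (delta_mx 0 i).

Definition near_pt z (P : pt -> Prop) := exists2 r : R, 0 < r & forall y, `|y - z| < r -> P y.

Lemma near_ptP z (P : pt -> Prop) : near_pt z P -> nbhs z P.
Proof.
move=> [r r0 H]; suff : nbhs_ball_ (ball_ (@Num.norm R 'rV[R]_d)) z P by move/nbhs_normP.
by exists r => // y /= Hy; apply: H; rewrite distrC.
Qed.

Lemma near_pt_at z (P : pt -> Prop) : near_pt z P -> P z.
Proof. by move=> [r r0]; apply; rewrite subrr normr0. Qed.

Lemma near_pt_all z (P : pt -> Prop) : (forall y, P y) -> near_pt z P.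
Proof. by move=> H; exists 1. Qed.

Lemma near_pt_sub z (P Q : pt -> Prop) : (forall y, P y -> Q y) -> near_pt z P -> near_pt z Q.
Proof. by move=> H [r r0 Hr]; exists r => // y /Hr /H. Qed.

Lemma near_pt_and z (P Q : pt -> Prop) : near_pt z P -> near_pt z Q ->
  near_pt z (fun y => P y /\ Q y).
Proof.
move=> [r r0 Hr] [s s0 Hs]; exists (Num.min r s); first by rewrite lt_min r0.
by move=> y; rewrite lt_min => /andP[/Hr ? /Hs ?].
Qed.

Lemma near_pt_near z (P : pt -> Prop) : near_pt z P -> near_pt z (fun y => near_pt y P).
Proof.
move=> [r r0 Hr]; exists (r / 2); first by rewrite divr_gt0.
move=> y Hy; exists (r / 2); first by rewrite divr_gt0.
move=> x Hx; apply: Hr; have -> : x - z = (x - y) + (y - z) by rewrite addrA subrK.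
by apply: le_lt_trans (ler_normD _ _) _; rewrite [ltRHS]splitr ltrD.
Qed.

(** A local form of twice differentiability. The inverse of the lapse, for instance, is controlled
    only where the lapse is known to be positive, that is for t >= 0, so the global predicate [Ck 2]
    does not pass to it. *)
Definition diff2 f z := near_pt z (diff1 f) /\ forall m, diff1 (pd m f) z.

Lemma diff1_near f g z : near_pt z (fun y => f y = g y) -> diff1 f z -> diff1 g z.
Proof.
by move=> /near_ptP H df i; exact: (@near_eq_derivable R 'rV[R]_d R f g z _ H (df i)).
Qed.

Lemma pd_near f g z i : near_pt z (fun y => f y = g y) -> pd i f z = pd i g z.
Proof.
by move=> /near_ptP H; exact: (@near_eq_derive R 'rV[R]_d R f g z _ H).
Qed.

Lemma diff1D f g z : diff1 f z -> diff1 g z -> diff1 (fun y => f y + g y) z.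
Proof. by move=> df dg i; exact: derivableD. Qed.

Lemma diff1M f g z : diff1 f z -> diff1 g z -> diff1 (fun y => f y * g y) z.
Proof. by move=> df dg i; exact: derivableM. Qed.

Lemma diff1B f g z : diff1 f z -> diff1 g z -> diff1 (fun y => f y - g y) z.
Proof. by move=> df dg i; exact: derivableB. Qed.

Lemma diff1N f z : diff1 f z -> diff1 (fun y => - f y) z.
Proof. by move=> df i; exact: derivableN. Qed.

Lemma diff1_cst (c : R) z : diff1 (fun=> c) z.
Proof. by move=> i; exact: derivable_cst. Qed.

Lemma diff1V f z : f z != 0 -> diff1 f z -> diff1 (fun y => (f y)^-1) z.
Proof. by move=> f0 df i; exact: derivableV. Qed.

Lemma diff1_sum (I : Type) (r : seq I) (P : pred I) (F : I -> pt -> R) z :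
  (forall i, P i -> diff1 (F i) z) -> diff1 (fun y => \sum_(i <- r | P i) F i y) z.
Proof.
move=> H; elim: r => [|i r IH].
  by under eq_fun do rewrite big_nil; exact: diff1_cst.
under eq_fun do rewrite big_cons; case: ifP => [Pi|_] //.
by apply: diff1D => //; exact: H.
Qed.

Lemma pd_cst i (c : R) z : pd i (fun=> c) z = 0.
Proof. exact: derive_cst. Qed.

Lemma pd_sum (I : Type) (r : seq I) (P : pred I) (F : I -> pt -> R) z m :
  (forall i, P i -> diff1 (F i) z) ->
  pd m (fun y => \sum_(i <- r | P i) F i y) z = \sum_(i <- r | P i) pd m (F i) z.
Proof.
move=> H; elim: r => [|i r IH].
  by rewrite big_nil; under eq_fun do rewrite big_nil; exact: pd_cst.
rewrite big_cons; under eq_fun do rewrite big_cons.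
case: ifP => [Pi|_] //.
by rewrite pdD ?IH//; [exact: H|apply: diff1_sum].
Qed.

Lemma pdV i f z : f z != 0 -> derivable f z (delta_mx 0 i) ->
  pd i (fun y => (f y)^-1) z = - pd i f z / f z ^+ 2.
Proof. by move=> f0 df; rewrite /pd deriveV// /GRing.scale /= mulrC mulNr -mulrN. Qed.

Lemma diff2M f g z : diff2 f z -> diff2 g z -> diff2 (fun y => f y * g y) z.
Proof.
move=> [f1 f2] [g1 g2].
have H := near_pt_and f1 g1.
have [df dg] := near_pt_at H.
split; first by apply: near_pt_sub H => y [? ?]; exact: diff1M.
move=> m; apply: (@diff1_near (fun y => pd m f y * g y + f y * pd m g y)).
  by apply: near_pt_sub H => y [? ?]; rewrite pdM.
by apply: diff1D; [exact: diff1M (f2 m) dg|exact: diff1M df (g2 m)].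
Qed.

Lemma diff2_cst (c : R) z : diff2 (fun=> c) z.
Proof.
split; first by apply: near_pt_all => y; exact: diff1_cst.
move=> m; have -> : pd m (fun _ : pt => c) = fun=> 0 by apply/funext => y; exact: pd_cst.
exact: diff1_cst.
Qed.

Lemma diff2V f z : near_pt z (fun y => f y != 0) -> diff2 f z -> diff2 (fun y => (f y)^-1) z.
Proof.
move=> f0 [f1 f2].
have H := near_pt_and f0 f1.
have [fz df] := near_pt_at H.
split; first by apply: near_pt_sub H => y [? ?]; exact: diff1V.
move=> m; apply: (@diff1_near (fun y => - pd m f y * (f y * f y)^-1)).
  by apply: near_pt_sub H => y [fy dy]; rewrite pdV// expr2.
by apply: diff1M; [exact: diff1N|apply: diff1V; [rewrite mulf_neq0|exact: diff1M]].
Qed.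

Lemma Ck2_diff2 f z : Ck 2 f -> diff2 f z.
Proof.
move=> /CkS[_ df H]; split; first by apply: near_pt_all => y i; exact: df.
by move=> m i; have /CkS[_ + _] := H m; exact.
Qed.

Lemma diff2_diff1 f z : diff2 f z -> diff1 f z.
Proof. by case=> /near_pt_at. Qed.

(* nabla G Z m l is the component l of the covariant derivative of Z along the
   coordinate field m. *)
Definition nabla G Z (m l : 'I_d) : pt -> R := fun y =>
  pd m (fun y => Z y 0 l) y + \sum_n christoffel G l m n y * Z y 0 n.

Lemma covE G X Y y l : cov G X Y y 0 l = \sum_m X y 0 m * nabla G Y m l y.
Proof. by rewrite mxE. Qed.

Lemma sum_mulr_exchange (x : 'I_d -> R) (t : 'I_d -> 'I_d -> R) :
  \sum_n x n * \sum_l t n l = \sum_l \sum_n x n * t n l.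
Proof.
by rewrite [RHS]exchange_big; apply: eq_bigr => n _; rewrite mulr_sumr.
Qed.

(** The contracted Ricci identity at a point, all values and derivatives being replaced by
    independent numbers: [Ga] and [dGa] stand for the Christoffel symbols and their derivatives,
    [dz] and [ddz] for the derivatives of Z. The symmetry of [ddz] removes the second
    derivatives. *)
Lemma ricci_identity_alg (x zc : 'I_d -> R) (dx dz : 'I_d -> 'I_d -> R)
  (ddz : 'I_d -> 'I_d -> 'I_d -> R) (Ga : 'I_d -> 'I_d -> 'I_d -> R)
  (dGa : 'I_d -> 'I_d -> 'I_d -> 'I_d -> R) :
  (forall l m n, Ga l m n = Ga l n m) ->
  (forall k l m n, dGa k l m n = dGa k l n m) ->
  (forall l m n, ddz l m n = ddz m l n) ->
  let nz m l := dz m l + \sum_n Ga l m n * zc n in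
  let nx m l := dx m l + \sum_n Ga l m n * x n in
  let dnz k m l := ddz k m l + \sum_n (dGa k l m n * zc n + Ga l m n * dz k n) in
  \sum_l (\sum_n (dx l n * nz n l + x n * dnz l n l) + \sum_k Ga l l k * \sum_n x n * nz n k)
  - \sum_l \sum_n nx l n * nz n l - \sum_n x n * \sum_l dnz n l l
  = \sum_s \sum_n zc s * x n *
     (\sum_l (dGa l l s n - dGa n l s l) + \sum_l \sum_r (Ga l l r * Ga r s n - Ga l n r * Ga r s l)).
Proof.
move=> sG sdG sz nz nx dnz.
(* The derivatives of X cancel between the divergence of D_X Z and the product of covariant
   derivatives, after which a factor [x n] comes out. *)
have E1 : \sum_l (\sum_n (dx l n * nz n l + x n * dnz l n l) + \sum_k Ga l l k * \sum_n x n * nz n k)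
    - \sum_l \sum_n nx l n * nz n l - \sum_n x n * \sum_l dnz n l l
  = \sum_n x n * (\sum_l (dnz l n l - dnz n l l)
      + \sum_l \sum_k (Ga l l k * nz n k - Ga k l n * nz k l)).
  have e1 : \sum_l \sum_n nx l n * nz n l = \sum_l \sum_n dx l n * nz n l
      + \sum_n x n * \sum_l \sum_k Ga k l n * nz k l.
    rewrite sum_mulr_exchange -big_split /=; apply: eq_bigr => l _.
    rewrite sum_mulr_exchange -big_split /=; apply: eq_bigr => n _.
    rewrite /nx mulrDl mulr_suml; congr (_ + _); apply: eq_bigr => k _.
    by rewrite mulrCA mulrA.
  have e2 : \sum_l \sum_k Ga l l k * \sum_n x n * nz n k
      = \sum_n x n * \sum_l \sum_k Ga l l k * nz n k.
    rewrite sum_mulr_exchange; apply: eq_bigr => l _.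
    rewrite sum_mulr_exchange; apply: eq_bigr => k _.
    by rewrite mulr_sumr; apply: eq_bigr => n _; rewrite mulrCA.
  have e3 : \sum_l \sum_n x n * dnz l n l = \sum_n x n * \sum_l dnz l n l.
    by rewrite sum_mulr_exchange.
  rewrite big_split /= e2 e1; under [X in X + _ - _ - _]eq_bigr do rewrite big_split /=.
  rewrite big_split /= e3.
  under [in RHS]eq_bigr do (rewrite sumrB; under [X in _ * (_ + X)]eq_bigr do rewrite sumrB).
  under [in RHS]eq_bigr do rewrite sumrB !mulrDr !mulrN.
  rewrite !big_split /= !sumrN; ring.
rewrite {}E1 exchange_big; apply: eq_bigr => n _ /=.
under [in RHS]eq_bigr do rewrite -mulrA mulrCA.
rewrite -mulr_sumr; congr (_ * _).
(* The terms in [dz] left over here and in [E3] are opposite. *)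
have E2 : \sum_l (dnz l n l - dnz n l l) = \sum_s zc s * \sum_l (dGa l l s n - dGa n l s l)
    + (\sum_l \sum_s Ga l n s * dz l s - \sum_l \sum_s Ga l l s * dz n s).
  rewrite sum_mulr_exchange -sumrB -big_split /=; apply: eq_bigr => l _.
  rewrite /dnz -sumrB (sz l) -big_split /= opprD addrACA subrr add0r -sumrB.
  by apply: eq_bigr => s _; rewrite (sdG l l s n) (sdG n l s l); ring.
have E3 : \sum_l \sum_k (Ga l l k * nz n k - Ga k l n * nz k l)
    = \sum_s zc s * \sum_l \sum_r (Ga l l r * Ga r s n - Ga l n r * Ga r s l)
    + (\sum_l \sum_s Ga l l s * dz n s - \sum_l \sum_s Ga l n s * dz l s).
  have f1 : \sum_l \sum_k Ga l l k * nz n k = \sum_l \sum_s Ga l l s * dz n s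
     + \sum_s zc s * \sum_l \sum_r Ga l l r * Ga r s n.
    rewrite sum_mulr_exchange -big_split /=; apply: eq_bigr => l _.
    rewrite sum_mulr_exchange -big_split /=; apply: eq_bigr => k _.
    rewrite /nz mulrDr mulr_sumr; congr (_ + _); apply: eq_bigr => s _.
    by rewrite (sG k n s); ring.
  have f2 : \sum_l \sum_k Ga k l n * nz k l = \sum_l \sum_s Ga l n s * dz l s
     + \sum_s zc s * \sum_l \sum_r Ga l n r * Ga r s l.
    rewrite exchange_big /=.
    rewrite sum_mulr_exchange -big_split /=; apply: eq_bigr => l _.
    rewrite sum_mulr_exchange -big_split /=; apply: eq_bigr => k _.
    rewrite /nz mulrDr mulr_sumr (sG l k n); congr (_ + _); apply: eq_bigr => s _.
    by rewrite (sG k s l); ring.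
  under eq_bigr do rewrite sumrB.
  rewrite sumrB f1 f2.
  under [X in _ = X + _]eq_bigr do (under eq_bigr do rewrite sumrB; rewrite sumrB mulrBr).
  by rewrite sumrB; ring.
rewrite E2 E3 addrACA -big_split /= (_ : _ - _ + (_ - _) = 0) ?addr0; last by ring.
by apply: eq_bigr => s _; rewrite -mulrDr.
Qed.

End FrameGeometry.

(** * Ricci tensor, wave operator and torsion in terms of connection coefficients *)

Section FrameFormulas.
Context {R : realType} {d : nat}.
Local Notation pt := 'rV[R]_d.
Implicit Types (G : pt -> 'M[R]_d) (X Y Z : pt -> pt) (f g : pt -> R) (z : pt).

Definition vdiff1 X z := forall n, diff1 (fun y => X y 0 n) z.

Lemma pd_mul i f g z : diff1 f z -> diff1 g z ->
  pd i (fun y => f y * g y) z = pd i f z * g z + f z * pd i g z.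
Proof. by move=> df dg; exact: pdM. Qed.

Lemma pd_add i f g z : diff1 f z -> diff1 g z ->
  pd i (fun y => f y + g y) z = pd i f z + pd i g z.
Proof. by move=> df dg; exact: pdD. Qed.

Lemma diff1_nabla G Z m l z : (forall n, diff1 (christoffel G l m n) z) -> vdiff1 Z z ->
  diff1 (pd m (fun y => Z y 0 l)) z -> diff1 (nabla G Z m l) z.
Proof.
move=> dG dZ ddZ; apply: diff1D => //; apply: diff1_sum => n _.
by apply: (@diff1M _ _ (christoffel G l m n) (fun y => Z y 0 n)).
Qed.

Lemma pd_nabla G Z k m l z : (forall n, diff1 (christoffel G l m n) z) -> vdiff1 Z z ->
  diff1 (pd m (fun y => Z y 0 l)) z ->
  pd k (nabla G Z m l) z = pd k (pd m (fun y => Z y 0 l)) z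
  + \sum_n (pd k (christoffel G l m n) z * Z z 0 n
            + christoffel G l m n z * pd k (fun y => Z y 0 n) z).
Proof.
move=> dG dZ ddZ.
have dM n : diff1 (fun y => christoffel G l m n y * Z y 0 n) z.
  by apply: (@diff1M _ _ (christoffel G l m n) (fun y => Z y 0 n)).
rewrite /nabla (@pd_add _ (pd m (fun y => Z y 0 l))) //; last by apply: diff1_sum.
rewrite pd_sum//; congr (_ + _); apply: eq_bigr => n _.
by rewrite (@pd_mul _ (christoffel G l m n) (fun y => Z y 0 n)).
Qed.

(* div (D_X Z) - (D_l X^n) (D_n Z^l) - X (div Z) = Ric (Z, X) *)
Lemma ricci_identity G X Z z :
  near_pt z (fun y => forall l m n, christoffel G l m n y = christoffel G l n m y) ->
  (forall l m n, diff1 (christoffel G l m n) z) ->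
  vdiff1 X z -> vdiff1 Z z -> (forall m l, diff1 (pd m (fun y => Z y 0 l)) z) ->
  (forall k m l, pd k (pd m (fun y => Z y 0 l)) z = pd m (pd k (fun y => Z y 0 l)) z) ->
  \sum_l nabla G (cov G X Z) l l z - \sum_l \sum_n nabla G X l n z * nabla G Z n l z
    - \sum_n X z 0 n * pd n (fun y => \sum_l nabla G Z l l y) z
  = \sum_s \sum_n Z z 0 s * X z 0 n * ricci G s n z.
Proof.
move=> symG dG dX dZ ddZ swz.
have sdG k l m n : pd k (christoffel G l m n) z = pd k (christoffel G l n m) z.
  by apply: pd_near; apply: near_pt_sub symG => y; exact.
have := @ricci_identity_alg R d (fun n => X z 0 n) (fun n => Z z 0 n)
  (fun m l => pd m (fun y => X y 0 l) z) (fun m l => pd m (fun y => Z y 0 l) z)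
  (fun k m l => pd k (pd m (fun y => Z y 0 l)) z) (fun l m n => christoffel G l m n z)
  (fun k l m n => pd k (christoffel G l m n) z) (near_pt_at symG) sdG swz.
move=> /= H; apply: etrans H.
have dN m l : diff1 (nabla G Z m l) z by exact: diff1_nabla.
congr (_ - _ - _).
  apply: eq_bigr => l _; rewrite {1}/nabla; congr (_ + _).
    have -> : (fun y => cov G X Z y 0 l) = fun y => \sum_m X y 0 m * nabla G Z m l y.
      by apply/funext => y; exact: covE.
    rewrite pd_sum; last by move=> n _; apply: (@diff1M _ _ (fun y => X y 0 n) (nabla G Z n l)).
    apply: eq_bigr => n _; rewrite (@pd_mul _ (fun y => X y 0 n) (nabla G Z n l))//.
    by rewrite pd_nabla.
  by apply: eq_bigr => k _; rewrite covE.
apply: eq_bigr => n _; congr (_ * _); rewrite pd_sum; last by move=> l _; exact: dN.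
by apply: eq_bigr => l _; rewrite pd_nabla.
Qed.

Definition dual_frame (X : 'I_d -> pt -> pt) (F : pt -> 'I_d -> 'I_d -> R) y :=
  (forall l m, \sum_A F y l A * X A y 0 m = (l == m)%:R) /\
  (forall D A, \sum_l X D y 0 l * F y l A = (D == A)%:R).

Lemma sum_delta_l (f : 'I_d -> R) i : \sum_j (i == j)%:R * f j = f i.
Proof.
by rewrite (bigD1 i)//= eqxx mul1r big1 ?addr0// => j /negbTE ji; rewrite eq_sym ji mul0r.
Qed.

Section Frame.
Variables (G : pt -> 'M[R]_d) (X : 'I_d -> pt -> pt) (c : 'I_d -> 'I_d -> 'I_d -> pt -> R)
  (F : pt -> 'I_d -> 'I_d -> R).

Definition connection_coef y := forall A B l,
  cov G (X A) (X B) y 0 l = \sum_D c A B D y * X D y 0 l.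

Lemma nabla_frame y B m l : dual_frame X F y -> connection_coef y ->
  nabla G (X B) m l y = \sum_A F y m A * \sum_D c A B D y * X D y 0 l.
Proof.
move=> [FX _] cc.
under eq_bigr do rewrite -cc covE mulr_sumr.
rewrite exchange_big /= -[LHS](sum_delta_l (fun m => nabla G (X B) m l y)).
by apply: eq_bigr => n _; rewrite -FX mulr_suml; apply: eq_bigr => A _; rewrite mulrA.
Qed.

Lemma div_frame y B : dual_frame X F y -> connection_coef y ->
  \sum_l nabla G (X B) l l y = \sum_A c A B A y.
Proof.
move=> dF cc; have [_ XF] := dF.
under eq_bigr do rewrite (nabla_frame _ _ _ dF cc).
rewrite exchange_big; apply: eq_bigr => A _ /=.
rewrite sum_mulr_exchange -(sum_delta_l (fun D => c A B D y)).
apply: eq_bigr => D _; rewrite eq_sym -XF mulr_suml; apply: eq_bigr => l _; ring.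
Qed.

Lemma nabla_prod_frame y B C : dual_frame X F y -> connection_coef y ->
  \sum_l \sum_n nabla G (X B) l n y * nabla G (X C) n l y
  = \sum_A \sum_E c A B E y * c E C A y.
Proof.
move=> dF cc; have [_ XF] := dF.
have H l n : nabla G (X B) l n y * nabla G (X C) n l y =
  \sum_A \sum_D F y l A * c A B D y * X D y 0 n * nabla G (X C) n l y.
  rewrite (nabla_frame B l n dF cc) mulr_suml; apply: eq_bigr => A _.
  by rewrite mulr_sumr mulr_suml; apply: eq_bigr => D _; rewrite mulrA.
under eq_bigr do under eq_bigr do rewrite H.
under eq_bigr do rewrite exchange_big.
rewrite exchange_big; apply: eq_bigr => A _ /=.
under eq_bigr do rewrite exchange_big.
rewrite exchange_big; apply: eq_bigr => E _ /=.
have K l : \sum_n F y l A * c A B E y * X E y 0 n * nabla G (X C) n l y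
    = c A B E y * \sum_D c E C D y * (F y l A * X D y 0 l).
  transitivity (F y l A * c A B E y * cov G (X E) (X C) y 0 l).
    by rewrite covE mulr_sumr; apply: eq_bigr => n _; rewrite !mulrA.
  by rewrite cc !mulr_sumr; apply: eq_bigr => D _; ring.
under eq_bigr do rewrite K.
rewrite -mulr_sumr; congr (_ * _); rewrite exchange_big /=.
rewrite -(sum_delta_l (fun D => c E C D y) A); apply: eq_bigr => D _.
by rewrite -mulr_sumr eq_sym -XF mulrC; congr (_ * _); apply: eq_bigr => l _; rewrite mulrC.
Qed.

(** This is [ricci_identity] for X = X_B and Z = X_C. There D_X Z = c_BCD X_D, whose divergence
    gives the first sum; the product of covariant derivatives becomes c_ABE c_ECA, and div X_C the
    trace c_ACA. *)
Lemma frame_ricci B C z :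
  near_pt z (fun y => forall l m n, christoffel G l m n y = christoffel G l n m y) ->
  (forall l m n, diff1 (christoffel G l m n) z) ->
  (forall A, vdiff1 (X A) z) -> (forall m l, diff1 (pd m (fun y => X C y 0 l)) z) ->
  (forall k m l, pd k (pd m (fun y => X C y 0 l)) z = pd m (pd k (fun y => X C y 0 l)) z) ->
  (forall D, diff1 (c B C D) z) ->
  near_pt z (dual_frame X F) -> near_pt z connection_coef ->
  \sum_s \sum_n X C z 0 s * X B z 0 n * ricci G s n z =
  \sum_D (deriv_along (X D) (c B C D) z + c B C D z * \sum_A c A D A z)
  - \sum_A \sum_E c A B E z * c E C A z
  - deriv_along (X B) (fun y => \sum_A c A C A y) z.
Proof.
move=> symG dG dX ddX swX dc ndF ncc.
have dF := near_pt_at ndF; have cc := near_pt_at ncc.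
rewrite -(ricci_identity symG dG (dX B) (dX C) ddX swX); congr (_ - _ - _).
- have E l : pd l (fun y => cov G (X B) (X C) y 0 l) z
     = \sum_D (pd l (c B C D) z * X D z 0 l + c B C D z * pd l (fun y => X D y 0 l) z).
    rewrite (@pd_near _ _ _ (fun y => \sum_D c B C D y * X D y 0 l)); last first.
      by apply: near_pt_sub ncc => y; exact.
    rewrite pd_sum; last by move=> D _; apply: (@diff1M _ _ (c B C D) (fun y => X D y 0 l)) => //; exact: dX.
    by apply: eq_bigr => D _; rewrite (@pd_mul _ (c B C D) (fun y => X D y 0 l))//; exact: dX.
  rewrite /nabla; under eq_bigr do rewrite E.
  under eq_bigr do (under [X in _ + X]eq_bigr do rewrite cc mulr_sumr).
  under eq_bigr do rewrite [X in _ + X]exchange_big -big_split /=.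
  rewrite exchange_big; apply: eq_bigr => D _ /=.
  rewrite -(div_frame D dF cc) mulr_sumr -big_split /=; apply: eq_bigr => l _.
  rewrite /nabla mulrDr mulr_sumr mulrC -addrA; congr (_ + (_ + _)).
  by apply: eq_bigr => n _; rewrite mulrCA.
- exact: nabla_prod_frame.
- apply: eq_bigr => n _; congr (_ * _); apply: pd_near.
  by apply: near_pt_sub (near_pt_and ndF ncc) => y [? ?]; exact: div_frame.
Qed.

(** X_A X_A f minus the derivative of f along D_{X_A} X_A is the covariant Hessian of f at (X_A,
    X_A), and the box is its trace with the inverse metric. *)
Lemma frame_box (eta : 'I_d -> R) f z :
  (forall m n, invmx (G z) m n = \sum_A eta A * X A z 0 m * X A z 0 n) ->
  (forall A, vdiff1 (X A) z) -> (forall n, diff1 (pd n f) z) -> connection_coef z ->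
  box G f z = \sum_A eta A * (deriv_along (X A) (deriv_along (X A) f) z
    - \sum_D c A A D z * deriv_along (X D) f z).
Proof.
move=> Ginv dX df cc.
have E A : deriv_along (X A) (deriv_along (X A) f) z - \sum_D c A A D z * deriv_along (X D) f z
  = \sum_m \sum_n X A z 0 m * X A z 0 n * (pd m (pd n f) z - \sum_l christoffel G l m n z * pd l f z).
  have E1 : deriv_along (X A) (deriv_along (X A) f) z = \sum_m \sum_n X A z 0 m * X A z 0 n * pd m (pd n f) z
      + \sum_l (\sum_m X A z 0 m * pd m (fun y => X A y 0 l) z) * pd l f z.
    rewrite /deriv_along.
    have H m : pd m (fun x => \sum_n X A x 0 n * pd n f x) z =
      \sum_n (pd m (fun y => X A y 0 n) z * pd n f z + X A z 0 n * pd m (pd n f) z).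
      rewrite pd_sum; last by move=> n _; apply: (@diff1M _ _ (fun y => X A y 0 n) (pd n f)) => //; exact: dX.
      by apply: eq_bigr => n _; rewrite (@pd_mul _ (fun y => X A y 0 n) (pd n f))//; exact: dX.
    under eq_bigr do rewrite H mulr_sumr.
    under [X in _ = _ + X]eq_bigr do rewrite mulr_suml.
    rewrite [X in _ = _ + X]exchange_big -big_split /=; apply: eq_bigr => m _.
    rewrite -big_split /=; apply: eq_bigr => n _; ring.
  have E2 : \sum_D c A A D z * deriv_along (X D) f z
      = \sum_l (\sum_m X A z 0 m * pd m (fun y => X A y 0 l) z) * pd l f z
       + \sum_m \sum_n X A z 0 m * X A z 0 n * \sum_l christoffel G l m n z * pd l f z.
    rewrite /deriv_along; rewrite sum_mulr_exchange.
    have K l : \sum_D c A A D z * (X D z 0 l * pd l f z) = cov G (X A) (X A) z 0 l * pd l f z.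
      by rewrite cc mulr_suml; apply: eq_bigr => D _; rewrite mulrA.
    under eq_bigr do rewrite K covE.
    have L : \sum_m \sum_n X A z 0 m * X A z 0 n * (\sum_l christoffel G l m n z * pd l f z)
      = \sum_l (\sum_m X A z 0 m * \sum_n christoffel G l m n z * X A z 0 n) * pd l f z.
      under [RHS]eq_bigr do rewrite mulr_suml.
      rewrite [RHS]exchange_big; apply: eq_bigr => m _ /=.
      rewrite sum_mulr_exchange; apply: eq_bigr => l _.
      by rewrite mulr_sumr mulr_suml; apply: eq_bigr => n _; ring.
    rewrite L -big_split /=; apply: eq_bigr => l _; rewrite -mulrDl; congr (_ * _).
    by rewrite -big_split /=; apply: eq_bigr => m _; rewrite /nabla mulrDr.
  rewrite E1 E2 opprD addrA addrK -sumrB; apply: eq_bigr => m _.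
  by rewrite -sumrB; apply: eq_bigr => n _; rewrite mulrBr.
under [RHS]eq_bigr do rewrite E mulr_sumr.
rewrite [RHS]exchange_big /box; apply: eq_bigr => m _ /=.
under [RHS]eq_bigr do rewrite mulr_sumr.
rewrite [RHS]exchange_big; apply: eq_bigr => n _ /=.
by rewrite Ginv mulr_suml; apply: eq_bigr => A _; rewrite !mulrA.
Qed.

End Frame.

Lemma innerE G X Y y : inner G X Y y = \sum_a \sum_b X y 0 a * G y a b * Y y 0 b.
Proof.
rewrite /inner mxE exchange_big; apply: eq_bigr => b _ /=.
by rewrite mxE mulr_suml; apply: eq_bigr => a _; rewrite mxE.
Qed.

Definition sym_near G z := near_pt z (fun y => forall a b, G y a b = G y b a).

Lemma christoffel_sym G z l m n : sym_near G z ->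
  christoffel G l m n z = christoffel G l n m z.
Proof.
move=> sG; rewrite /christoffel; congr (_ * _); apply: eq_bigr => s _; congr (_ * _).
rewrite (@pd_near _ _ (fun y => G y m n) (fun y => G y n m)); last first.
  by apply: near_pt_sub sG => y; exact.
by rewrite [X in X - _]addrC.
Qed.

Lemma torsion_free G X Y z l : sym_near G z ->
  cov G X Y z 0 l - cov G Y X z 0 l
  = \sum_m (X z 0 m * pd m (fun y => Y y 0 l) z - Y z 0 m * pd m (fun y => X y 0 l) z).
Proof.
move=> sG; rewrite !covE /nabla.
under eq_bigr do rewrite mulrDr.
under [X in _ - X]eq_bigr do rewrite mulrDr.
rewrite [RHS]sumrB !big_split /=.
have -> : \sum_m X z 0 m * (\sum_n christoffel G l m n z * Y z 0 n)
    = \sum_m Y z 0 m * \sum_n christoffel G l m n z * X z 0 n.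
  rewrite sum_mulr_exchange; apply: eq_bigr => n _; rewrite mulr_sumr; apply: eq_bigr => m _.
  by rewrite (christoffel_sym _ _ _ sG); ring.
by rewrite opprD addrACA subrr addr0.
Qed.

Lemma christoffel_lower G m n a z : G z \in unitmx ->
  \sum_l G z a l * christoffel G l m n z
  = 2^-1 * (pd m (fun y => G y a n) z + pd n (fun y => G y a m) z - pd a (fun y => G y m n) z).
Proof.
move=> uG; rewrite /christoffel.
under eq_bigr do rewrite mulrCA.
rewrite -mulr_sumr; congr (_ * _); rewrite sum_mulr_exchange.
pose h s := pd m (fun y => G y s n) z + pd n (fun y => G y s m) z - pd s (fun y => G y m n) z.
rewrite -[RHS]/(h a) -(sum_delta_l h a); apply: eq_bigr => s _; rewrite -/(h s).
have := congr1 (fun M : 'M[R]_d => M a s) (mulmxV uG); rewrite !mxE => <-.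
by rewrite mulr_suml; apply: eq_bigr => l _; rewrite mulrA.
Qed.

(** The Christoffel formula makes each derivative of the metric a sum of two lowered symbols
    ([compat]); the rest is the Leibniz rule. *)
Lemma metric_compat G X Y Z z : sym_near G z -> G z \in unitmx ->
  (forall a b, diff1 (fun y => G y a b) z) -> vdiff1 Y z -> vdiff1 Z z ->
  deriv_along X (inner G Y Z) z = inner G (cov G X Y) Z z + inner G Y (cov G X Z) z.
Proof.
move=> sG uG dG dY dZ.
have sGz := near_pt_at sG.
have dGs m a b : pd m (fun y => G y a b) z = pd m (fun y => G y b a) z.
  by apply: pd_near; apply: near_pt_sub sG => y; exact.
have compat m a b : pd m (fun y => G y a b) z
   = \sum_l G z b l * christoffel G l m a z + \sum_l G z a l * christoffel G l m b z.
  rewrite !christoffel_lower// -mulrDr (dGs m b a) (dGs b a m) (dGs a b m).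
  set u := pd m _ z; set v := pd a _ z; set w := pd b _ z.
  by field.
rewrite !innerE /deriv_along.
have H m : pd m (inner G Y Z) z = \sum_a \sum_b
  ((pd m (fun y => Y y 0 a) z * G z a b + Y z 0 a * pd m (fun y => G y a b) z) * Z z 0 b
   + Y z 0 a * G z a b * pd m (fun y => Z y 0 b) z).
  have -> : inner G Y Z = fun y => \sum_a \sum_b Y y 0 a * G y a b * Z y 0 b.
    by apply/funext => y; exact: innerE.
  have d2 a b : diff1 (fun y => Y y 0 a * G y a b) z.
    by apply: (@diff1M _ _ (fun y => Y y 0 a) (fun y => G y a b)).
  have d3 a b : diff1 (fun y => Y y 0 a * G y a b * Z y 0 b) z.
    by apply: (@diff1M _ _ (fun y => Y y 0 a * G y a b) (fun y => Z y 0 b)).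
  rewrite pd_sum; last by move=> a _; apply: diff1_sum.
  apply: eq_bigr => a _; rewrite pd_sum//; apply: eq_bigr => b _.
  rewrite (@pd_mul _ (fun y => Y y 0 a * G y a b) (fun y => Z y 0 b))//.
  by rewrite (@pd_mul _ (fun y => Y y 0 a) (fun y => G y a b)).
have K m : pd m (inner G Y Z) z = \sum_a \sum_b nabla G Y m a z * G z a b * Z z 0 b
    + \sum_a \sum_b Y z 0 a * G z a b * nabla G Z m b z.
  have K1 : \sum_a \sum_b Y z 0 a * pd m (fun y => G y a b) z * Z z 0 b
     = \sum_a \sum_b (\sum_n christoffel G a m n z * Y z 0 n) * G z a b * Z z 0 b
     + \sum_a \sum_b Y z 0 a * G z a b * (\sum_n christoffel G b m n z * Z z 0 n).
    have -> : \sum_a \sum_b (\sum_n christoffel G a m n z * Y z 0 n) * G z a b * Z z 0 b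
       = \sum_a \sum_b Y z 0 a * (\sum_l G z b l * christoffel G l m a z) * Z z 0 b.
      under eq_bigr do (under eq_bigr do rewrite -mulrA mulr_suml; rewrite exchange_big).
      rewrite exchange_big; apply: eq_bigr => a _ /=; rewrite exchange_big /=.
      apply: eq_bigr => b _; rewrite mulr_sumr mulr_suml; apply: eq_bigr => l _.
      by rewrite (sGz l b); ring.
    have -> : \sum_a \sum_b Y z 0 a * G z a b * (\sum_n christoffel G b m n z * Z z 0 n)
       = \sum_a \sum_b Y z 0 a * (\sum_l G z a l * christoffel G l m b z) * Z z 0 b.
      apply: eq_bigr => a _; under eq_bigr do rewrite mulr_sumr.
      rewrite exchange_big; apply: eq_bigr => b _ /=; rewrite mulr_sumr mulr_suml.
      by apply: eq_bigr => l _; ring.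
    rewrite -big_split; apply: eq_bigr => a _ /=; rewrite -big_split; apply: eq_bigr => b _ /=.
    by rewrite compat; ring.
  rewrite H.
  transitivity (\sum_a \sum_b pd m (fun y => Y y 0 a) z * G z a b * Z z 0 b
    + \sum_a \sum_b Y z 0 a * pd m (fun y => G y a b) z * Z z 0 b
    + \sum_a \sum_b Y z 0 a * G z a b * pd m (fun y => Z y 0 b) z).
    rewrite -!big_split; apply: eq_bigr => a _ /=; rewrite -!big_split; apply: eq_bigr => b _ /=.
    by rewrite mulrDl.
  have N1 : \sum_a \sum_b nabla G Y m a z * G z a b * Z z 0 b
      = \sum_a \sum_b pd m (fun y => Y y 0 a) z * G z a b * Z z 0 b
      + \sum_a \sum_b (\sum_n christoffel G a m n z * Y z 0 n) * G z a b * Z z 0 b.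
    rewrite -big_split; apply: eq_bigr => a _ /=; rewrite -big_split; apply: eq_bigr => b _ /=.
    by rewrite /nabla !mulrDl.
  have N2 : \sum_a \sum_b Y z 0 a * G z a b * nabla G Z m b z
      = \sum_a \sum_b Y z 0 a * G z a b * pd m (fun y => Z y 0 b) z
      + \sum_a \sum_b Y z 0 a * G z a b * (\sum_n christoffel G b m n z * Z z 0 n).
    rewrite -big_split; apply: eq_bigr => a _ /=; rewrite -big_split; apply: eq_bigr => b _ /=.
    by rewrite /nabla mulrDr.
  by rewrite K1 N1 N2; ring.
under eq_bigr do rewrite K mulrDr.
rewrite big_split /=; congr (_ + _); rewrite sum_mulr_exchange; apply: eq_bigr => a _;
  rewrite sum_mulr_exchange; apply: eq_bigr => b _; rewrite covE.
  by rewrite !mulr_suml; apply: eq_bigr => m _; ring.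
by rewrite mulr_sumr; apply: eq_bigr => m _; ring.
Qed.

(** * Orthonormal frames of arbitrary signature *)

Section OrthonormalFrame.
Variables (G : pt -> 'M[R]_d) (X : 'I_d -> pt -> pt) (eta : 'I_d -> R).

(** The signs [eta] let the same lemmas serve the spacetime frame, with [mink], and the frame of a
    slice, with all signs equal to 1. *)
Definition orthonormal_at y :=
  forall A B, inner G (X A) (X B) y = eta A * (A == B)%:R.

Hypothesis eta2 : forall A, eta A * eta A = 1.

Definition frame_dual y (l A : 'I_d) : R := eta A * \sum_b G y l b * X A y 0 b.

Definition conn (A B D : 'I_d) y : R := eta D * inner G (cov G (X A) (X B)) (X D) y.

Let Em y := \matrix_(A, l) X A y 0 l.
Let Fm y := \matrix_(l, A) frame_dual y l A.

(** One of the two inverse relations is orthonormality; the other follows because a one-sided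
    inverse of a square matrix is two-sided. *)
Lemma frame_dualP y : orthonormal_at y -> dual_frame X frame_dual y.
Proof.
move=> on.
have EF D A : \sum_l X D y 0 l * frame_dual y l A = (D == A)%:R.
  transitivity (eta A * inner G (X D) (X A) y).
    rewrite innerE mulr_sumr; apply: eq_bigr => l _; rewrite /frame_dual !mulr_sumr.
    by apply: eq_bigr => b _; ring.
  by rewrite on; have [->|] := eqVneq; rewrite ?mulr1 ?eta2// !mulr0.
split=> // l m.
have : Em y *m Fm y = 1%:M.
  by apply/matrixP => D A; rewrite !mxE -EF; apply: eq_bigr => k _; rewrite !mxE.
move=> /mulmx1C /(congr1 (fun M : 'M[R]_d => M l m)); rewrite !mxE => <-.
by apply: eq_bigr => A _; rewrite !mxE.
Qed.

Lemma orthonormal_inv y : orthonormal_at y -> G y \in unitmx /\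
  forall m n, invmx (G y) m n = \sum_A eta A * X A y 0 m * X A y 0 n.
Proof.
move=> on; have [FX _] := frame_dualP on.
pose H := \matrix_(m, n) \sum_A eta A * X A y 0 m * X A y 0 n.
have GH : G y *m H = 1%:M.
  apply/matrixP => l m; rewrite [RHS]mxE -FX mxE.
  under eq_bigr do rewrite mxE mulr_sumr.
  rewrite exchange_big; apply: eq_bigr => A _ /=; rewrite /frame_dual !mulr_sumr mulr_suml.
  by apply: eq_bigr => b _; ring.
have [uG _] := mulmx1_unit GH; split=> // m n.
have -> : invmx (G y) = H by rewrite -[LHS]mulmx1 -GH mulmxA mulVmx// mul1mx.
by rewrite mxE.
Qed.

Lemma orthonormal_expand y (v : pt) l : orthonormal_at y ->
  v 0 l = \sum_D (eta D * \sum_a \sum_b v 0 a * G y a b * X D y 0 b) * X D y 0 l.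
Proof.
move=> on; have [FX _] := frame_dualP on.
rewrite -[LHS](sum_delta_l (fun m => v 0 m)).
transitivity (\sum_m \sum_A v 0 m * (frame_dual y m A * X A y 0 l)).
  by apply: eq_bigr => m _; rewrite eq_sym -FX mulr_suml; apply: eq_bigr => A _; rewrite mulrC.
rewrite exchange_big; apply: eq_bigr => D _ /=; rewrite mulr_sumr mulr_suml.
apply: eq_bigr => m _; rewrite /frame_dual !mulr_sumr !mulr_suml mulr_sumr.
by apply: eq_bigr => b _; ring.
Qed.

Lemma connP y : orthonormal_at y -> connection_coef G X conn y.
Proof.
move=> on A B l; rewrite (orthonormal_expand _ _ on); apply: eq_bigr => D _.
by rewrite /conn innerE.
Qed.

Lemma inner_sym Y Z y : (forall a b, G y a b = G y b a) -> inner G Y Z y = inner G Z Y y.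
Proof.
move=> sG; rewrite !innerE exchange_big; apply: eq_bigr => b _; apply: eq_bigr => a _ /=.
by rewrite sG; ring.
Qed.

(** G(X_B, X_D) is constant, and metric compatibility expands its derivative along X_A. *)
Lemma conn_antisym A B D z : near_pt z orthonormal_at -> sym_near G z ->
  (forall a b, diff1 (fun y => G y a b) z) -> (forall B, vdiff1 (X B) z) ->
  eta D * conn A B D z + eta B * conn A D B z = 0.
Proof.
move=> non sG dG dX; have on := near_pt_at non.
have [uG _] := orthonormal_inv on.
have H := @metric_compat G (X A) (X B) (X D) z sG uG dG (dX B) (dX D).
rewrite /conn !mulrA !eta2 !mul1r.
rewrite (inner_sym (cov G (X A) (X D)) (X B) (near_pt_at sG)) -H.
rewrite /deriv_along big1// => m _.
rewrite (@pd_near _ _ _ (fun=> eta B * (B == D)%:R)); first by rewrite pd_cst mulr0.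
by apply: near_pt_sub non => y; exact.
Qed.

Lemma conn_torsion A B D z : near_pt z orthonormal_at -> sym_near G z ->
  conn A B D z - conn B A D z = \sum_l (\sum_m (X A z 0 m * pd m (fun y => X B y 0 l) z
     - X B z 0 m * pd m (fun y => X A y 0 l) z)) * frame_dual z l D.
Proof.
move=> non sG; rewrite /conn -mulrBr !innerE -sumrB mulr_sumr; apply: eq_bigr => l _.
rewrite -(torsion_free _ _ _ sG) -sumrB /frame_dual !mulr_sumr; apply: eq_bigr => b _; ring.
Qed.

End OrthonormalFrame.

(* Koszul: a connection in an orthonormal frame is determined by its torsion. *)
Lemma antisym_torsion_unique (g h : 'I_d -> 'I_d -> 'I_d -> R) :
  (forall I J B, g I J B = - g I B J) -> (forall I J B, h I J B = - h I B J) ->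
  (forall I J B, g I J B - g J I B = h I J B - h J I B) ->
  forall I J B, g I J B = h I J B.
Proof.
move=> ag ah t I J B.
have := t I J B; have := t J B I; have := t B I J.
have := ag I J B; have := ag J I B; have := ag B I J; have := ag J B I.
have := ah I J B; have := ah J I B; have := ah B I J; have := ah J B I; lra.
Qed.

End FrameFormulas.

(** * The reduced equations *)

Section Slices.
Context {R : realType}.
Local Notation T3 := 'rV[R]_3.
Local Notation M4 := 'rV[R]_(1 + 3).

Definition tI : 'I_(1 + 3) := lshift 3 ord0.
Definition sI (i : 'I_3) : 'I_(1 + 3) := rshift 1 i.

Lemma tIE : 0 = tI. Proof. exact/val_inj. Qed.

Lemma sum4 (f : 'I_(1 + 3) -> R) : \sum_a f a = f tI + \sum_i f (sI i).
Proof. by rewrite big_split_ord big_ord1. Qed.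

Lemma event_t t (x : T3) : event t x 0 0 = t.
Proof. by rewrite tIE /event row_mxEl mxE eqxx. Qed.

Lemma event_x t (x : T3) : rsubmx (event t x) = x.
Proof. by rewrite /event row_mxKr. Qed.

Lemma event_eta (z : M4) : event (z 0 0) (rsubmx z) = z.
Proof.
rewrite /event -[RHS](@hsubmxK _ _ 1 3); congr row_mx.
apply/matrixP => i j; rewrite !ord1 !mxE eqxx mulr1n; congr (z _ _); exact/val_inj.
Qed.

Lemma lift4_event {A : Type} (f : R -> T3 -> A) t x : lift4 f (event t x) = f t x.
Proof. by rewrite /lift4 event_t event_x. Qed.

Lemma lift4E {A : Type} (h : M4 -> A) : h = lift4 (fun t x => h (event t x)).
Proof. by apply/funext => z; rewrite /lift4 event_eta. Qed.

Lemma event_shift_t t (x : T3) (h : R) : h *: delta_mx 0 tI + event t x = event (h + t) x.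
Proof.
have -> : delta_mx 0 tI = row_mx 1%:M 0 :> M4.
  apply/matrixP => i j; rewrite !ord1 /tI; case: (split_ordP j) => k ->.
    by rewrite row_mxEl !mxE !ord1 !eqxx.
  by rewrite row_mxEr !mxE eq_rlshift andbF.
rewrite /event scale_row_mx scaler0 add_row_mx add0r; congr row_mx.
by rewrite scalemx1 -raddfD.
Qed.

Lemma event_shift_x t (x : T3) i (h : R) :
  h *: delta_mx 0 (sI i) + event t x = event t (h *: delta_mx 0 i + x).
Proof.
have -> : delta_mx 0 (sI i) = row_mx 0 (delta_mx 0 i) :> M4.
  apply/matrixP => k j; rewrite !ord1 /sI; case: (split_ordP j) => l ->.
    by rewrite row_mxEl !mxE eq_lrshift andbF.
  by rewrite row_mxEr !mxE eqxx /= eq_rshift.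
by rewrite /event scale_row_mx scaler0 add_row_mx add0r.
Qed.

Section Lift.
Variables (f : R -> T3 -> R) (t : R) (x : T3).

Lemma time_quotient : (fun h : R => h^-1 *: ((lift4 f \o shift (event t x)) (h *: delta_mx 0 tI)
    - lift4 f (event t x)))
  = (fun h : R => h^-1 *: (((f ^~ x) \o shift t) (h *: (1:R)) - f t x)).
Proof.
apply/funext => h /=; rewrite event_shift_t !lift4_event.
by rewrite -[h *: 1]/(h * 1) mulr1.
Qed.

Lemma space_quotient i : (fun h : R => h^-1 *: ((lift4 f \o shift (event t x)) (h *: delta_mx 0 (sI i))
    - lift4 f (event t x)))
  = (fun h : R => h^-1 *: ((f t \o shift x) (h *: delta_mx 0 i) - f t x)).
Proof. by apply/funext => h /=; rewrite event_shift_x !lift4_event. Qed.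

Lemma pd_time : pd tI (lift4 f) (event t x) = 'D_1 (f ^~ x) t.
Proof. by rewrite /pd /derive time_quotient. Qed.

Lemma derivable_time : derivable (lift4 f) (event t x) (delta_mx 0 tI) ->
  derivable (f ^~ x) t 1.
Proof. by rewrite /derivable time_quotient. Qed.

Lemma pd_space i : pd (sI i) (lift4 f) (event t x) = pd i (f t) x.
Proof. by rewrite /pd /derive space_quotient. Qed.

Lemma derivable_space i : derivable (lift4 f) (event t x) (delta_mx 0 (sI i)) ->
  derivable (f t) x (delta_mx 0 i).
Proof. by rewrite /derivable space_quotient. Qed.

Lemma is_derive_time (v : R) : diff1 (lift4 f) (event t x) ->
  pd tI (lift4 f) (event t x) = v -> is_derive t (1:R) (f ^~ x) v.
Proof.
move=> df <-; split; first exact: derivable_time (df tI).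
by rewrite pd_time.
Qed.

End Lift.

Lemma pd_space_fun (f : R -> T3 -> R) t i : (fun x => pd (sI i) (lift4 f) (event t x)) = pd i (f t).
Proof. by apply/funext => x; exact: pd_space. Qed.

Lemma mx_entry_le (v : T3) i : `|v 0 i| <= `|v|.
Proof. by rewrite [leRHS]/Num.norm /= mx_normrE; apply/bigmax_geP; right => /=; exists (0, i). Qed.

Lemma mx_norm_row_mx0 (v : T3) : `|row_mx (0 : 'rV[R]_1) v| <= `|v|.
Proof.
have [E|/mx_norm_neq0[[i j] E]] := eqVneq (mx_norm (row_mx (0 : 'rV[R]_1) v)) 0.
  by rewrite [leLHS]/Num.norm /= E.
rewrite [leLHS]/Num.norm /= E /= ord1; case: (split_ordP j) => k ->.
  by rewrite row_mxEl mxE normr0.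
by rewrite row_mxEr mx_entry_le.
Qed.

Lemma continuous_event t : continuous (event t : T3 -> M4).
Proof.
move=> x; apply/(@cvgrPdist_lt _ _ _ (nbhs x) (nbhs_filter x)) => e e0.
suff : nbhs_ball_ (ball_ (@Num.norm R T3)) x (fun y => `|event t x - event t y| < e).
  by move/nbhs_normP.
exists e => // y /= Hy; apply: le_lt_trans Hy.
have -> : event t x - event t y = row_mx 0 (x - y).
  by rewrite /event opp_row_mx add_row_mx subrr.
exact: mx_norm_row_mx0.
Qed.

Lemma Ck_slice k (f : R -> T3 -> R) t : Ck k (lift4 f) -> Ck k (f t).
Proof.
elim: k f => [|k IH] f.
  move=> [cf _]; split=> //; have -> : f t = lift4 f \o event t.
    by apply/funext => x /=; rewrite lift4_event.
  by move=> x; apply: continuous_comp; [exact: continuous_event|exact: cf].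
move=> /CkS[cf df Hf]; apply/CkS; split.
- have -> : f t = lift4 f \o event t by apply/funext => x /=; rewrite lift4_event.
  by move=> x; apply: continuous_comp; [exact: continuous_event|exact: cf].
- by move=> i x; apply: derivable_space; exact: df.
- move=> i; rewrite -pd_space_fun.
  apply: (IH (fun t x => pd (sI i) (lift4 f) (event t x))).
  by rewrite -lift4E; exact: Hf.
Qed.

Lemma future_near (z : M4) : 0 < z 0 0 -> near_pt z (fun y => 0 < y 0 0).
Proof.
move=> z0; have [r r0 H] := continuous_modulus (@coord_continuous R 1 (1 + 3) 0 0 z) z0.
exists r => // y Hy; have := H _ Hy; rewrite (_ : z + (y - z) = y) ;last by rewrite addrC subrK.
rewrite ltr_norml => /andP[+ _]; lra.
Qed.

(** e_0 and the e_I as one family, so that the general frame formulas apply to it. *)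
Definition spt_frame (S : fields R) (A : 'I_(1 + 3)) : M4 -> M4 :=
  match fintype.split A with inl _ => e0_vec S | inr K => e_vec S K end.

Definition mink (A : 'I_(1 + 3)) : R := match fintype.split A with inl _ => -1 | inr _ => 1 end.

Lemma spt_frame_t S : spt_frame S tI = e0_vec S.
Proof. by rewrite /spt_frame /tI (unsplitK (inl ord0 : 'I_1 + 'I_3)). Qed.

Lemma spt_frame_s S I : spt_frame S (sI I) = e_vec S I.
Proof. by rewrite /spt_frame /sI (unsplitK (inr I : 'I_1 + 'I_3)). Qed.

Lemma mink_t : mink tI = -1.
Proof. by rewrite /mink /tI (unsplitK (inl ord0 : 'I_1 + 'I_3)). Qed.

Lemma mink_s I : mink (sI I) = 1.
Proof. by rewrite /mink /sI (unsplitK (inr I : 'I_1 + 'I_3)). Qed.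

Lemma mink2 A : mink A * mink A = 1.
Proof. by rewrite /mink; case: fintype.split => _; rewrite ?mulrNN mulr1. Qed.

Section Components.
Variable S : fields R.

Lemma metric4_tt z : metric4 S z tI tI = - lift4 (lapse S) z ^+ 2.
Proof. by rewrite /metric4 /lift4 /tI block_mxEul mxE eqxx mulr1n. Qed.

Lemma metric4_ts z i : metric4 S z tI (sI i) = 0.
Proof. by rewrite /metric4 /lift4 /tI block_mxEur mxE. Qed.

Lemma metric4_st z i : metric4 S z (sI i) tI = 0.
Proof. by rewrite /metric4 /lift4 /tI block_mxEdl mxE. Qed.

Lemma metric4_ss z i j : metric4 S z (sI i) (sI j) = lift4 (fun t x => gmet S t x i j) z.
Proof. by rewrite /metric4 /lift4 block_mxEdr. Qed.

Lemma e0_vec_t z : e0_vec S z 0 tI = (lift4 (lapse S) z)^-1.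
Proof. by rewrite /e0_vec /lift4 !mxE !eqxx mulr1. Qed.

Lemma e0_vec_s z i : e0_vec S z 0 (sI i) = 0.
Proof.
rewrite /e0_vec /lift4 !mxE (_ : (sI i == 0) = false) ?andbF ?mulr0//.
Qed.

Lemma e_vec_t I z : e_vec S I z 0 tI = 0.
Proof. by rewrite /e_vec /lift4 row_mxEl mxE. Qed.

Lemma e_vec_s I z i : e_vec S I z 0 (sI i) = lift4 (fun t x => frame S t x I i) z.
Proof. by rewrite /e_vec /lift4 row_mxEr mxE. Qed.

Lemma deriv_along_e0 f t x :
  deriv_along (e0_vec S) (lift4 f) (event t x) = (lapse S t x)^-1 * 'D_1 (f ^~ x) t.
Proof.
rewrite /deriv_along sum4 big1 ?addr0; last by move=> i _; rewrite e0_vec_s mul0r.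
by rewrite e0_vec_t lift4_event pd_time.
Qed.

Lemma deriv_along_e I f t x :
  deriv_along (e_vec S I) (lift4 f) (event t x) = \sum_a frame S t x I a * pd a (f t) x.
Proof.
rewrite /deriv_along sum4 e_vec_t mul0r add0r; apply: eq_bigr => a _.
by rewrite e_vec_s lift4_event pd_space.
Qed.

Lemma e0_psiE t x : e0_psi S t x = (lapse S t x)^-1 * 'D_1 ((scal S) ^~ x) t.
Proof. exact: deriv_along_e0. Qed.

Lemma e_psiE I t x : e_psi S I t x = \sum_a frame S t x I a * pd a (scal S t) x.
Proof. exact: deriv_along_e. Qed.

Hypotheses (reg : regular S)
  (pos : forall t x, 0 <= t -> 0 < lapse S t x /\ sym_posdef (gmet S t x))
  (orth : orthonormal_frame S).

Let lapse_C2 : Ck 2 (lift4 (lapse S)). Proof. by case: reg => [[]]. Qed.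
Let scal_C2 : Ck 2 (lift4 (scal S)). Proof. by case: reg => _ []. Qed.
Let gmet_C2 i j : Ck 2 (lift4 (fun t x => gmet S t x i j)).
Proof. by case: reg => _ _ /(_ i j)[]. Qed.
Let frame_C2 I i : Ck 2 (lift4 (fun t x => frame S t x I i)).
Proof. by case: reg => _ _ _ /(_ I i)[]. Qed.

Lemma spt_orthonormal (z : M4) : 0 <= z 0 0 ->
  orthonormal_at (metric4 S) (spt_frame S) mink z.
Proof.
move=> z0 A B.
have [n0 _] := pos (rsubmx z) z0.
have in_tt : inner (metric4 S) (e0_vec S) (e0_vec S) z = -1.
  rewrite innerE sum4 [X in _ + X]big1 ?addr0; last first.
    by move=> i _; rewrite big1// => b _; rewrite e0_vec_s !mul0r.
  rewrite sum4 [X in _ + X]big1 ?addr0; last by move=> i _; rewrite metric4_ts mulr0 mul0r.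
  rewrite e0_vec_t metric4_tt /lift4; field; exact: lt0r_neq0.
have in_ts I : inner (metric4 S) (e0_vec S) (e_vec S I) z = 0.
  rewrite innerE sum4 [X in _ + X]big1 ?addr0; last first.
    by move=> i _; rewrite big1// => b _; rewrite e0_vec_s !mul0r.
  rewrite sum4 big1 ?addr0; last by move=> i _; rewrite metric4_ts mulr0 mul0r.
  by rewrite e_vec_t mulr0.
have in_st I : inner (metric4 S) (e_vec S I) (e0_vec S) z = 0.
  rewrite innerE sum4 !sum4 e_vec_t !mul0r add0r big1 ?add0r; last first.
    by move=> i _; rewrite !mul0r.
  rewrite big1// => i _; rewrite sum4 metric4_st mulr0 mul0r add0r.
  by rewrite big1// => j _; rewrite e0_vec_s mulr0.
have in_ss I J : inner (metric4 S) (e_vec S I) (e_vec S J) z = (I == J)%:R.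
  by rewrite -(event_eta z); exact: orth.
case: (split_ordP A) => [i ->|I ->]; case: (split_ordP B) => [j ->|J ->].
- by rewrite !ord1 -/tI spt_frame_t mink_t eqxx mulr1.
- by rewrite !ord1 -/tI -/(sI J) spt_frame_t spt_frame_s eq_lrshift mulr0.
- by rewrite !ord1 -/tI -/(sI I) spt_frame_t spt_frame_s eq_rlshift mulr0.
- by rewrite -/(sI I) -/(sI J) !spt_frame_s mink_s mul1r eq_rshift.
Qed.

Lemma metric4_sym (z : M4) a b : 0 <= z 0 0 -> metric4 S z a b = metric4 S z b a.
Proof.
move=> z0; have [_ [sg _]] := pos (rsubmx z) z0.
case: (split_ordP a) => [i ->|I ->]; case: (split_ordP b) => [j ->|J ->]; rewrite ?ord1//.
- by rewrite -/tI -/(sI J) metric4_ts metric4_st.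
- by rewrite -/tI -/(sI I) metric4_ts metric4_st.
- by rewrite -/(sI I) -/(sI J) !metric4_ss /lift4 -{1}sg mxE.
Qed.

Lemma near_future (z : M4) (P : M4 -> Prop) : 0 < z 0 0 -> (forall y : M4, 0 <= y 0 0 -> P y) -> near_pt z P.
Proof. by move=> z0 H; apply: near_pt_sub (future_near z0) => y y0; apply: H; exact: ltW. Qed.

Lemma metric4_diff2 z a b : diff2 (fun y => metric4 S y a b) z.
Proof.
case: (split_ordP a) => [i ->|I ->]; case: (split_ordP b) => [j ->|J ->]; rewrite ?ord1.
- have -> : (fun y => metric4 S y tI tI) = fun y => (-1) * (lift4 (lapse S) y * lift4 (lapse S) y).
    by apply/funext => y; rewrite metric4_tt mulN1r.
  by apply: diff2M; [exact: diff2_cst|apply: diff2M; exact: Ck2_diff2 lapse_C2].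
- have -> : (fun y => metric4 S y tI (sI J)) = fun=> 0 by apply/funext => y; rewrite metric4_ts.
  exact: diff2_cst.
- have -> : (fun y => metric4 S y (sI I) tI) = fun=> 0 by apply/funext => y; rewrite metric4_st.
  exact: diff2_cst.
- have -> : (fun y => metric4 S y (sI I) (sI J)) = lift4 (fun t x => gmet S t x I J).
    by apply/funext => y; rewrite metric4_ss.
  exact: Ck2_diff2 (gmet_C2 I J).
Qed.

Lemma spt_frame_diff2 (z : M4) A a : 0 < z 0 0 -> diff2 (fun y => spt_frame S A y 0 a) z.
Proof.
move=> z0; case: (split_ordP A) => [i ->|I ->]; case: (split_ordP a) => [j ->|J ->]; rewrite ?ord1.
- have -> : (fun y => spt_frame S tI y 0 tI) = fun y => (lift4 (lapse S) y)^-1.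
    by apply/funext => y; rewrite spt_frame_t e0_vec_t.
  apply: diff2V; last exact: Ck2_diff2 lapse_C2.
  by apply: near_future => // y /(pos (rsubmx y)) [y0 _]; exact: lt0r_neq0.
- have -> : (fun y => spt_frame S tI y 0 (sI J)) = fun=> 0.
    by apply/funext => y; rewrite spt_frame_t e0_vec_s.
  exact: diff2_cst.
- have -> : (fun y => spt_frame S (sI I) y 0 tI) = fun=> 0.
    by apply/funext => y; rewrite spt_frame_s e_vec_t.
  exact: diff2_cst.
- have -> : (fun y => spt_frame S (sI I) y 0 (sI J)) = lift4 (fun t x => frame S t x I J).
    by apply/funext => y; rewrite spt_frame_s e_vec_s.
  exact: Ck2_diff2 (frame_C2 I J).
Qed.

Lemma metric4_sym_near (z : M4) : 0 < z 0 0 -> sym_near (metric4 S) z.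
Proof. by move=> z0; apply: near_future => // y y0 a b; exact: metric4_sym. Qed.

Lemma spt_orthonormal_near (z : M4) : 0 < z 0 0 ->
  near_pt z (orthonormal_at (metric4 S) (spt_frame S) mink).
Proof. by move=> z0; apply: near_future => // y; exact: spt_orthonormal. Qed.

Lemma christoffel4_diff1 (z : M4) l m n : 0 < z 0 0 -> diff1 (christoffel (metric4 S) l m n) z.
Proof.
move=> z0.
(* The inverse metric is written with the frame, whose components are known to be differentiable. *)
pose g y := 2^-1 * \sum_s (\sum_A mink A * spt_frame S A y 0 l * spt_frame S A y 0 s) *
    (pd m (fun y => metric4 S y s n) y + pd n (fun y => metric4 S y s m) y
     - pd s (fun y => metric4 S y m n) y).
apply: (@diff1_near _ _ g).
  apply: near_pt_sub (spt_orthonormal_near z0) => y on; rewrite /g /christoffel; congr (_ * _).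
  by apply: eq_bigr => s _; rewrite (orthonormal_inv mink2 on).2.
apply: diff1M; first exact: diff1_cst.
apply: diff1_sum => s _; apply: diff1M.
  apply: diff1_sum => A _; apply: diff1M; last exact/diff2_diff1/spt_frame_diff2.
  by apply: diff1M; [exact: diff1_cst|exact/diff2_diff1/spt_frame_diff2].
by apply: diff1B; [apply: diff1D|]; apply: (metric4_diff2 z _ _).2.
Qed.

Definition conn4 := conn (metric4 S) (spt_frame S) mink.

Lemma spt_vdiff1 (z : M4) A : 0 < z 0 0 -> vdiff1 (spt_frame S A) z.
Proof. by move=> z0 n; exact/diff2_diff1/spt_frame_diff2. Qed.

Lemma conn4_diff1 (z : M4) A B D : 0 < z 0 0 -> diff1 (conn4 A B D) z.
Proof.
move=> z0.
have -> : conn4 A B D = fun y => mink D * \sum_a \sum_b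
    (\sum_m spt_frame S A y 0 m * nabla (metric4 S) (spt_frame S B) m a y)
    * metric4 S y a b * spt_frame S D y 0 b.
  apply/funext => y; rewrite /conn4 /conn innerE; congr (_ * _).
  by apply: eq_bigr => a _; apply: eq_bigr => b _; rewrite covE.
apply: diff1M; first exact: diff1_cst.
apply: diff1_sum => a _; apply: diff1_sum => b _; apply: diff1M; last exact: spt_vdiff1.
apply: diff1M; last exact/diff2_diff1/metric4_diff2.
apply: diff1_sum => m _; apply: diff1M; first exact: spt_vdiff1.
apply: diff1_nabla; [by move=> n; exact: christoffel4_diff1|exact: spt_vdiff1|].
by apply: (spt_frame_diff2 B a z0).2.
Qed.

Local Notation kk := (kk S).
Local Notation gam := (gam S).
Local Notation fr := (frame S).

Lemma conn4_s0s I J t x : conn4 (sI I) tI (sI J) (event t x) = - kk I J t x.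
Proof.
by rewrite /conn4 /conn mink_s mul1r !spt_frame_s spt_frame_t /Defs.kk /second_form opprK.
Qed.

Lemma event_pos t (x : T3) : 0 < t -> 0 < (event t x) 0 0.
Proof. by rewrite event_t. Qed.

Lemma conn4_antisym A B D t x : 0 < t ->
  mink D * conn4 A B D (event t x) + mink B * conn4 A D B (event t x) = 0.
Proof.
move=> t0; have z0 := event_pos x t0.
apply: conn_antisym (spt_orthonormal_near z0) (metric4_sym_near z0) _ _.
- exact: mink2.
- by move=> a b; exact/diff2_diff1/metric4_diff2.
- by move=> C; exact: spt_vdiff1.
Qed.

Lemma conn4_ss0 I J t x : 0 < t -> conn4 (sI I) (sI J) tI (event t x) = - kk I J t x.
Proof.
move=> t0; have := conn4_antisym (sI I) (sI J) tI x t0.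
rewrite mink_s mink_t conn4_s0s; lra.
Qed.

Lemma conn4_A00 A t x : 0 < t -> conn4 A tI tI (event t x) = 0.
Proof. by move=> t0; have := conn4_antisym A tI tI x t0; rewrite mink_t; lra. Qed.

Definition lapse_grad (I : 'I_3) (t : R) (x : T3) : R := \sum_a fr t x I a * pd a (lapse S t) x.

(** The component along e_I of the acceleration D_{e_0} e_0; see [conn4_00s]. *)
Definition accel (I : 'I_3) (t : R) (x : T3) : R := (lapse S t x)^-1 * lapse_grad I t x.

Hypothesis fermi : fermi_propagated S.

Lemma conn4_0s I D t x : 0 < t ->
  conn4 tI (sI I) D (event t x) = accel I t x * (tI == D)%:R.
Proof.
move=> t0; rewrite /conn4 /conn spt_frame_t spt_frame_s.
have -> : inner (metric4 S) (cov (metric4 S) (e0_vec S) (e_vec S I)) (spt_frame S D) (event t x)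
    = accel I t x * inner (metric4 S) (spt_frame S tI) (spt_frame S D) (event t x).
  rewrite /inner (fermi x I (ltW t0)) deriv_along_e /accel /lapse_grad spt_frame_t.
  by rewrite -!scalemxAl mxE.
have z0 : 0 <= (event t x) 0 0 by rewrite event_t ltW.
rewrite (spt_orthonormal z0); have [<-|] := eqVneq; rewrite ?mulr0// !mulr1 mink_t; ring.
Qed.

Lemma conn4_00s I t x : 0 < t -> conn4 tI tI (sI I) (event t x) = accel I t x.
Proof.
move=> t0; have := conn4_antisym tI tI (sI I) x t0.
by rewrite mink_t mink_s conn4_0s// eqxx mulr1; lra.
Qed.

Let e3 t (K : 'I_3) (y : T3) : T3 := row K (fr t y).

Lemma gamE I J B t x : gam I J B t x = conn (gmet S t) (e3 t) (fun=> 1) I J B x.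
Proof. by rewrite /conn mul1r. Qed.

Lemma inner_slice (Y Z : M4 -> M4) (Y3 Z3 : T3 -> T3) t x :
  (forall i, Y (event t x) 0 (sI i) = Y3 x 0 i) -> (forall i, Z (event t x) 0 (sI i) = Z3 x 0 i) ->
  Y (event t x) 0 tI = 0 -> inner (metric4 S) Y Z (event t x) = inner (gmet S t) Y3 Z3 x.
Proof.
move=> HY HZ Y0; rewrite !innerE sum4 big1 ?add0r; last by move=> b _; rewrite Y0 !mul0r.
apply: eq_bigr => a _; rewrite sum4 metric4_st mulr0 mul0r add0r; apply: eq_bigr => b _.
by rewrite HY HZ metric4_ss lift4_event.
Qed.

Lemma slice_orthonormal t x : 0 <= t -> orthonormal_at (gmet S t) (e3 t) (fun=> 1) x.
Proof.
move=> t0 A B; rewrite mul1r -(orth x A B t0); apply/esym/inner_slice.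
- by move=> i; rewrite e_vec_s lift4_event mxE.
- by move=> i; rewrite e_vec_s lift4_event mxE.
- by rewrite e_vec_t.
Qed.

Lemma slice_sym t x : 0 <= t -> sym_near (gmet S t) x.
Proof.
move=> t0; apply: near_pt_all => y a b; have [_ [sg _]] := pos y t0.
by rewrite -{1}sg mxE.
Qed.

Lemma slice_gmet_diff1 t x a b : diff1 (fun y => gmet S t y a b) x.
Proof. exact: diff2_diff1 (Ck2_diff2 _ (Ck_slice t (gmet_C2 a b))). Qed.

Lemma slice_frame_C2 t K i : Ck 2 (fun y => fr t y K i).
Proof. exact: (Ck_slice t (frame_C2 K i)). Qed.

Lemma slice_vdiff1 t x K : vdiff1 (e3 t K) x.
Proof.
move=> n; have -> : (fun y => e3 t K y 0 n) = fun y => fr t y K n.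
  by apply/funext => y; rewrite mxE.
exact: diff2_diff1 (Ck2_diff2 _ (slice_frame_C2 t K n)).
Qed.

Lemma slice_orthonormal_near t x : 0 <= t ->
  near_pt x (orthonormal_at (gmet S t) (e3 t) (fun=> 1)).
Proof. by move=> t0; apply: near_pt_all => y; exact: slice_orthonormal. Qed.

Lemma gam_antisym I J B t x : 0 <= t -> gam I J B t x = - gam I B J t x.
Proof.
move=> t0; rewrite !gamE.
have := @conn_antisym R 3 (gmet S t) (e3 t) (fun=> 1) (fun=> mulr1 1) I J B x
  (slice_orthonormal_near x t0) (slice_sym x t0) (fun a b => @slice_gmet_diff1 t x a b) (fun K => @slice_vdiff1 t x K).
by rewrite !mul1r; lra.
Qed.

Definition bracket (I J i : 'I_3) (t : R) (x : T3) : R :=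
  \sum_a (fr t x I a * pd a (fun y => fr t y J i) x - fr t x J a * pd a (fun y => fr t y I i) x).

Definition coframe (i K : 'I_3) (t : R) (x : T3) : R := \sum_b gmet S t x i b * fr t x K b.

Lemma e3_bracket t x I J l :
  \sum_m (e3 t I x 0 m * pd m (fun y => e3 t J y 0 l) x
    - e3 t J x 0 m * pd m (fun y => e3 t I y 0 l) x) = bracket I J l t x.
Proof.
have E K k : (fun y => e3 t K y 0 k) = fun y => fr t y K k by apply/funext => y; rewrite mxE.
by apply: eq_bigr => a _; rewrite !E !mxE.
Qed.

Lemma e3_dual t x l B : frame_dual (gmet S t) (e3 t) (fun=> 1) x l B = coframe l B t x.
Proof. by rewrite /frame_dual mul1r; apply: eq_bigr => b _; rewrite mxE. Qed.

Lemma coframeP t x : 0 <= t ->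
  (forall l m, \sum_A coframe l A t x * fr t x A m = (l == m)%:R) /\
  (forall D A, \sum_l fr t x D l * coframe l A t x = (D == A)%:R).
Proof.
move=> t0; have [H1 H2] := frame_dualP (fun=> mulr1 1) (slice_orthonormal x t0).
split=> [l m|D A]; [rewrite -H1|rewrite -H2]; apply: eq_bigr => K _; rewrite e3_dual mxE//.
Qed.

Lemma gam_torsion I J B t x : 0 <= t ->
  gam I J B t x - gam J I B t x = \sum_l bracket I J l t x * coframe l B t x.
Proof.
move=> t0; rewrite !gamE (@conn_torsion _ _ _ _ _ _ _ _ _ (slice_orthonormal_near x t0) (slice_sym x t0)).
by apply: eq_bigr => l _; rewrite e3_bracket e3_dual.
Qed.

Lemma bracket_frame I J i t x : 0 <= t ->
  bracket I J i t x = \sum_K (gam I J K t x - gam J I K t x) * fr t x K i.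
Proof.
move=> t0; under eq_bigr do rewrite gam_torsion// mulr_suml.
rewrite exchange_big /= -(sum_delta_l (fun l => bracket I J l t x)).
apply: eq_bigr => l _; rewrite eq_sym -(coframeP x t0).1 mulr_suml.
by apply: eq_bigr => K _; rewrite mulrC mulrA.
Qed.

Lemma spt_pd_s0 I (y : M4) m : pd m (fun y => spt_frame S (sI I) y 0 tI) y = 0.
Proof.
have -> : (fun y => spt_frame S (sI I) y 0 tI) = fun=> 0.
  by apply/funext => w; rewrite spt_frame_s e_vec_t.
exact: pd_cst.
Qed.

Lemma conn4_ss_torsion I J D t x : 0 < t ->
  conn4 (sI I) (sI J) D (event t x) - conn4 (sI J) (sI I) D (event t x)
  = \sum_l bracket I J l t x * frame_dual (metric4 S) (spt_frame S) mink (event t x) (sI l) D.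
Proof.
move=> t0; have z0 := event_pos x t0.
rewrite /conn4 (@conn_torsion _ _ _ _ _ _ _ _ _ (spt_orthonormal_near z0) (metric4_sym_near z0)).
rewrite sum4 big1 ?mul0r ?add0r; last by move=> m _; rewrite !spt_pd_s0 !mulr0 subrr.
apply: eq_bigr => l _; congr (_ * _); rewrite sum4 !spt_frame_s !e_vec_t !mul0r subrr add0r.
apply: eq_bigr => a _; rewrite !e_vec_s !lift4_event.
have E K : (fun y => e_vec S K y 0 (sI l)) = lift4 (fun t x => fr t x K l).
  by apply/funext => w; rewrite e_vec_s.
by rewrite !E !pd_space.
Qed.

(** Koszul: both sides are antisymmetric in the last two indices, and both have the torsion given by
    the brackets [e_I, e_J], computed once in spacetime and once in the slice. *)
Lemma conn4_sss I J B t x : 0 < t -> conn4 (sI I) (sI J) (sI B) (event t x) = gam I J B t x.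
Proof.
move=> t0; move: I J B.
apply: (antisym_torsion_unique (h := fun I J B => gam I J B t x)) => [I J B|I J B|I J B].
- by have := conn4_antisym (sI I) (sI J) (sI B) x t0; rewrite !mink_s; lra.
- exact/gam_antisym/ltW.
- rewrite conn4_ss_torsion// gam_torsion ?ltW//; apply: eq_bigr => l _; congr (_ * _).
  rewrite /frame_dual mink_s mul1r sum4 metric4_st mul0r add0r; apply: eq_bigr => b _.
  by rewrite metric4_ss lift4_event spt_frame_s e_vec_s lift4_event.
Qed.

(** The spatial components of [e_0, e_I] = D_{e_0} e_I - D_{e_I} e_0: the first term is along e_0 by
    Fermi propagation, the second has the coefficients - k_IJ. *)
Lemma frame_evolution I i (t : R) x : 0 < t ->
  is_derive t (1:R) (fun s : R => fr s x I i) (lapse S t x * \sum_C kk I C t x * fr t x C i).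
Proof.
move=> t0; have z0 := event_pos x t0; have [n0 _] := pos x (ltW t0).
apply: (@is_derive_time (fun s y => fr s y I i)).
  exact: diff2_diff1 (Ck2_diff2 _ (frame_C2 I i)).
have := torsion_free (spt_frame S tI) (spt_frame S (sI I)) (sI i) (metric4_sym_near z0).
have cc := connP mink2 (near_pt_at (spt_orthonormal_near z0)).
rewrite !cc -/conn4 !sum4 spt_frame_t e0_vec_s !mulr0 !add0r.
rewrite [X in _ = _ + X -> _]big1 ?addr0; last first.
  move=> j _; rewrite e0_vec_s mul0r spt_frame_s.
  have -> : (fun y => e0_vec S y 0 (sI i)) = fun=> 0 by apply/funext => w; rewrite e0_vec_s.
  by rewrite pd_cst mulr0 subrr.
rewrite spt_frame_s e_vec_t mul0r subr0 e0_vec_t lift4_event.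
have -> : (fun y => e_vec S I y 0 (sI i)) = lift4 (fun t x => fr t x I i).
  by apply/funext => w; rewrite e_vec_s.
rewrite [X in X - _ = _ -> _]big1 ?sub0r; last first.
  by move=> j _; rewrite conn4_0s// eq_lrshift mulr0 mul0r.
set d := pd tI _ _ => E.
have -> : d = lapse S t x * ((lapse S t x)^-1 * d) by rewrite mulrA mulfV ?mul1r// lt0r_neq0.
rewrite -E; congr (_ * _); rewrite -sumrN; apply: eq_bigr => J _.
by rewrite conn4_s0s spt_frame_s e_vec_s lift4_event mulNr opprK.
Qed.

Lemma deriv_along_near (X : M4 -> M4) (f g : M4 -> R) z : near_pt z (fun y => f y = g y) ->
  deriv_along X f z = deriv_along X g z.
Proof. by move=> H; apply: eq_bigr => m _; rewrite (pd_near m H). Qed.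

Lemma near_event t x (f g : M4 -> R) : 0 < t ->
  (forall s y, 0 < s -> f (event s y) = g (event s y)) ->
  near_pt (event t x) (fun y => f y = g y).
Proof.
move=> t0 H; apply: near_pt_sub (future_near (event_pos x t0)) => y y0.
by rewrite -(event_eta y); exact: H.
Qed.

Lemma kk_diff1 I J t x : 0 < t -> diff1 (lift4 (kk I J)) (event t x).
Proof.
move=> t0; apply: (@diff1_near _ _ (fun y => - conn4 (sI I) tI (sI J) y)).
  by apply: near_event => // s y s0; rewrite conn4_s0s opprK lift4_event.
by apply: diff1N; apply: conn4_diff1; exact: event_pos.
Qed.

Lemma gam_diff1 I J B t x : 0 < t -> diff1 (lift4 (gam I J B)) (event t x).
Proof.
move=> t0; apply: (@diff1_near _ _ (conn4 (sI I) (sI J) (sI B))).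
  by apply: near_event => // s y s0; rewrite conn4_sss// lift4_event.
by apply: conn4_diff1; exact: event_pos.
Qed.

Lemma slice_diff1 (f : R -> T3 -> R) t x : diff1 (lift4 f) (event t x) -> diff1 (f t) x.
Proof. by move=> df i; apply: derivable_space; exact: df. Qed.

Lemma lapse_diff1 t x : diff1 (lapse S t) x.
Proof. exact: diff2_diff1 (Ck2_diff2 _ (Ck_slice t lapse_C2)). Qed.

Lemma lapse_grad_diff1 I t x : diff1 (lapse_grad I t) x.
Proof.
apply: diff1_sum => a _; apply: diff1M; first exact: diff2_diff1 (Ck2_diff2 _ (slice_frame_C2 t I a)).
by apply: (Ck2_diff2 x (Ck_slice t lapse_C2)).2.
Qed.

Lemma accel_diff1 I t x : 0 <= t -> diff1 (accel I t) x.
Proof.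
move=> t0; have [n0 _] := pos x t0; apply: diff1M; last exact: lapse_grad_diff1.
by apply: diff1V; [exact: lt0r_neq0|exact: lapse_diff1].
Qed.

Lemma pd_accel a I t x : 0 <= t -> pd a (accel I t) x =
  (lapse S t x)^-1 * pd a (lapse_grad I t) x - (lapse S t x)^-1 * pd a (lapse S t) x * accel I t x.
Proof.
move=> t0; have [n0 _] := pos x t0; have nn := lt0r_neq0 n0.
rewrite /accel (@pd_mul _ _ _ (fun y => (lapse S t y)^-1)); last exact: lapse_grad_diff1.
  by rewrite pdV//; [field|exact: lapse_diff1].
by apply: diff1V => //; exact: lapse_diff1.
Qed.

Variable Lam : R.
Hypothesis einst : einstein_scalar S Lam.

(* The frame components of the Ricci tensor of the slice, minus e_I psi e_J psi. *)
Definition src (I J : 'I_3) (t : R) (x : T3) : R :=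
  \sum_C \sum_a fr t x C a * pd a (gam I J C t) x
  - \sum_C \sum_a fr t x I a * pd a (gam C J C t) x
  - \sum_C \sum_D gam C I D t x * gam D J C t x
  - \sum_C \sum_D gam I J D t x * gam C C D t x
  - e_psi S I t x * e_psi S J t x.

Lemma ricci_contract I J t x : 0 <= t ->
  \sum_s \sum_n spt_frame S (sI J) (event t x) 0 s * spt_frame S (sI I) (event t x) 0 n
    * ricci (metric4 S) s n (event t x)
  = Lam * (I == J)%:R + e_psi S I t x * e_psi S J t x.
Proof.
move=> t0; have z0 : 0 <= (event t x) 0 0 by rewrite event_t.
transitivity (Lam * inner (metric4 S) (spt_frame S (sI J)) (spt_frame S (sI I)) (event t x)
  + deriv_along (spt_frame S (sI I)) (lift4 (scal S)) (event t x)
    * deriv_along (spt_frame S (sI J)) (lift4 (scal S)) (event t x)).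
  rewrite innerE mulr_sumr [X in _ + X]mulrC /deriv_along mulr_suml -big_split.
  apply: eq_bigr => s _ /=; rewrite !mulr_sumr -big_split; apply: eq_bigr => n _ /=.
  by rewrite (einst x t0).1; ring.
by rewrite (spt_orthonormal z0) mink_s mul1r eq_rshift eq_sym !spt_frame_s.
Qed.

Lemma conn4_trace_0 t x : 0 < t -> \sum_A conn4 A tI A (event t x) = - trk S t x.
Proof.
move=> t0; rewrite sum4 conn4_A00// add0r -sumrN; apply: eq_bigr => C _.
exact: conn4_s0s.
Qed.

Lemma conn4_trace_s K t x : 0 < t ->
  \sum_A conn4 A (sI K) A (event t x) = accel K t x + \sum_C gam C K C t x.
Proof.
move=> t0; rewrite sum4 conn4_0s// eqxx mulr1; congr (_ + _).
by apply: eq_bigr => C _; rewrite conn4_sss.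
Qed.

Lemma einstein_frame I J t x : 0 < t ->
  Lam * (I == J)%:R + e_psi S I t x * e_psi S J t x =
   \sum_D (deriv_along (spt_frame S D) (conn4 (sI I) (sI J) D) (event t x) +
       conn4 (sI I) (sI J) D (event t x) * \sum_A conn4 A D A (event t x)) -
   \sum_A \sum_E conn4 A (sI I) E (event t x) * conn4 E (sI J) A (event t x) -
   deriv_along (spt_frame S (sI I)) (fun y => \sum_A conn4 A (sI J) A y) (event t x).
Proof.
move=> t0; have z0 := event_pos x t0; have non := spt_orthonormal_near z0.
rewrite -ricci_contract ?ltW//.
apply: (@frame_ricci R _ (metric4 S) (spt_frame S) conn4 (frame_dual (metric4 S) (spt_frame S) mink)).
- by apply: near_pt_sub (near_pt_near (metric4_sym_near z0)) => y sy l m n; exact: christoffel_sym.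
- by move=> l m n; exact: christoffel4_diff1.
- by move=> A; exact: spt_vdiff1.
- by move=> m l; apply: (@spt_frame_diff2 _ (sI J) l z0).2.
- move=> k m l; case: (split_ordP l) => [i ->|i ->].
    have E n : pd n (fun y => spt_frame S (sI J) y 0 (lshift 3 i)) = fun=> 0.
      by apply/funext => y; rewrite !ord1 -/tI spt_pd_s0.
    by rewrite !E !pd_cst.
  have -> : (fun y => spt_frame S (sI J) y 0 (rshift 1 i)) = lift4 (fun t x => fr t x J i).
    by apply/funext => w; rewrite -/(sI i) spt_frame_s e_vec_s.
  by rewrite (pd_comm _ _ (frame_C2 J i)).
- by move=> D; exact: conn4_diff1.
- by apply: near_pt_sub non => y; exact/frame_dualP/mink2.
- by apply: near_pt_sub non => y; exact/connP/mink2.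
Qed.

(** In [einstein_frame] the term D = 0 contains the derivative along e_0 of the coefficient - k_IJ,
    hence the time derivative. Fermi propagation annihilates the mixed products in the quadratic
    term, so that tr k times k_IJ is the only product of components of k. *)
Lemma kk_evolution I J (t : R) x : 0 < t ->
  is_derive t (1:R) (fun s : R => kk I J s x)
   (lapse S t x * (trk S t x * kk I J t x + src I J t x - Lam * (I == J)%:R)
    - \sum_a fr t x I a * pd a (lapse_grad J t) x + \sum_K gam I J K t x * lapse_grad K t x).
Proof.
move=> t0; have z0 := event_pos x t0; have [n0 _] := pos x (ltW t0).
have nn := lt0r_neq0 n0.
apply: is_derive_time; first exact: kk_diff1.
have := einstein_frame I J x t0.
rewrite sum4 conn4_trace_0// spt_frame_t !conn4_ss0// [X in _ - X - _]sum4.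
have -> : deriv_along (e0_vec S) (conn4 (sI I) (sI J) tI) (event t x)
    = - ((lapse S t x)^-1 * pd tI (lift4 (kk I J)) (event t x)).
  rewrite (@deriv_along_near _ _ (lift4 (fun t x => - kk I J t x))); last first.
    by apply: near_event => // s y s0; rewrite conn4_ss0// lift4_event.
  have dk : derivable ((kk I J) ^~ x) t 1 by apply: derivable_time; exact: kk_diff1.
  by rewrite deriv_along_e0 pd_time deriveN// mulrN.
have -> : \sum_i (deriv_along (spt_frame S (sI i)) (conn4 (sI I) (sI J) (sI i)) (event t x)
     + conn4 (sI I) (sI J) (sI i) (event t x) * \sum_A conn4 A (sI i) A (event t x))
  = \sum_C (\sum_a fr t x C a * pd a (gam I J C t) x
     + gam I J C t x * (accel C t x - \sum_D gam D D C t x)).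
  apply: eq_bigr => C _; rewrite conn4_sss// conn4_trace_s//; congr (_ + _ * (_ + _)).
    rewrite (@deriv_along_near _ _ (lift4 (gam I J C))); last first.
      by apply: near_event => // s y s0; rewrite conn4_sss// lift4_event.
    by rewrite spt_frame_s deriv_along_e.
  by rewrite -sumrN; apply: eq_bigr => D _; rewrite gam_antisym// ltW.
have -> : \sum_E conn4 tI (sI I) E (event t x) * conn4 E (sI J) tI (event t x)
    = accel I t x * accel J t x.
  rewrite sum4 !conn4_0s// eqxx !mulr1 big1 ?addr0// => E _.
  by rewrite conn4_0s// eq_lrshift mulr0 mul0r.
have -> : \sum_i \sum_E conn4 (sI i) (sI I) E (event t x) * conn4 E (sI J) (sI i) (event t x)
    = \sum_C \sum_D gam C I D t x * gam D J C t x.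
  apply: eq_bigr => C _; rewrite sum4 [X in _ * X + _]conn4_0s// eq_lrshift !mulr0 add0r.
  by apply: eq_bigr => D _; rewrite !conn4_sss.
have -> : deriv_along (spt_frame S (sI I)) (fun y => \sum_A conn4 A (sI J) A y) (event t x)
    = \sum_a fr t x I a * pd a (accel J t) x
    + \sum_C \sum_a fr t x I a * pd a (gam C J C t) x.
  rewrite (@deriv_along_near _ _ (lift4 (fun t x => accel J t x + \sum_C gam C J C t x))); last first.
    by apply: near_event => // s y s0; rewrite conn4_trace_s// lift4_event.
  have dg C y : diff1 (gam C J C t) y by apply: slice_diff1; exact: gam_diff1.
  rewrite spt_frame_s deriv_along_e.
  have E a : pd a (fun y => accel J t y + \sum_C gam C J C t y) x
      = pd a (accel J t) x + \sum_C pd a (gam C J C t) x.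
    rewrite (@pd_add _ _ _ (accel J t)) ?pd_sum//; first by exact/accel_diff1/ltW.
    by apply: diff1_sum.
  under eq_bigr do rewrite E mulrDr.
  by rewrite big_split sum_mulr_exchange.
(* The product [accel I t x * accel J t x], due to the derivative of the inverse lapse, cancels the
   one found in the quadratic term; only the Hessian of the lapse remains. *)
have -> : \sum_a fr t x I a * pd a (accel J t) x
    = (lapse S t x)^-1 * \sum_a fr t x I a * pd a (lapse_grad J t) x - accel I t x * accel J t x.
  under eq_bigr do rewrite pd_accel ?ltW// mulrBr.
  rewrite sumrB mulr_sumr; congr (_ - _).
    by apply: eq_bigr => a _; rewrite mulrCA.
  rewrite [X in _ = X * _]/accel /lapse_grad mulr_sumr mulr_suml.
  by apply: eq_bigr => a _; ring.
rewrite big_split /=.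
have -> : \sum_C gam I J C t x * (accel C t x - \sum_D gam D D C t x)
   = (lapse S t x)^-1 * \sum_K gam I J K t x * lapse_grad K t x
    - \sum_C \sum_D gam I J D t x * gam C C D t x.
  rewrite mulr_sumr [X in _ - X]exchange_big -sumrB /=; apply: eq_bigr => C _.
  by rewrite -mulr_sumr /accel; ring.
rewrite /src; set A1 := \sum_C \sum_a fr t x C a * _; set A2 := \sum_C \sum_a fr t x I a * _.
set A3 := \sum_C \sum_D gam C I D t x * _; set A4 := \sum_C \sum_D gam I J D t x * _.
set A5 := \sum_K gam I J K t x * _; set A6 := \sum_a _; set k := kk I J t x.
set d := pd tI _ _; set p := e_psi S I t x * _; set q := accel I t x * _; set T := trk S t x.
set n := lapse S t x in nn *; set L := Lam * _.
move=> E.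
have -> : d = - n * (- (n^-1 * d)) by field.
have -> : - (n^-1 * d) = L + p - (- k * - T + (A1 + (n^-1 * A5 - A4)) - (q + A3)
   - (n^-1 * A6 - q + A2)) by rewrite E; ring.
field; exact: nn.
Qed.

Lemma lift4_e0_psi : deriv_along (e0_vec S) (lift4 (scal S)) = lift4 (e0_psi S).
Proof. by rewrite [LHS]lift4E. Qed.

Lemma lift4_e_psi I : deriv_along (e_vec S I) (lift4 (scal S)) = lift4 (e_psi S I).
Proof. by rewrite [LHS]lift4E. Qed.

Lemma e0_psi_diff1 t x : 0 <= t -> diff1 (lift4 (e0_psi S)) (event t x).
Proof.
move=> t0; have [n0 _] := pos x t0.
have -> : lift4 (e0_psi S) = fun y => (lift4 (lapse S) y)^-1 * pd tI (lift4 (scal S)) y.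
  apply/funext => y; rewrite -(event_eta y) !lift4_event e0_psiE pd_time//.
apply: diff1M; last by apply: (Ck2_diff2 _ scal_C2).2.
apply: diff1V; first by rewrite lift4_event lt0r_neq0.
exact: diff2_diff1 (Ck2_diff2 _ lapse_C2).
Qed.

(** The wave equation in the frame. The acceleration D_{e_0} e_0 produces the term with the gradient
    of the lapse; the spatial part of the trace produces those with tr k and gamma. *)
Lemma e0_psi_evolution (t : R) x : 0 < t ->
  is_derive t (1:R) (fun s : R => e0_psi S s x)
   (lapse S t x * (trk S t x * e0_psi S t x
       + \sum_C \sum_a fr t x C a * pd a (e_psi S C t) x
       - \sum_C \sum_D gam C C D t x * e_psi S D t x)
    + \sum_C lapse_grad C t x * e_psi S C t x).
Proof.
move=> t0; have z0 := event_pos x t0; have [n0 _] := pos x (ltW t0).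
have nn := lt0r_neq0 n0.
apply: is_derive_time; first exact/e0_psi_diff1/ltW.
have on := near_pt_at (spt_orthonormal_near z0).
have := @frame_box R _ (metric4 S) (spt_frame S) conn4 mink (lift4 (scal S)) (event t x)
  (orthonormal_inv mink2 on).2 (fun A => @spt_vdiff1 _ A z0)
  (fun n => (Ck2_diff2 _ scal_C2).2 n) (connP mink2 on).
rewrite (einst x (ltW t0)).2 sum4 mink_t spt_frame_t lift4_e0_psi deriv_along_e0 -pd_time.
rewrite !sum4 conn4_A00// mul0r add0r.
have -> : \sum_i conn4 tI tI (sI i) (event t x) * deriv_along (spt_frame S (sI i)) (lift4 (scal S)) (event t x)
  = (lapse S t x)^-1 * \sum_C lapse_grad C t x * e_psi S C t x.
  rewrite mulr_sumr; apply: eq_bigr => C _.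
  by rewrite conn4_00s// spt_frame_s lift4_e_psi lift4_event mulrA.
have -> : \sum_i mink (sI i) * (deriv_along (spt_frame S (sI i))
       (deriv_along (spt_frame S (sI i)) (lift4 (scal S))) (event t x)
      - \sum_D conn4 (sI i) (sI i) D (event t x) * deriv_along (spt_frame S D) (lift4 (scal S)) (event t x))
  = \sum_C \sum_a fr t x C a * pd a (e_psi S C t) x + trk S t x * e0_psi S t x
    - \sum_C \sum_D gam C C D t x * e_psi S D t x.
  rewrite /trk mulr_suml -big_split -sumrB; apply: eq_bigr => C _ /=.
  rewrite mink_s mul1r spt_frame_s lift4_e_psi deriv_along_e -addrA; congr (_ + _).
  rewrite sum4 conn4_ss0// spt_frame_t lift4_e0_psi lift4_event opprD mulNr opprK; congr (_ - _).
  by apply: eq_bigr => D _; rewrite conn4_sss// spt_frame_s lift4_e_psi lift4_event.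
set d := pd tI _ _; set n := lapse S t x in nn *; set A := \sum_C \sum_a _; set B := \sum_C \sum_D _.
set T := trk S t x * _; set G := \sum_C _ => E.
have -> : d = n * (n^-1 * d) by field.
have -> : n^-1 * d = n^-1 * G + (A + T - B) by lra.
field; exact: nn.
Qed.

(** The second fundamental form enters the equations of the frame, of e_I psi and of the brackets
    only through this combination. *)
Definition mk (I J : 'I_3) (t : R) (x : T3) : R := lapse S t x * kk I J t x.

Lemma mk_diff1 I J t x : 0 < t -> diff1 (mk I J t) x.
Proof.
move=> t0; apply: diff1M; first exact: lapse_diff1.
by apply: slice_diff1; exact: kk_diff1.
Qed.

Lemma frame_evolution_mk I i (t : R) x : 0 < t ->
  is_derive t (1:R) (fun s : R => fr s x I i) (\sum_C mk I C t x * fr t x C i).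
Proof.
move=> t0; have := frame_evolution I i x t0; rewrite mulr_sumr.
by under eq_bigr do rewrite mulrA.
Qed.

Lemma time_space_comm (f : R -> T3 -> R) (t : R) x a : Ck 2 (lift4 f) ->
  is_derive t (1:R) (fun s => pd a (f s) x) (pd a (fun y => 'D_1 (f ^~ y) t) x).
Proof.
move=> Cf; apply: (@is_derive_time (fun s y => pd a (f s) y)).
  have -> : lift4 (fun s y => pd a (f s) y) = pd (sI a) (lift4 f).
    by rewrite [RHS]lift4E; congr lift4; apply/funext => s; apply/funext => y; rewrite pd_space.
  by apply: (Ck2_diff2 _ Cf).2.
have -> : lift4 (fun s y => pd a (f s) y) = pd (sI a) (lift4 f).
  by rewrite [RHS]lift4E; congr lift4; apply/funext => s; apply/funext => y; rewrite pd_space.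
rewrite (pd_comm _ _ Cf) [X in pd (sI a) X]lift4E pd_space; congr (pd a _ x).
by apply/funext => y; rewrite pd_time.
Qed.

Lemma e_psi_evolution I (t : R) x : 0 < t ->
  is_derive t (1:R) (fun s : R => e_psi S I s x)
   (\sum_C mk I C t x * e_psi S C t x
    + \sum_a fr t x I a * pd a (fun y => lapse S t y * e0_psi S t y) x).
Proof.
move=> t0.
have -> : (fun s => e_psi S I s x) = \sum_a (fun s => fr s x I a * pd a (scal S s) x).
  by apply/funext => s; rewrite e_psiE fct_sumE.
have D a : is_derive t (1:R) (fun s => fr s x I a * pd a (scal S s) x)
   (fr t x I a * pd a (fun y => lapse S t y * e0_psi S t y) x
    + pd a (scal S t) x * \sum_C mk I C t x * fr t x C a).
  have D1 := frame_evolution_mk I a x t0.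
  have D2 := time_space_comm t x a scal_C2.
  have E : (fun y => 'D_1 ((scal S) ^~ y) t) = (fun y => lapse S t y * e0_psi S t y).
    apply/funext => y; have [n0 _] := pos y (ltW t0).
    by rewrite e0_psiE mulrA mulfV ?mul1r// lt0r_neq0.
  rewrite E in D2; exact: is_deriveM.
apply: is_derive_eq; rewrite big_split addrC; congr (_ + _).
under eq_bigr do rewrite mulr_sumr.
rewrite exchange_big; apply: eq_bigr => C _ /=; rewrite e_psiE mulr_sumr.
by apply: eq_bigr => a _; ring.
Qed.

Lemma bracket_evolution I J i (t : R) x : 0 < t ->
  is_derive t (1:R) (fun s : R => bracket I J i s x)
   (\sum_C mk I C t x * bracket C J i t x + \sum_C mk J C t x * bracket I C i t x
    + \sum_C \sum_a (fr t x I a * pd a (mk J C t) x - fr t x J a * pd a (mk I C t) x) * fr t x C i).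
Proof.
move=> t0.
have -> : (fun s => bracket I J i s x) = \sum_a (fun s => fr s x I a * pd a (fun y => fr s y J i) x
    - fr s x J a * pd a (fun y => fr s y I i) x).
  by apply/funext => s; rewrite fct_sumE.
have DV K a : is_derive t (1:R) (fun s => pd a (fun y => fr s y K i) x)
    (\sum_C (pd a (mk K C t) x * fr t x C i + mk K C t x * pd a (fun y => fr t y C i) x)).
  have D2 := time_space_comm t x a (frame_C2 K i).
  have E : (fun y => 'D_1 ((fun s y => fr s y K i) ^~ y) t) = (fun y => \sum_C mk K C t y * fr t y C i).
    by apply/funext => y; have [_ ->] := frame_evolution_mk K i y t0.
  rewrite E pd_sum in D2; last first.
    move=> C _; apply: diff1M; first exact: mk_diff1.
    exact: diff2_diff1 (Ck2_diff2 _ (slice_frame_C2 t C i)).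
  apply: is_derive_eq; apply: eq_bigr => C _; rewrite (@pd_mul _ _ _ (mk K C t))//; first exact: mk_diff1.
  exact: diff2_diff1 (Ck2_diff2 _ (slice_frame_C2 t C i)).
have D a := is_deriveB (is_deriveM (frame_evolution_mk I a x t0) (DV J a))
   (is_deriveM (frame_evolution_mk J a x t0) (DV I a)).
apply: is_derive_eq.
rewrite /bracket.
under [X in _ = X + _ + _]eq_bigr do rewrite mulr_sumr.
under [X in _ = _ + X + _]eq_bigr do rewrite mulr_sumr.
rewrite [X in _ = X + _ + _]exchange_big [X in _ = _ + X + _]exchange_big [X in _ = _ + _ + X]exchange_big.
rewrite -!big_split; apply: eq_bigr => a _ /=.
rewrite /GRing.scale /= !mulr_sumr -[X in X - _ = _]big_split -[X in _ - X = _]big_split -sumrB.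
rewrite -[X in _ = X + _]big_split -[RHS]big_split; apply: eq_bigr => C _ /=.
ring.
Qed.

(** By [bracket_frame] the bracket is the sum of tau_K e_K. Its time derivative is given by
    [bracket_evolution] and that of e_K by the frame equation; contracting with the coframe isolates
    the derivative of tau. *)
Lemma torsion_evolution I J L (t : R) x : 0 < t ->
  is_derive t (1:R) (fun s : R => gam I J L s x - gam J I L s x)
   (\sum_C mk I C t x * (gam C J L t x - gam J C L t x)
    + \sum_C mk J C t x * (gam I C L t x - gam C I L t x)
    - \sum_K (gam I J K t x - gam J I K t x) * mk K L t x
    + \sum_a (fr t x I a * pd a (mk J L t) x - fr t x J a * pd a (mk I L t) x)).
Proof.
move=> t0.
pose tau K s := gam I J K s x - gam J I K s x.
(* The derivative exists because [gam] is differentiable; its value is an unknown that is solved for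
   below. *)
have dtau K : is_derive t (1:R) (tau K) ('D_1 (tau K) t).
  apply: derivableP; apply: derivableB; apply: derivable_time; exact: gam_diff1.
have D i : is_derive t (1:R) (\sum_K (fun s => tau K s * fr s x K i))
    (\sum_K (tau K t * (\sum_C mk K C t x * fr t x C i) + fr t x K i * 'D_1 (tau K) t)).
  have DK K := is_deriveM (dtau K) (frame_evolution_mk K i x t0).
  exact: is_derive_eq.
(* Both sides are derivatives at [t] of one function: [bracket_frame] holds on a neighbourhood of
   [t], as t > 0. *)
have E i : \sum_K (tau K t * (\sum_C mk K C t x * fr t x C i) + fr t x K i * 'D_1 (tau K) t)
  = \sum_C mk I C t x * bracket C J i t x + \sum_C mk J C t x * bracket I C i t x
    + \sum_C \sum_a (fr t x I a * pd a (mk J C t) x - fr t x J a * pd a (mk I C t) x) * fr t x C i.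
  have [_ <-] := D i; have [_ <-] := bracket_evolution I J i x t0.
  apply: near_eq_derive.
  have : \forall s \near t, 0 < s.
    by apply/nbhs_ballP; exists t => // s; rewrite /ball /= ltr_norml => /andP[_]; lra.
  apply: filterS => s s0; rewrite bracket_frame ?ltW// fct_sumE.
  by apply: eq_bigr => K _.
have Phi (v : 'I_3 -> R) : \sum_i (\sum_K v K * fr t x K i) * coframe i L t x = v L.
  under eq_bigr do rewrite mulr_suml.
  rewrite exchange_big -[RHS](sum_delta_l v); apply: eq_bigr => K _ /=.
  rewrite eq_sym -(coframeP x (ltW t0)).2 mulr_suml; apply: eq_bigr => i _; ring.
apply: (is_derive_eq (dtau L)).
have -> : 'D_1 (tau L) t = \sum_i (\sum_K 'D_1 (tau K) t * fr t x K i) * coframe i L t x.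
  by rewrite Phi.
have E' i : \sum_K 'D_1 (tau K) t * fr t x K i =
   (\sum_C mk I C t x * bracket C J i t x + \sum_C mk J C t x * bracket I C i t x
    + \sum_C (\sum_a (fr t x I a * pd a (mk J C t) x - fr t x J a * pd a (mk I C t) x)) * fr t x C i)
    - \sum_C (\sum_K tau K t * mk K C t x) * fr t x C i.
  have -> : \sum_C (\sum_a (fr t x I a * pd a (mk J C t) x - fr t x J a * pd a (mk I C t) x)) * fr t x C i
     = \sum_C \sum_a (fr t x I a * pd a (mk J C t) x - fr t x J a * pd a (mk I C t) x) * fr t x C i.
    by apply: eq_bigr => C _; rewrite mulr_suml.
  rewrite -E big_split /= addrC.
  have -> : \sum_C (\sum_K tau K t * mk K C t x) * fr t x C i
     = \sum_K tau K t * (\sum_C mk K C t x * fr t x C i).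
    under eq_bigr do rewrite mulr_suml.
    rewrite exchange_big; apply: eq_bigr => K _ /=; rewrite mulr_sumr.
    by apply: eq_bigr => C _; rewrite mulrA.
  by rewrite addrK; apply: eq_bigr => K _; rewrite mulrC.
under eq_bigr do rewrite E' mulrBl mulrDl mulrDl.
rewrite sumrB [X in X - _]big_split [X in X + _ - _]big_split /=.
rewrite (Phi (fun C => \sum_a (fr t x I a * pd a (mk J C t) x - fr t x J a * pd a (mk I C t) x))).
rewrite (Phi (fun C => \sum_K tau K t * mk K C t x)) addrAC.
congr (_ + _); congr (_ - _); congr (_ + _).
- under eq_bigr do rewrite mulr_suml.
  rewrite exchange_big; apply: eq_bigr => C _ /=; rewrite gam_torsion ?ltW// mulr_sumr.
  by apply: eq_bigr => l _; rewrite mulrA.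
- under eq_bigr do rewrite mulr_suml.
  rewrite exchange_big; apply: eq_bigr => C _ /=; rewrite gam_torsion ?ltW// mulr_sumr.
  by apply: eq_bigr => l _; rewrite mulrA.
Qed.

Lemma continuous_sum (I : Type) (r : seq I) (F : I -> T3 -> R) :
  (forall i, continuous (F i)) -> continuous (fun y => \sum_(i <- r) F i y).
Proof.
move=> H; elim: r => [|i r IH].
  by under eq_fun do rewrite big_nil; move=> x; exact: cst_continuous.
by under eq_fun do rewrite big_cons; exact: continuous_add.
Qed.

Lemma periodic_pd (f : T3 -> R) i : z3_periodic f -> z3_periodic (pd i f).
Proof.
move=> pf x j; have := congr1 (@^~ x) (pd_shift i f (delta_mx 0 j)) => /= <-.
by congr (pd i _ x); apply/funext => y; exact: pf.
Qed.

Lemma frame_periodic I i t : z3_periodic (fun x => fr t x I i).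
Proof. by case: reg => _ _ _ /(_ I i)[_ H]; exact: H. Qed.

Lemma gmet_periodic i j t : z3_periodic (fun x => gmet S t x i j).
Proof. by case: reg => _ _ /(_ i j)[_ H] _; exact: H. Qed.

Lemma scal_periodic t : z3_periodic (scal S t).
Proof. by case: reg => _ [_ H] _ _; exact: H. Qed.

(** With the inverse metric written as the sum of e_A e_A, continuity and periodicity of the symbols
    reduce to those of the metric and the frame. *)
Lemma slice_christoffel t l m n x : 0 <= t -> christoffel (gmet S t) l m n x
  = 2^-1 * \sum_s (\sum_A fr t x A l * fr t x A s) *
    (pd m (fun y => gmet S t y s n) x + pd n (fun y => gmet S t y s m) x
     - pd s (fun y => gmet S t y m n) x).
Proof.
move=> t0; rewrite /christoffel; congr (_ * _); apply: eq_bigr => s _.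
rewrite (orthonormal_inv (fun=> mulr1 1) (slice_orthonormal x t0)).2; congr (_ * _).
by apply: eq_bigr => A _; rewrite !mxE mul1r.
Qed.

Lemma gam_slice I J B t x : gam I J B t x = \sum_a \sum_b
  (\sum_m fr t x I m * (pd m (fun y => fr t y J a) x
     + \sum_n christoffel (gmet S t) a m n x * fr t x J n)) * gmet S t x a b * fr t x B b.
Proof.
rewrite /Defs.gam innerE; apply: eq_bigr => a _; apply: eq_bigr => b _.
rewrite covE !mxE; congr (_ * _ * _); apply: eq_bigr => m _; rewrite !mxE; congr (_ * _).
rewrite /nabla; congr (_ + _).
  by congr (pd m _ x); apply/funext => y; rewrite mxE.
by apply: eq_bigr => n _; rewrite mxE.
Qed.

(** Continuity and periodicity on every slice, including t = 0, are what [HM_sq_Cb] requires to turn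
    energy bounds into pointwise ones. *)
Lemma gam_continuous I J B t : 0 <= t -> continuous (gam I J B t).
Proof.
move=> t0.
have cF K i : continuous (fun x => fr t x K i) by apply: Ck_cont; exact: slice_frame_C2.
have cG i j : continuous (fun x => gmet S t x i j) by apply: Ck_cont; exact: (Ck_slice t (gmet_C2 i j)).
have cP f m : Ck 2 f -> continuous (pd m f).
  by move=> Cf; have /CkS[_ _ /(_ m)] := Cf; exact: Ck_cont.
have cPF K i m : continuous (pd m (fun x => fr t x K i)) by apply: cP; exact: slice_frame_C2.
have cPG i j m : continuous (pd m (fun x => gmet S t x i j)).
  by apply: cP; exact: (Ck_slice t (gmet_C2 i j)).
have cC l m n : continuous (christoffel (gmet S t) l m n).
  rewrite (funext (fun x => @slice_christoffel t l m n x t0)).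
  apply: (@continuous_mul _ _ (fun=> 2^-1)); first by move=> x; exact: cst_continuous.
  apply: continuous_sum => s; apply: continuous_mul.
    by apply: continuous_sum => A; exact: continuous_mul.
  apply: continuous_add; first exact: continuous_add.
  rewrite (_ : (fun x => _) = fun x => (-1) * pd s (fun y => gmet S t y m n) x); last first.
    by apply/funext => x; rewrite mulN1r.
  by apply: (@continuous_mul _ _ (fun=> -1)) => // x; exact: cst_continuous.
rewrite (funext (fun x => gam_slice I J B t x)).
apply: continuous_sum => a; apply: continuous_sum => b; apply: continuous_mul => //.
apply: continuous_mul => //; apply: continuous_sum => m; apply: continuous_mul => //.
apply: continuous_add => //; apply: continuous_sum => n; exact: continuous_mul.
Qed.

Lemma gam_periodic I J B t : 0 <= t -> z3_periodic (gam I J B t).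
Proof.
move=> t0 x i.
have pPF K k m := periodic_pd m (frame_periodic K k t).
have pPG k l m := periodic_pd m (gmet_periodic k l t).
have pC l m n : christoffel (gmet S t) l m n (x + delta_mx 0 i) = christoffel (gmet S t) l m n x.
  rewrite !slice_christoffel//; congr (_ * _); apply: eq_bigr => s _.
  rewrite !(pPG _ _ _ x i); congr (_ * _); apply: eq_bigr => A _.
  by rewrite !(frame_periodic _ _ t x i).
rewrite !gam_slice; apply: eq_bigr => a _; apply: eq_bigr => b _.
rewrite (gmet_periodic a b t x i) (frame_periodic B b t x i); congr (_ * _ * _).
apply: eq_bigr => m _; rewrite (frame_periodic I m t x i) (pPF J a m x i); congr (_ * (_ + _)).
by apply: eq_bigr => n _; rewrite pC (frame_periodic J n t x i).
Qed.

Lemma e_psi_continuous I t : continuous (e_psi S I t).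
Proof.
rewrite (funext (fun x => e_psiE I t x)).
apply: continuous_sum => a; apply: continuous_mul.
  by apply: Ck_cont; exact: slice_frame_C2.
by have /CkS[_ _ /(_ a)] := Ck_slice t scal_C2; exact: Ck_cont.
Qed.

Lemma e_psi_periodic I t : z3_periodic (e_psi S I t).
Proof.
move=> x i; rewrite !e_psiE; apply: eq_bigr => a _.
by rewrite (frame_periodic I a t x i) (periodic_pd a (scal_periodic t) x i).
Qed.

Lemma frame_continuous I i t : continuous (fun x => fr t x I i).
Proof. by apply: Ck_cont; exact: slice_frame_C2. Qed.

Lemma lapse_periodic t : z3_periodic (lapse S t).
Proof. by case: reg => [[_ H] _ _ _]; exact: H. Qed.

End Components.
End Slices.

(** * The background *)

Section Background.
Context {R : realType}.
Variable b : flrw R.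
Hypotheses (hL : 0 < Lambda b) (ha : 0 < a_init b) (hcoef : flrw_coef b).

Local Notation H := (hubble b).
Local Notation s := (sinh_coef b).

Lemma hubble_gt0 : 0 < H.
Proof. by rewrite sqrtr_gt0 divr_gt0. Qed.

Lemma hubble_sq : 3 * H ^+ 2 = Lambda b.
Proof. by rewrite sqr_sqrtr ?divr_ge0 ?ltW// mulrC divfK// pnatr_eq0. Qed.

Lemma sqrt_3Lambda : Num.sqrt (3 * Lambda b) = 3 * H.
Proof.
have H0 := hubble_gt0.
rewrite -hubble_sq (_ : 3 * (3 * H ^+ 2) = (3 * H) ^+ 2); last by ring.
by rewrite sqrtr_sqr ger0_norm// mulr_ge0// ltW.
Qed.

Lemma sinh_coef_ge1 : 1 <= s.
Proof.
have q x : 0 <= x -> 1 <= Num.sqrt (x + 1) :> R.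
  by move=> x0; rewrite -{1}(sqrtr1 R) ler_sqrt; lra.
by case: hcoef => ->; apply: q; rewrite divr_ge0 ?sqr_ge0// ltW// mulr_gt0.
Qed.

(* The cube of the scale factor, divided by its initial value. *)
Definition vol (t : R) : R := s * sinh (3 * H * t) + cosh (3 * H * t).

Definition dvol (t : R) : R := s * cosh (3 * H * t) + sinh (3 * H * t).

(** This is a'/a ([is_derive_scale]), since [dvol] is the derivative of [vol] divided by 3H. *)
Definition hub (t : R) : R := H * (dvol t / vol t).

Lemma vol_exp (t : R) : vol t = ((s + 1) * expR (3 * H * t) - (s - 1) * expR (- (3 * H * t))) / 2.
Proof. by rewrite /vol /sinh /cosh; field. Qed.

Lemma dvol_exp (t : R) : dvol t = ((s + 1) * expR (3 * H * t) + (s - 1) * expR (- (3 * H * t))) / 2.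
Proof. by rewrite /dvol /sinh /cosh; field. Qed.

Lemma vol_ge (t : R) : 0 <= t -> expR (3 * H * t) <= vol t.
Proof.
move=> t0; rewrite vol_exp; have s1 := sinh_coef_ge1; have H0 := hubble_gt0.
have e1 : expR (- (3 * H * t)) <= expR (3 * H * t).
  by rewrite ler_expR; have := mulr_ge0 (ltW H0) t0; lra.
nra.
Qed.

Lemma vol_gt0 (t : R) : 0 <= t -> 0 < vol t.
Proof. by move=> /vol_ge; apply: lt_le_trans; exact: expR_gt0. Qed.

Lemma is_derive_expM (c t : R) : is_derive t (1:R) (fun t => expR (c * t)) (c * expR (c * t)).
Proof.
have D1 : is_derive t (1:R) (fun t => c * t) c.
  by have := @is_deriveZ _ _ _ (@id R) c t 1 1 (is_derive_id t 1); rewrite [c *: 1]mulr1.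
have := @is_derive1_comp R expR (fun t => c * t) t _ _ (is_derive_expR (c * t)) D1.
by rewrite mulrC.
Qed.

Lemma is_derive_vol (t : R) : is_derive t (1:R) vol (3 * H * dvol t).
Proof.
have -> : vol = (fun t => (s + 1) / 2 * expR (3 * H * t)) - (fun t => (s - 1) / 2 * expR (- (3 * H) * t)).
  by apply/funext => r; rewrite vol_exp !fctE mulNr; field.
have D1 := is_derive_expM (3 * H) t; have D2 := is_derive_expM (- (3 * H)) t.
apply: is_derive_eq; rewrite /GRing.scale /= dvol_exp !mulNr; by field.
Qed.

Lemma is_derive_dvol (t : R) : is_derive t (1:R) dvol (3 * H * vol t).
Proof.
have -> : dvol = (fun t => (s + 1) / 2 * expR (3 * H * t)) + (fun t => (s - 1) / 2 * expR (- (3 * H) * t)).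
  by apply/funext => r; rewrite dvol_exp !fctE mulNr; field.
have D1 := is_derive_expM (3 * H) t; have D2 := is_derive_expM (- (3 * H)) t.
apply: is_derive_eq; rewrite /GRing.scale /= vol_exp !mulNr; by field.
Qed.

(** [dvol - vol] is exactly (s - 1) exp(- 3Ht), and [vol] is at least exp(3Ht). *)
Lemma hub_bound (t : R) : 0 <= t -> `|hub t - H| <= H * (s - 1) * expR (- (6 * H * t)).
Proof.
move=> t0; have v0 := vol_gt0 t0; have s1 := sinh_coef_ge1; have H0 := hubble_gt0.
have E : hub t - H = H * (s - 1) * (expR (- (3 * H * t)) / vol t).
  rewrite /hub; have -> : dvol t = vol t + (s - 1) * expR (- (3 * H * t)).
    by rewrite vol_exp dvol_exp; field.
  by field; exact: lt0r_neq0.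
have B0 : 0 <= H * (s - 1) by apply: mulr_ge0; [exact: ltW|rewrite subr_ge0].
rewrite E ger0_norm; last by rewrite mulr_ge0// divr_ge0 ?expR_ge0// ltW.
rewrite ler_wpM2l// ler_pdivrMr//.
apply: (@le_trans _ _ (expR (- (6 * H * t)) * expR (3 * H * t))).
  by rewrite -expRD ler_expR; lra.
by rewrite ler_wpM2l ?expR_ge0// vol_ge.
Qed.

Lemma scaleE (t : R) : scale b t = a_init b * vol t `^ (3^-1).
Proof. by rewrite /scale sqrt_3Lambda. Qed.

Lemma scale_gt0 (t : R) : 0 <= t -> 0 < scale b t.
Proof. by move=> t0; rewrite scaleE mulr_gt0// powR_gt0// vol_gt0. Qed.

Lemma cube_root_cube (x : R) : 0 <= x -> (x `^ (3^-1)) ^+ 3 = x.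
Proof.
move=> x0; rewrite -powR_mulrn ?powR_ge0// -powRrM.
by rewrite mulVf ?pnatr_eq0// powRr1.
Qed.

Lemma scale_cube (t : R) : 0 <= t -> scale b t ^+ 3 = a_init b ^+ 3 * vol t.
Proof. by move=> t0; rewrite scaleE exprMn cube_root_cube// ltW// vol_gt0. Qed.

Lemma is_derive_scale (t : R) : 0 < t -> is_derive t (1:R) (scale b) (hub t * scale b t).
Proof.
move=> t0; have v0 := vol_gt0 (ltW t0).
have -> : scale b = a_init b *: ((fun x : R => x `^ (3^-1)) \o vol).
  by apply/funext => r; rewrite scaleE.
have D := is_derive1_comp (is_derive1_powR (3^-1) v0) (is_derive_vol t).
apply: is_derive_eq; rewrite /GRing.scale /= /GRing.scale /= /hub powRD; last first.
  by apply/implyP => _; rewrite lt0r_neq0.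
rewrite powRN powRr1 ?ltW//; field; exact: lt0r_neq0.
Qed.

Lemma near_pos (t : R) (f g : R -> R) : 0 < t -> (forall r, 0 < r -> f r = g r) ->
  \forall r \near t, f r = g r.
Proof.
move=> t0 H0; apply/nbhs_ballP; exists t => // r; rewrite /ball /= ltr_norml => /andP[_ rt].
apply: H0; lra.
Qed.

Lemma trk_flrwE (t : R) : 0 < t -> trk_flrw b t = - 3 * hub t.
Proof.
move=> t0; rewrite /trk_flrw derive1E; have [_ ->] := is_derive_scale t0.
by rewrite mulfK// lt0r_neq0// scale_gt0// ltW.
Qed.

Lemma is_derive_hub (t : R) : 0 < t -> is_derive t (1:R) hub (3 * H ^+ 2 - 3 * hub t ^+ 2).
Proof.
move=> t0; have v0 := vol_gt0 (ltW t0); have vn := lt0r_neq0 v0.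
have D1 := is_derive_dvol t; have D2 := is_derive_vol t.
have D3 : is_derive t (1:R) (fun r => (vol r)^-1) (- (3 * H * dvol t) / vol t ^+ 2).
  have := @derivableV _ _ vol t 1 vn (@ex_derive _ _ _ _ _ _ _ D2) => dv.
  split=> //; rewrite (@deriveV _ _ vol t 1 vn (@ex_derive _ _ _ _ _ _ _ D2)) (@derive_val _ _ _ _ _ _ _ D2).
  by rewrite /GRing.scale /=; field; exact: vn.
have E : hub = H *: (dvol * (fun r => (vol r)^-1)) by apply/funext => r.
rewrite {1}E; apply: is_derive_eq; rewrite /GRing.scale /= /hub; field; exact: vn.
Qed.

Lemma is_derive_trk_flrw (t : R) : 0 < t ->
  is_derive t (1:R) (trk_flrw b) (9 * hub t ^+ 2 - 9 * H ^+ 2).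
Proof.
move=> t0; apply: (@near_eq_is_derive _ _ _ (- 3 *: hub)).
  by apply: near_pos => // r r0; rewrite trk_flrwE.
have D := is_derive_hub t0; apply: is_derive_eq; rewrite /GRing.scale /=; ring.
Qed.

Definition dpsi (t : R) : R := phi_init b * (vol t)^-1.

Lemma is_derive_dpsi (t : R) : 0 < t -> is_derive t (1:R) dpsi (- 3 * hub t * dpsi t).
Proof.
move=> t0; have v0 := vol_gt0 (ltW t0); have vn := lt0r_neq0 v0.
have D2 := is_derive_vol t.
have D3 : is_derive t (1:R) (fun r => (vol r)^-1) (- (3 * H * dvol t) / vol t ^+ 2).
  have := @derivableV _ _ vol t 1 vn (@ex_derive _ _ _ _ _ _ _ D2) => dv.
  split=> //; rewrite (@deriveV _ _ vol t 1 vn (@ex_derive _ _ _ _ _ _ _ D2)) (@derive_val _ _ _ _ _ _ _ D2).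
  by rewrite /GRing.scale /=; field; exact: vn.
have E : dpsi = phi_init b *: (fun r => (vol r)^-1) by apply/funext => r.
rewrite {1}E; apply: is_derive_eq; rewrite /GRing.scale /= /hub /dpsi; field; exact: vn.
Qed.

(** The fundamental theorem of calculus: for nonnegative arguments the integrand is the inverse of
    [vol], the factor [a_init b ^+ 3] cancelling. *)
Lemma derive1_psi_flrw (t : R) : 0 < t -> derive1 (psi_flrw b) t = dpsi t.
Proof.
move=> t0; pose f := fun r : R => a_init b ^+ 3 / scale b r ^+ 3.
have fE r : 0 <= r -> f r = (vol r)^-1.
  move=> r0; rewrite /f scale_cube// invfM mulrA divff ?mul1r//.
  by rewrite expf_neq0// lt0r_neq0.
have cvol : continuous vol.
  by move=> r; apply: differentiable_continuous; apply/derivable1_diffP; case: (is_derive_vol r).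
have cV r : 0 <= r -> {for r, continuous (fun r => (vol r)^-1)}.
  by move=> r0; apply: (@continuousV _ _ vol); [rewrite lt0r_neq0// vol_gt0|exact: cvol].
have tt1 : t < t + 1 by rewrite ltrDl.
have int_f : (@lebesgue_measure R).-integrable `[0%R, t + 1] (EFin \o f).
  apply: continuous_compact_integrable; first exact: segment_compact.
  apply: (@subspace_eq_continuous _ _ _ (fun r => (vol r)^-1)).
    by move=> r; rewrite inE /= in_itv /= => /andP[r0 _]; exact/esym/fE.
  apply: continuous_in_subspaceT => r; rewrite inE /= in_itv /= => /andP[r0 _]; exact: cV.
have cf : {for t, continuous f}.
  have nf : \forall r \near t, (vol r)^-1 = f r.
    by apply: near_pos => // r r0; rewrite fE// ltW.
  rewrite /prop_for /continuous_at fE ?ltW//; apply: cvg_trans (cV t (ltW t0)).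
  exact: near_eq_cvg.
have [dF F'] := continuous_FTC1_closed tt1 int_f t0 cf.
have D : is_derive t (1:R) (int0 f) (f t).
  have D0 : is_derive t (1:R) (fun x => \int[@lebesgue_measure R]_(t in `[0%R, x]) f t)%R (f t).
    by split; [exact: dF|rewrite -derive1E; exact: F'].
  apply: (near_eq_is_derive _ D0).
  by apply: near_pos => // r r0; rewrite /int0 ltW.
have D' : is_derive t (1:R) (psi_flrw b) (phi_init b * f t).
  have -> : psi_flrw b = cst (psi_init b) + phi_init b *: int0 f by apply/funext => r.
  move: D; move: (int0 f) (f t) => g v D.
  have D1 := is_deriveD (@is_derive_cst _ _ _ (psi_init b) t 1) (is_deriveZ (phi_init b) D).
  by apply: (is_derive_eq D1); rewrite add0r.
rewrite derive1E; have [_ ->] := D'.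
by rewrite fE// ltW.
Qed.

Lemma is_derive_dpsi_flrw (t : R) : 0 < t ->
  is_derive t (1:R) (derive1 (psi_flrw b)) (- 3 * hub t * dpsi t).
Proof.
move=> t0; apply: (near_eq_is_derive _ (is_derive_dpsi t0)).
by apply: near_pos => // r r0; rewrite derive1_psi_flrw.
Qed.

Lemma inv_anti (x y : R) : 0 < x -> x <= y -> y^-1 <= x^-1.
Proof. by move=> x0 xy; rewrite lef_pV2 ?posrE//; exact: lt_le_trans xy. Qed.

Lemma dpsi_bound (t : R) : 0 < t -> `|dpsi t| <= `|phi_init b| * expR (- (3 * H * t)).
Proof.
move=> t0; have v0 := vol_gt0 (ltW t0).
rewrite /dpsi normrM ler_wpM2l// expRN gtr0_norm ?invr_gt0//.
by apply: inv_anti; [exact: expR_gt0|exact/vol_ge/ltW].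
Qed.

Let root t := vol t `^ (3^-1).
Let croot := (2^-1 * s + 2^-1) `^ (3^-1).

Lemma root_ge (t : R) : 0 <= t -> expR (H * t) <= root t.
Proof.
move=> t0; rewrite -(@ler_pXn2r _ 3) ?nnegrE ?expR_ge0 ?powR_ge0// cube_root_cube; last first.
  by rewrite ltW// vol_gt0.
by rewrite -expRM_natl (_ : 3%:R * (H * t) = 3 * H * t) ?vol_ge//; ring.
Qed.

(** Let X be the cube root of [vol] and Z its leading part; then Z^3 - X^3 = (s - 1)/2 exp(- 3Ht).
    Dividing by Z^2 + ZX + X^2 and by XZ, each at least exp(2Ht), leaves exp(- 7Ht). *)
Lemma inv_scale_bound (t : R) : 0 <= t ->
  `|(scale b t)^-1 - inv_scale_limit b * expR (- (H * t))|
   <= (a_init b)^-1 * ((s - 1) / 2) * expR (- (7 * H * t)).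
Proof.
move=> t0; have s1 := sinh_coef_ge1.
pose X := root t; pose Z := croot * expR (H * t); pose e := expR (H * t).
have e0 : 0 < e by exact: expR_gt0.
have eX : e <= X by exact: root_ge.
have X0 : 0 < X by exact: lt_le_trans eX.
have X3 : X ^+ 3 = vol t by rewrite cube_root_cube// ltW// vol_gt0.
have c0 : 0 < croot by rewrite powR_gt0//; lra.
have Z0 : 0 < Z by rewrite mulr_gt0.
have e3 : e ^+ 3 = expR (3 * H * t).
  by rewrite -expRM_natl; congr expR; ring.
have Z3 : Z ^+ 3 = (2^-1 * s + 2^-1) * expR (3 * H * t).
  by rewrite exprMn cube_root_cube -/e ?e3//; lra.
have d3 : Z ^+ 3 - X ^+ 3 = (s - 1) / 2 * expR (- (3 * H * t)).
  by rewrite Z3 X3 vol_exp; field.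
have XZ : X <= Z.
  rewrite -(@ler_pXn2r _ 3) ?nnegrE ?(ltW X0) ?(ltW Z0)//.
  have : 0 <= Z ^+ 3 - X ^+ 3 by rewrite d3; apply: mulr_ge0; [lra|exact: expR_ge0].
  lra.
have -> : (scale b t)^-1 - inv_scale_limit b * expR (- (H * t)) = (a_init b)^-1 * ((Z - X) / (X * Z)).
  rewrite scaleE -/(root t) -/X /inv_scale_limit powRN -/croot expRN -/e /Z -/e.
  by field; rewrite !lt0r_neq0.
have q0 : 0 <= (Z - X) / (X * Z) by rewrite divr_ge0 ?subr_ge0// mulr_ge0 ?(ltW X0) ?(ltW Z0).
rewrite ger0_norm; last by rewrite mulr_ge0// invr_ge0 ltW.
rewrite -mulrA ler_wpM2l ?invr_ge0 ?(ltW ha)//.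
have e7 : expR (- (7 * H * t)) = expR (- (3 * H * t)) / (e ^+ 2 * e ^+ 2).
  rewrite /e -exprD -expRM_natl -expRN -expRD; congr expR; ring.
rewrite e7 [leRHS]mulrA -d3 ler_pdivlMr ?mulr_gt0 ?exprn_gt0//.
have -> : Z ^+ 3 - X ^+ 3 = (Z - X) * (Z ^+ 2 + Z * X + X ^+ 2) by ring.
rewrite mulrAC ler_pdivrMr ?mulr_gt0// -[leRHS]mulrA ler_wpM2l ?subr_ge0//.
have eZ : e <= Z by exact: le_trans XZ.
have h1 : e ^+ 2 <= X * Z by rewrite expr2 ler_pM ?(ltW e0).
have h2 : e ^+ 2 <= X ^+ 2 by rewrite ler_sqr ?nnegrE ?(ltW e0) ?(ltW X0).
have h3 : 0 <= Z ^+ 2 + Z * X by rewrite addr_ge0 ?sqr_ge0// mulr_ge0 ?(ltW X0) ?(ltW Z0).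
have XZ0 : 0 <= X * Z by rewrite mulr_ge0 ?(ltW X0) ?(ltW Z0).
have e20 := sqr_ge0 e.
by rewrite [leRHS]mulrC; apply: ler_pM => //; rewrite -[leLHS]add0r lerD.
Qed.

Lemma inv_scale_le (t : R) : 0 <= t -> (scale b t)^-1 <= (a_init b)^-1 * expR (- (H * t)).
Proof.
move=> t0; rewrite scaleE invfM expRN ler_wpM2l ?invr_ge0 ?(ltW ha)//.
by apply: inv_anti; [exact: expR_gt0|exact: root_ge].
Qed.

Lemma scale_le (t : R) : 0 <= t -> scale b t <= a_init b * (s + 1) * expR (H * t).
Proof.
move=> t0; rewrite scaleE -mulrA ler_wpM2l ?(ltW ha)//.
have s1 := sinh_coef_ge1.
have s10 : 0 <= (s + 1) * expR (H * t) by rewrite mulr_ge0 ?expR_ge0//; lra.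
rewrite -(@ler_pXn2r _ 3) ?nnegrE ?powR_ge0// cube_root_cube; last by rewrite ltW// vol_gt0.
rewrite exprMn -expRM_natl (_ : 3%:R * (H * t) = 3 * H * t); last by ring.
rewrite vol_exp; have := expR_gt0 (3 * H * t); have := expR_gt0 (- (3 * H * t)).
set p := expR _; set q := expR _ => q0 p0.
have : s + 1 <= (s + 1) ^+ 3 by nra.
nra.
Qed.

End Background.

(** * Exponentially decaying families *)

Section Asymptotics.
Context {R : realType} {d : nat}.
Variables (H : R) (Omega : Type) (eps : Omega -> R).
Hypotheses (H0 : 0 < H) (eps01 : forall o, 0 <= eps o <= 1).
Implicit Types (f g F : Omega -> R -> 'rV[R]_d -> R) (finf ginf : Omega -> 'rV[R]_d -> R).

(* [f] is O(eps^e exp(- k H t)) in C^m, uniformly over the family [Omega] of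
   solutions; the time 0 is excluded, as the equations are only used after it. *)
Definition OO (m e : nat) (k : R) f := exists2 K : R, 0 <= K &
  forall o (t : R), 0 < t -> Cb m (K * eps o ^+ e * expR (- (k * H * t))) (f o t).

(** The bound eps <= 1 is what allows the exponent of eps to be lowered, and t > 0 the rate. *)
Lemma OO_W m m' e e' (k k' : R) f : OO m e k f ->
  (m' <= m)%N -> (e' <= e)%N -> k' <= k -> OO m' e' k' f.
Proof.
move=> [K K0 Hf] mm ee kk; exists K => // o t t0.
apply: CbW mm _ (Hf o t t0); rewrite -!mulrA ler_wpM2l//.
have /andP[e0 e1] := eps01 o.
apply: ler_pM; rewrite ?exprn_ge0 ?expR_ge0//; first exact: ler_wiXn2l.
by rewrite ler_expR lerN2 ler_wpM2r// mulr_ge0// ltW.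
Qed.

Lemma OO_ext m e (k : R) f g : (forall o (t : R), 0 < t -> f o t =1 g o t) ->
  OO m e k f -> OO m e k g.
Proof.
move=> fg [K K0 Hf]; exists K => // o t t0.
by apply: Cb_ext (Hf o t t0); exact: fg.
Qed.

Lemma OO_add m e (k : R) f g : OO m e k f -> OO m e k g ->
  OO m e k (fun o t x => f o t x + g o t x).
Proof.
move=> [K K0 Hf] [L L0 Hg]; exists (K + L); first exact: addr_ge0.
by move=> o t t0; rewrite -mulrA mulrDl !mulrA; apply: Cb_add; [exact: Hf|exact: Hg].
Qed.

Lemma OO_opp m e (k : R) f : OO m e k f -> OO m e k (fun o t x => - f o t x).
Proof. by move=> [K K0 Hf]; exists K => // o t t0; apply: Cb_opp; exact: Hf. Qed.

Lemma OO_sub m e (k : R) f g : OO m e k f -> OO m e k g ->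
  OO m e k (fun o t x => f o t x - g o t x).
Proof. by move=> Hf /OO_opp; exact: OO_add. Qed.

Lemma OO_mul m e1 e2 e (k1 k2 k : R) f g : OO m e1 k1 f -> OO m e2 k2 g ->
  (e <= e1 + e2)%N -> k <= k1 + k2 -> OO m e k (fun o t x => f o t x * g o t x).
Proof.
move=> [K K0 Hf] [L L0 Hg] ee kk.
apply: (@OO_W m _ (e1 + e2) _ (k1 + k2)) => //.
exists (2 ^+ m * (K * L)); first by rewrite !mulr_ge0 ?exprn_ge0.
move=> o t t0; have := Cb_mul (Hf o t t0) (Hg o t t0).
apply: CbW => //; rewrite (_ : - ((k1 + k2) * H * t) = - (k1 * H * t) + - (k2 * H * t)); last by ring.
by rewrite expRD exprD le_eqVlt; apply/orP; left; apply/eqP; ring.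
Qed.

Lemma OO_scale m e (k c : R) f : OO m e k f -> OO m e k (fun o t x => c * f o t x).
Proof.
move=> [K K0 Hf]; exists (`|c| * K); first exact: mulr_ge0.
by move=> o t t0; rewrite -!mulrA; apply: Cb_scale; rewrite !mulrA; exact: Hf.
Qed.

Lemma OO_time m (k : R) (c : R -> R) (K : R) :
  (forall t : R, 0 < t -> `|c t| <= K * expR (- (k * H * t))) -> OO m 0 k (fun _ t _ => c t).
Proof.
move=> Hc; exists K.
  have := Hc 1 ltr01 => /(le_trans (normr_ge0 _)).
  by rewrite pmulr_lge0 ?expR_gt0.
by move=> o t t0; rewrite expr0 mulr1; apply: CbW (leqnn m) (Hc t t0) (Cb_cst _ _).
Qed.

Lemma OO_cst m (c : R) : OO m 0 0 (fun _ _ _ => c).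
Proof. by apply: (@OO_time _ _ _ `|c|) => t _; rewrite !mul0r oppr0 expR0 mulr1. Qed.

Lemma OO_exp m (k : R) : OO m 0 k (fun _ t _ => expR (- (k * H * t))).
Proof. by apply: (@OO_time _ _ _ 1) => t _; rewrite mul1r ger0_norm ?expR_ge0. Qed.

Lemma OO_0 m e (k : R) : OO m e k (fun _ _ _ => 0).
Proof.
exists 0 => // o t t0; rewrite !mul0r; have := @Cb_cst R d m 0; by rewrite normr0.
Qed.

Lemma OO_sum (n : nat) m e (k : R) (f : 'I_n -> Omega -> R -> 'rV[R]_d -> R) :
  (forall i, OO m e k (f i)) -> OO m e k (fun o t x => \sum_i f i o t x).
Proof.
elim: n f => [|n IH] f Hf.
  by apply: OO_ext (OO_0 m e k) => o t _ x; rewrite big_ord0.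
apply: (@OO_ext _ _ _ (fun o t x => f ord0 o t x + \sum_(i < n) f (lift ord0 i) o t x)).
  by move=> o t _ x; rewrite big_ord_recl.
by apply: OO_add => //; apply: (IH (fun i => f (lift ord0 i))).
Qed.

Lemma OO_pd m e (k : R) f i : OO m.+1 e k f -> OO m e k (fun o t => pd i (f o t)).
Proof. by move=> [K K0 Hf]; exists K => // o t t0; apply: Cb_pd; exact: Hf. Qed.

Lemma OO_Ck m e (k : R) f o (t : R) : OO m e k f -> 0 < t -> Ck m (f o t).
Proof. by move=> [K _ Hf] t0; case: (Hf o t t0). Qed.

Lemma expR_cvg0 (K c : R) : 0 < c -> (fun n : nat => K * expR (- (c * n.+1%:R))) @ \oo --> (0:R).
Proof.
move=> c0; have q0 := expR_gt0 (- c).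
have E : (fun n : nat => K * expR (- (c * n.+1%:R))) = geometric (K * expR (- c)) (expR (- c)).
  apply/funext => n; rewrite /geometric /= -mulrA; congr (_ * _).
  by rewrite -expRM_natl -expRD; congr expR; rewrite -natr1; ring.
by rewrite E; apply: cvg_geometric; rewrite ger0_norm ?(ltW q0)// expR_lt1; lra.
Qed.

(** The limit as t tends to infinity, taken along the positive integers so that [Ck_limit] applies;
    [OO_int] extends the convergence to all times. *)
Definition flim f (o : Omega) : 'rV[R]_d -> R := fun x => lim (f o n.+1%:R x @[n --> \oo]).

Section Integration.
Variables (m e : nat) (f F : Omega -> R -> 'rV[R]_d -> R).
Hypothesis df : forall o (t : R) x, 0 < t -> is_derive t (1:R) (fun t => f o t x) (F o t x).

(** [k] may have either sign: [OO_damped] applies it to a growing integrand, with the exponent k - c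
    < 0. *)
Lemma OO_increment (k : R) (K : R) : k != 0 ->
  (forall o (t : R), 0 < t -> Ck m (f o t)) ->
  (forall o (t : R), 0 < t -> Cb m (K * eps o ^+ e * expR (- (k * H * t))) (F o t)) ->
  forall o (s t : R) w x, 0 < s -> s <= t -> (size w <= m)%N ->
  `|pdw w (f o t) x - pdw w (f o s) x|
    <= K * eps o ^+ e / (k * H) * (expR (- (k * H * s)) - expR (- (k * H * t))).
Proof.
move=> k0 Cf HF o s t w x s0 st wm.
have kH : k * H != 0 by rewrite mulf_neq0// gt_eqF.
set c := K * eps o ^+ e.
pose Phi r := - (c / (k * H)) * expR (- (k * H) * r).
have -> : c / (k * H) * (expR (- (k * H * s)) - expR (- (k * H * t))) = Phi t - Phi s.
  by rewrite /Phi !mulNr; ring.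
apply: (@time_increment _ _ m (f o) (F o) Phi (fun r => c * expR (- (k * H * r)))) => //.
- exact: Cf.
- by apply: Cf; exact: lt_le_trans st.
- by move=> r /andP[sr _]; case: (HF o r (lt_le_trans s0 sr)).
- by move=> y r /andP[sr _]; apply: df; exact: lt_le_trans sr.
- move=> r _; have := is_deriveZ (- (c / (k * H))) (is_derive_expM (- (k * H)) r).
  move=> D; apply: (is_derive_eq D); rewrite /GRing.scale /= !mulNr; field.
  by move: kH; rewrite mulf_eq0 negb_or => /andP[-> ->].
- by move=> y r /andP[sr _]; apply: (HF o r (lt_le_trans s0 sr)).2.
Qed.

(** The increments of [f] after time s are at most a multiple of exp(- k H s), so the values at
    integer times are Cauchy in C^m. The factor 2 pays for the way from t to a later integer and
    from there to the limit. *)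
Lemma OO_int e0 (k k0 : R) : 0 < k -> OO m e k F -> OO m e0 k0 f ->
  OO m e k (fun o t x => f o t x - flim f o x) /\ forall o, Ck m (flim f o).
Proof.
move=> k0' [K K0 HF] Hf.
have Cf o (t : R) : 0 < t -> Ck m (f o t) by move=> t0; exact: OO_Ck Hf t0.
have I := OO_increment (lt0r_neq0 k0') Cf HF.
have kH : 0 < k * H by exact: mulr_gt0.
pose c o := K * eps o ^+ e / (k * H).
have c0 o : 0 <= c o.
  by rewrite divr_ge0 ?(ltW kH)// mulr_ge0// exprn_ge0//; have /andP[] := eps01 o.
have {}I o (s t : R) w x : 0 < s -> s <= t -> (size w <= m)%N ->
    `|pdw w (f o t) x - pdw w (f o s) x| <= c o * expR (- (k * H * s)).
  move=> s0 st wm; apply: (le_trans (I o s t w x s0 st wm)); rewrite -/(c o) ler_wpM2l//.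
  by rewrite lerBlDr lerDl expR_ge0.
have le_nat1 n j : (n <= j)%N -> n.+1%:R <= j.+1%:R :> R by rewrite ler_nat ltnS.
have L o := @Ck_limit R d m (fun n => f o n.+1%:R) (fun n => c o * expR (- (k * H * n.+1%:R)))
  (expR_cvg0 (c o) kH) (fun n => Cf o _ (ltr0Sn R n))
  (fun w wm j n nj x => I o _ _ w x (ltr0Sn R n) (le_nat1 _ _ nj) wm).
split=> [|o]; last by case: (L o).
exists (2 * (K / (k * H))); first by rewrite mulr_ge0// divr_ge0// ltW.
move=> o t t0; have [CL BL] := L o.
split; first by apply: Ck_sub => //; exact: Cf.
move=> w wm x; rewrite (pdw_sub wm (Cf o t t0) CL).
pose n := Num.bound t.
have tn : t <= n.+1%:R.
  apply: ltW; apply: (lt_le_trans (archi_boundP (ltW t0))); by rewrite ler_nat leqnSn.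
have h1 := I o t n.+1%:R w x t0 tn wm; have h2 := BL w wm n x.
have h3 : expR (- (k * H * n.+1%:R)) <= expR (- (k * H * t)).
  by rewrite ler_expR lerN2 ler_wpM2l// ltW.
have := ler_wpM2l (c0 o) h3.
have -> : 2 * (K / (k * H)) * eps o ^+ e * expR (- (k * H * t))
    = c o * expR (- (k * H * t)) + c o * expR (- (k * H * t)) by rewrite /c; ring.
move: h1 h2; rewrite -/(flim f o).
set a := c o * _; set a' := c o * _; set u := pdw w (f o t) x; set v := pdw w (flim f o) x.
set z := pdw w _ x; clearbody a a' u v z => h1 h2 h3'.
have -> : u - v = (u - z) + (z - v) by ring.
apply: (le_trans (ler_normD _ _)); apply: lerD; first by rewrite distrC.
by rewrite distrC; exact: le_trans h3'.
Qed.

End Integration.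

(** Variation of constants: exp(c H t) f has derivative exp(c H t) F, which grows at the rate c - k
    > 0, so its integral is dominated by the endpoint t. Integration starts at time 1. *)
Lemma OO_damped m e f F (c k : R) : k < c -> 0 <= k ->
  (forall o (t : R) x, 0 < t -> is_derive t (1:R) (fun t => f o t x) (- (c * H) * f o t x + F o t x)) ->
  OO m e k F -> OO m e 0 f -> OO m e k f.
Proof.
move=> kc k0 df [K K0 HF] [L L0 Hf].
pose g o t x := expR (c * H * t) * f o t x.
pose G o t x := expR (c * H * t) * F o t x.
have dg o (t : R) x : 0 < t -> is_derive t (1:R) (fun t => g o t x) (G o t x).
  move=> t0; have D1 := is_derive_expM (c * H) t; have D2 := df o t x t0.
  have := is_deriveM D1 D2 => D; apply: (is_derive_eq D).
  by rewrite /GRing.scale /= /G; ring.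
have Cf o (t : R) : 0 < t -> Ck m (f o t) by move=> t0; case: (Hf o t t0).
have Cg o (t : R) : 0 < t -> Ck m (g o t) by move=> t0; apply: Ck_scale; exact: Cf.
have HG o (t : R) : 0 < t -> Cb m (K * eps o ^+ e * expR (- ((k - c) * H * t))) (G o t).
  move=> t0; have := Cb_scale (expR (c * H * t)) (HF o t t0); apply: CbW => //.
  rewrite ger0_norm ?expR_ge0// mulrCA -expRD (_ : c * H * t - k * H * t = - ((k - c) * H * t))//.
  by ring.
have kc0 : k - c != 0 by rewrite subr_eq0 lt_eqF.
have I := OO_increment dg kc0 Cg HG.
(* The first term covers t <= 1, where exp(k H) offsets the decay; the second is the integrated
   source; the third is the value of [f] at time 1, with its weight exp(c H). *)
exists (L * expR (k * H) + (K / ((c - k) * H) + L * expR (c * H))).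
  by rewrite !addr_ge0 ?mulr_ge0 ?expR_ge0// invr_ge0 mulr_ge0// ltW// subr_gt0.
move=> o t t0; have e0 : 0 <= eps o ^+ e by rewrite exprn_ge0//; have /andP[] := eps01 o.
have [t1|t1] := leP t 1.
  apply: (@CbW _ _ m m (L * eps o ^+ e)) => //; last first.
    by have := Hf o t t0; rewrite !mul0r oppr0 expR0 mulr1.
  apply: (@le_trans _ _ (L * expR (k * H) * eps o ^+ e * expR (- (k * H * t)))).
    rewrite (_ : _ * _ * _ = L * eps o ^+ e * (expR (k * H) * expR (- (k * H * t)))); last by ring.
    rewrite ler_peMr ?mulr_ge0// -expRD -expR0 ler_expR.
    by have := mulr_ge0 k0 (ltW H0); nra.
  rewrite ler_wpM2r ?expR_ge0// ler_wpM2r// lerDl addr_ge0// ?mulr_ge0 ?expR_ge0// invr_ge0.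
  by rewrite mulr_ge0 ?(ltW H0)// subr_ge0 ltW.
split; first exact: Cf.
move=> w wm x; have Ht := I o 1 t w x ltr01 (ltW t1) wm.
rewrite (pdw_scale _ wm (Cf o t t0)) (pdw_scale _ wm (Cf o 1 ltr01)) in Ht.
have Hf1 := (Hf o 1 ltr01).2 w wm x; rewrite !mul0r oppr0 expR0 mulr1 in Hf1.
move: Ht Hf1; set p := pdw w (f o t) x; set q := pdw w (f o 1) x; rewrite mulr1.
have -> : K * eps o ^+ e / ((k - c) * H) * (expR (- ((k - c) * H * 1)) - expR (- ((k - c) * H * t)))
   = K / ((c - k) * H) * eps o ^+ e * (expR ((c - k) * H * t) - expR ((c - k) * H)).
  rewrite mulr1 (_ : - ((k - c) * H * t) = (c - k) * H * t); last by ring.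
  rewrite (_ : - ((k - c) * H) = (c - k) * H); last by ring.
  field; by rewrite gt_eqF// subr_eq0 gt_eqF// subr_eq0 lt_eqF.
move=> Ht Hf1.
have eT := expR_gt0 (c * H * t).
rewrite -(ler_pM2l eT) -[X in X * `|p|](ger0_norm (ltW eT)) -normrM.
set P := expR (c * H * t) * p in Ht *; set Q := expR (c * H) * q in Ht.
have HQ : `|Q| <= expR (c * H) * (L * eps o ^+ e).
  by rewrite normrM ger0_norm ?expR_ge0// ler_wpM2l ?expR_ge0.
have HP : `|P| <= `|P - Q| + `|Q| by rewrite -{1}(subrK Q P) ler_normD.
have E : expR (c * H * t) * expR (- (k * H * t)) = expR ((c - k) * H * t).
  by rewrite -expRD; congr expR; ring.
have E1 : 1 <= expR ((c - k) * H * t).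
  by rewrite -expR0 ler_expR !mulr_ge0// ?ltW// subr_gt0.
apply: (le_trans HP); apply: (le_trans (lerD Ht HQ)).
rewrite [leRHS]mulrCA E.
have D0 : 0 <= K / ((c - k) * H) * eps o ^+ e.
  by rewrite mulr_ge0// divr_ge0// mulr_ge0 ?(ltW H0)// subr_ge0 ltW.
have L1 : 0 <= L * eps o ^+ e by exact: mulr_ge0.
set y := expR ((c - k) * H * t) in E1 *.
have y1 : 0 <= expR ((c - k) * H) by exact: expR_ge0.
have y2 := expR_ge0 (c * H); have y3 := expR_ge0 (k * H).
set D := K / ((c - k) * H) * eps o ^+ e in D0 *.
rewrite (_ : (L * expR (k * H) + (K / ((c - k) * H) + L * expR (c * H))) * eps o ^+ e
   = L * eps o ^+ e * expR (k * H) + (D + L * eps o ^+ e * expR (c * H))); last by rewrite /D; ring.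
move: (expR ((c - k) * H)) (expR (c * H)) (expR (k * H)) y1 y2 y3 => Y1 Y2 Y3 y1 y2 y3.
clearbody y D; set l := L * _ in L1 *; clearbody l.
have h1 := mulr_ge0 L1 y2; have h2 := mulr_ge0 L1 y3; have h3 := mulr_ge0 D0 y1.
have h4 := mulr_ge0 h1 (ltac:(by rewrite subr_ge0) : 0 <= y - 1).
have h5 := mulr_ge0 h2 (le_trans ler01 E1).
nra.
Qed.

(* The profile [finf exp(- j H t)] gives the leading term of [f], of order
   exp(- j H t), with an error two powers of exp(- H t) smaller. *)
Definition EX (m e : nat) (j : R) f finf := [/\ OO m e j f, OO m e 0 (fun o _ => finf o) &
  OO m e (j + 2) (fun o t x => f o t x - finf o x * expR (- (j * H * t)))].

Lemma EX_W m m' e e' (j : R) f finf : EX m e j f finf -> (m' <= m)%N -> (e' <= e)%N ->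
  EX m' e' j f finf.
Proof. by move=> [h1 h2 h3] mm ee; split; [exact: OO_W h1 _ _ _|exact: OO_W h2 _ _ _|exact: OO_W h3 _ _ _]. Qed.

Lemma EX_ext m e (j : R) f g finf ginf : (forall o (t : R), 0 < t -> f o t =1 g o t) ->
  (forall o, finf o =1 ginf o) -> EX m e j f finf -> EX m e j g ginf.
Proof.
move=> fg fginf [h1 h2 h3]; split; [exact: OO_ext fg h1| |].
  by apply: OO_ext h2 => o t _; exact: fginf.
by apply: OO_ext h3 => o t t0 x; rewrite (fg o t t0) fginf.
Qed.

Lemma EX_add m e (j : R) f g finf ginf : EX m e j f finf -> EX m e j g ginf ->
  EX m e j (fun o t x => f o t x + g o t x) (fun o x => finf o x + ginf o x).
Proof.
move=> [f1 f2 f3] [g1 g2 g3]; split; [exact: OO_add|exact: OO_add|].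
by apply: OO_ext (OO_add f3 g3) => o t _ x; ring.
Qed.

Lemma EX_scale m e (j c : R) f finf : EX m e j f finf ->
  EX m e j (fun o t x => c * f o t x) (fun o x => c * finf o x).
Proof.
move=> [f1 f2 f3]; split; [exact: OO_scale|exact: OO_scale|].
by apply: OO_ext (OO_scale c f3) => o t _ x; ring.
Qed.

Lemma EX_sub m e (j : R) f g finf ginf : EX m e j f finf -> EX m e j g ginf ->
  EX m e j (fun o t x => f o t x - g o t x) (fun o x => finf o x - ginf o x).
Proof.
move=> hf /(EX_scale (-1)) hg; apply: EX_ext (EX_add hf hg) => [a t _|a] x /=; ring.
Qed.

Lemma EX_0 m e (j : R) : EX m e j (fun _ _ _ => 0) (fun _ _ => 0).
Proof.
split; [exact: OO_0|exact: OO_0|].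
by apply: OO_ext (OO_0 m e (j + 2)) => o t _ x; ring.
Qed.

Lemma EX_sum (n : nat) m e (j : R) (f : 'I_n -> Omega -> R -> 'rV[R]_d -> R)
    (finf : 'I_n -> Omega -> 'rV[R]_d -> R) :
  (forall i, EX m e j (f i) (finf i)) ->
  EX m e j (fun o t x => \sum_i f i o t x) (fun o x => \sum_i finf i o x).
Proof.
elim: n f finf => [|n IH] f finf Hf.
  by apply: EX_ext (EX_0 m e j) => [a t _|a] x; rewrite big_ord0.
have := EX_add (Hf ord0) (IH (fun i => f (lift ord0 i)) (fun i => finf (lift ord0 i)) (fun i => Hf _)).
by apply: EX_ext => [a t _|a] x; rewrite big_ord_recl.
Qed.

Lemma EX_pd m e (j : R) f finf i : EX m.+1 e j f finf ->
  EX m e j (fun o t => pd i (f o t)) (fun o => pd i (finf o)).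
Proof.
move=> [f1 f2 f3]; split; [exact: OO_pd|exact: OO_pd|].
apply: OO_ext (OO_pd i f3) => o t t0 x.
have Cf := OO_Ck o f1 t0; have CF := OO_Ck o f2 t0.
have dfx : derivable (f o t) x (delta_mx 0 i) by case/CkS: Cf.
have dFx : derivable (finf o) x (delta_mx 0 i) by case/CkS: CF.
have := @pdB _ _ i (f o t) (fun y => expR (- (j * H * t)) * finf o y) x dfx
  ltac:(by case/CkS: (Ck_scale (expR (- (j * H * t))) CF)).
rewrite pdZ// [_ * pd i _ x]mulrC => <-.
by congr (pd i _ x); apply/funext => y; rewrite [expR _ * _]mulrC.
Qed.

(** The remainder is (f - f_oo) g + f_oo (g - g_oo), the profiles being taken with their
    exponentials. *)
Lemma EX_mul m e1 e2 e (j1 j2 j : R) f g finf ginf : EX m e1 j1 f finf -> EX m e2 j2 g ginf ->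
  (e <= e1 + e2)%N -> j = j1 + j2 ->
  EX m e j (fun o t x => f o t x * g o t x) (fun o x => finf o x * ginf o x).
Proof.
move=> [f1 f2 f3] [g1 g2 g3] ee ->; split.
- exact: OO_mul f1 g1 _ _.
- by apply: OO_mul f2 g2 _ _ => //; rewrite addr0.
have fe : OO m e1 j1 (fun o t x => finf o x * expR (- (j1 * H * t))).
  by apply: OO_mul f2 (OO_exp m j1) _ _; rewrite ?addn0// add0r.
have a1 : OO m e (j1 + j2 + 2) (fun o t x =>
    (f o t x - finf o x * expR (- (j1 * H * t))) * g o t x).
  by apply: OO_mul f3 g1 _ _ => //; lra.
have a2 : OO m e (j1 + j2 + 2) (fun o t x =>
    finf o x * expR (- (j1 * H * t)) * (g o t x - ginf o x * expR (- (j2 * H * t)))).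
  by apply: OO_mul fe g3 _ _ => //; lra.
apply: OO_ext (OO_add a1 a2) => o t _ x /=.
rewrite (_ : - ((j1 + j2) * H * t) = - (j1 * H * t) + - (j2 * H * t)); last by ring.
by rewrite expRD; ring.
Qed.

Definition periodic_after f := forall o (t : R) x i, 0 < t -> f o t (x + delta_mx 0 i) = f o t x.

Lemma flim_periodic f o x i : periodic_after f ->
  flim f o (x + delta_mx 0 i) = flim f o x.
Proof.
move=> pf; rewrite /flim.
have -> // : (fun n : nat => f o n.+1%:R (x + delta_mx 0 i)) = (fun n => f o n.+1%:R x).
by apply/funext => n; rewrite pf.
Qed.

End Asymptotics.

(** * Expansions of the perturbed solutions *)

Section PeriodicSlices.
Context {R : realType}.

(** Applied to the translation of spacetime by a period of the torus, this gives the periodicity of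
    [kk]. *)
Lemma cov_shift d (G : 'rV[R]_d -> 'M[R]_d) X Y (a : 'rV[R]_d) :
  (forall z, G (z + a) = G z) -> (forall z, X (z + a) = X z) -> (forall z, Y (z + a) = Y z) ->
  forall z, cov G X Y (z + a) = cov G X Y z.
Proof.
move=> HG HX HY z.
have pdE (f : 'rV[R]_d -> R) i y : (forall y, f (y + a) = f y) -> pd i f (y + a) = pd i f y.
  move=> Hf; have := congr1 (fun h => h y) (pd_shift i f a) => /= <-.
  by congr (pd i _ y); apply/funext => w.
rewrite /cov; apply/rowP => l; rewrite !mxE; apply: eq_bigr => m _.
rewrite HX pdE => [|y]; last by rewrite HY.
congr (_ * (_ + _)); apply: eq_bigr => n _; rewrite HY; congr (_ * _).
rewrite /christoffel; congr (_ * _); apply: eq_bigr => s _; rewrite HG.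
by rewrite !pdE// => y; rewrite HG.
Qed.

Variable S : fields R.
Hypothesis reg : regular S.
Local Notation M4 := 'rV[R]_(1 + 3).

Lemma event_add_delta (t : R) (x : 'rV[R]_3) i :
  event t (x + delta_mx 0 i) = event t x + row_mx 0 (delta_mx 0 i).
Proof. by rewrite /event add_row_mx addr0. Qed.

Lemma lift4_shift (A : Type) (f : R -> 'rV[R]_3 -> A) i (z : M4) :
  (forall t x, f t (x + delta_mx 0 i) = f t x) ->
  lift4 f (z + row_mx 0 (delta_mx 0 i)) = lift4 f z.
Proof.
by move=> Hf; rewrite -(event_eta z) -event_add_delta !lift4_event.
Qed.

Lemma gmet_shift i t (x : 'rV[R]_3) : gmet S t (x + delta_mx 0 i) = gmet S t x.
Proof. by apply/matrixP => k l; have [_ _ /(_ k l)[_ ->]] := reg. Qed.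

Lemma frame_shift i t (x : 'rV[R]_3) : frame S t (x + delta_mx 0 i) = frame S t x.
Proof. by apply/matrixP => k l; have [_ _ _ /(_ k l)[_ ->]] := reg. Qed.

Lemma lapse_shift i t (x : 'rV[R]_3) : lapse S t (x + delta_mx 0 i) = lapse S t x.
Proof. exact: lapse_periodic. Qed.

Lemma kk_periodic I J t : z3_periodic (kk S I J t).
Proof.
move=> x i; rewrite /kk /second_form /inner event_add_delta; set z := event t x.
have e_shift K y : e_vec S K (y + row_mx 0 (delta_mx 0 i)) = e_vec S K y.
  by apply: lift4_shift => s w; rewrite frame_shift.
have e0_shift y : e0_vec S (y + row_mx 0 (delta_mx 0 i)) = e0_vec S y.
  by apply: lift4_shift => s w; rewrite lapse_shift.
have g_shift y : metric4 S (y + row_mx 0 (delta_mx 0 i)) = metric4 S y.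
  by apply: lift4_shift => s w; rewrite lapse_shift gmet_shift.
by rewrite g_shift e_shift (cov_shift g_shift (e_shift I) e0_shift).
Qed.

Lemma e0_psi_periodic t : z3_periodic (e0_psi S t).
Proof.
move=> x i; rewrite !e0_psiE lapse_shift.
have -> // : (scal S)^~ (x + delta_mx 0 i) = (scal S)^~ x.
by apply/funext => s; have [_ [_ ->]] := reg.
Qed.

End PeriodicSlices.

Section ErealSums.
Context {R : realType}.
Local Open Scope ereal_scope.

Lemma le_sum_term (n : nat) (F : 'I_n -> \bar R) i : (forall j, 0 <= F j) -> F i <= \sum_j F j.
Proof. by move=> F0; rewrite (bigD1 i)//= leeDl// sume_ge0. Qed.

Lemma expR_mule_le (c : R) (X Y : \bar R) (B : R) : 0 <= X -> X <= Y ->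
  (expR c)%:E * Y <= B%:E -> X <= (B * expR (- c))%:E.
Proof.
move=> X0 XY H; have Y0 := le_trans X0 XY.
have c0 := expR_gt0 c.
case: X Y X0 XY H Y0 => [x||] [y||] //=.
- rewrite !lee_fin => x0 xy H _; apply: (le_trans xy).
  by rewrite expRN ler_pdivlMr// mulrC.
- by move=> _ _; rewrite gt0_muley ?lte_fin// leye_eq.
- by move=> _ _; rewrite gt0_muley ?lte_fin// leye_eq.
Qed.

Lemma le_sum5 (a b c d e : \bar R) : 0 <= a -> 0 <= b -> 0 <= c -> 0 <= d -> 0 <= e ->
  [/\ b <= a + b + c + d + e, c <= a + b + c + d + e & e <= a + b + c + d + e].
Proof.
move=> a0 b0 c0 d0 e0; split.
- by rewrite -!addeA addeCA leeDl// !adde_ge0.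
- by rewrite -!addeA (addeCA b) addeCA leeDl// !adde_ge0.
- by rewrite addeC leeDl// !adde_ge0.
Qed.

End ErealSums.

(** * The family of perturbed solutions and its a priori bounds *)

Section Perturbed.
Context {R : realType}.
Variables (M N : nat) (b : flrw R) (C0 : R).
Hypotheses (hN : N = (M + 6)%N) (hL : 0 < Lambda b) (ha : 0 < a_init b)
  (hcoef : flrw_coef b) (hC0 : 0 < C0).
Local Notation H := (hubble b).
Local Notation L := (inv_scale_limit b).

(** The index type of [OO] in all that follows: constants found there hold for all solutions with
    the given N, background and [C0]. *)
Record perturbed := Perturbed {
  pfields :> fields R;
  psize : R;
  psize01 : 0 <= psize <= 1;
  pgauge : exists D, gauge_solution pfields b D;
  pbounds : global_bounds pfields b N C0 psize }.

Let H0 : 0 < H := hubble_gt0 hL.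
Let eps := psize.
Let e01 := psize01 : forall o, 0 <= eps o <= 1.
Local Notation OO := (OO H eps).
Local Notation EX := (EX H eps).
Implicit Types (o : perturbed) (t : R) (x : 'rV[R]_3).

Lemma perturbed_regular o : regular o. Proof. by have [D [[]]] := pgauge o. Qed.
Lemma perturbed_posdef o t x : 0 <= t -> 0 < lapse o t x /\ sym_posdef (gmet o t x).
Proof. by have [D [[_ Hp _ _] _ _]] := pgauge o; exact: Hp. Qed.
Lemma perturbed_einstein o : einstein_scalar o (Lambda b). Proof. by have [D [[_ _]]] := pgauge o. Qed.
Lemma perturbed_gauge o t x : 0 <= t -> lapse o t x - 1 = trk_flrw b t - trk o t x.
Proof. by have [D [_ Hg _]] := pgauge o; exact: Hg. Qed.
Lemma perturbed_orthonormal o : orthonormal_frame o. Proof. by have [D [_ _ []]] := pgauge o. Qed.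
Lemma perturbed_fermi o : fermi_propagated o. Proof. by have [D [_ _ []]] := pgauge o. Qed.

(** In contrast with [OO], the time 0 is included; this is what gives the final estimates there. *)
Definition apriori m (j : R) (f : perturbed -> R -> 'rV[R]_3 -> R) := exists2 K : R, 0 <= K &
  forall o t, 0 <= t -> Cb m (K * eps o * expR (- (j * H * t))) (f o t).

Lemma apriori_OO m j f : apriori m j f -> OO m 1 j f.
Proof. by move=> [K K0 Hf]; exists K => // o t t0; rewrite expr1; apply: Hf; exact: ltW. Qed.

Lemma apriori_0 m j f : apriori m j f -> OO m 1 0 (fun o _ => f o 0).
Proof.
move=> [K K0 Hf]; exists K => // o t t0; rewrite expr1; have := Hf o 0 (lexx _).
by rewrite mulr0 mul0r mul0r.
Qed.

Lemma energy_Cb (X : fields R -> R -> 'rV[R]_3 -> R) (E : fields R -> R -> \bar R) :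
  (forall o t, 0 <= t -> continuous (X o t)) ->
  (forall o t, 0 <= t -> z3_periodic (X o t)) ->
  (forall o t, 0 <= t -> (HM_sq N (X o t) <= E o t)%E) ->
  (forall o t, 0 <= t -> ((expR (2 * H * t))%:E * E o t <= (C0 * psize o ^+ 2)%:E)%E) ->
  apriori M.+2 1 (fun o => X o).
Proof.
(* 8 is the square root of the constant 64 of the Sobolev embedding. *)
move=> cX pX XE HE; exists (8 * Num.sqrt C0); first by rewrite mulr_ge0// sqrtr_ge0.
move=> o t t0; have /andP[e0 _] := e01 o.
apply: (@HM_sq_Cb _ N M.+2 (X o t) (C0 * psize o ^+ 2 * expR (- (2 * H * t)))).
- by rewrite hN; lia.
- exact: cX.
- exact: pX.
- by apply: (expR_mule_le _ (XE o t t0) (HE o t t0)); exact: HM_sq_ge0.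
- by rewrite !mulr_ge0 ?expR_ge0 ?sqrtr_ge0.
rewrite !exprMn sqr_sqrtr ?(ltW hC0)// -expRM_natl (_ : 2%:R * - (1 * H * t) = - (2 * H * t)); last by ring.
by rewrite le_eqVlt; apply/orP; left; apply/eqP; rewrite /eps; ring.
Qed.

Local Open Scope ereal_scope.

Let energy_ge0 (S : fields R) t : [/\ 0 <= k_energy S N t, 0 <= gam_energy S N t,
  0 <= e_energy S b N t, 0 <= n_energy S N t & 0 <= epsi_energy S b N t].
Proof.
split; rewrite /k_energy /gam_energy /e_energy /n_energy /epsi_energy ?HM_sq_ge0//;
  try by do ?(apply: sume_ge0 => ? _); rewrite ?HM_sq_ge0.
by rewrite adde_ge0 ?HM_sq_ge0// sume_ge0// => ? _; exact: HM_sq_ge0.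
Qed.

Let energy S t := k_energy S N t + gam_energy S N t + e_energy S b N t
     + (expR (H * t))%:E * n_energy S N t + epsi_energy S b N t.

Let gam_le (S : fields R) t I J B : HM_sq N (hat_gam S I J B t) <= energy S t.
Proof.
have [h1 h2 h3 h4 h5] := energy_ge0 S t.
have h6 : 0 <= (expR (H * t))%:E * n_energy S N t by rewrite mule_ge0// lee_fin expR_ge0.
apply: (@le_trans _ _ (gam_energy S N t)).
  apply: (le_trans _ (@le_sum_term _ _ _ I _)) => [|i]; last by do 2!(apply: sume_ge0 => ? _); exact: HM_sq_ge0.
  apply: (le_trans _ (@le_sum_term _ _ _ J _)) => [|i]; last by apply: sume_ge0 => ? _; exact: HM_sq_ge0.
  by apply: (@le_sum_term _ _ (fun B => HM_sq N (hat_gam S I J B t))) => i; exact: HM_sq_ge0.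
by case: (le_sum5 h1 h2 h3 h6 h5).
Qed.

Let e_le (S : fields R) t I i : HM_sq N (hat_e S b I i t) <= energy S t.
Proof.
have [h1 h2 h3 h4 h5] := energy_ge0 S t.
have h6 : 0 <= (expR (H * t))%:E * n_energy S N t by rewrite mule_ge0// lee_fin expR_ge0.
apply: (@le_trans _ _ (e_energy S b N t)).
  apply: (le_trans _ (@le_sum_term _ _ _ I _)) => [|j]; last by apply: sume_ge0 => ? _; exact: HM_sq_ge0.
  by apply: (@le_sum_term _ _ (fun i => HM_sq N (hat_e S b I i t))) => j; exact: HM_sq_ge0.
by case: (le_sum5 h1 h2 h3 h6 h5).
Qed.

Let epsi_le (S : fields R) t I : HM_sq N (hat_epsi S I t) <= energy S t.
Proof.
have [h1 h2 h3 h4 h5] := energy_ge0 S t.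
have h6 : 0 <= (expR (H * t))%:E * n_energy S N t by rewrite mule_ge0// lee_fin expR_ge0.
apply: (@le_trans _ _ (epsi_energy S b N t)); last by case: (le_sum5 h1 h2 h3 h6 h5).
rewrite /epsi_energy addeC; apply: (@le_trans _ _ (\sum_I HM_sq N (hat_epsi S I t))).
  by apply: (@le_sum_term _ _ (fun I => HM_sq N (hat_epsi S I t))) => j; exact: HM_sq_ge0.
exact: (leeDl _ (HM_sq_ge0 _ _)).
Qed.

Local Close Scope ereal_scope.

Let energy_bound o t : 0 <= t -> ((expR (2 * H * t))%:E * energy o t <= (C0 * psize o ^+ 2)%:E)%E.
Proof. by move=> t0; case: (pbounds o t0). Qed.

Lemma gam_apriori I J B : apriori M.+2 1 (fun o => gam o I J B).
Proof.
apply: (@energy_Cb (fun S => gam S I J B) energy) => o t t0; last exact: energy_bound.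
- exact: (gam_continuous (perturbed_regular o) (@perturbed_orthonormal o) t0).
- exact: (gam_periodic (perturbed_regular o) (@perturbed_orthonormal o) _ _ _ t0).
- exact: gam_le.
Qed.

Lemma hat_e_apriori I i : apriori M.+2 1 (fun o => hat_e o b I i).
Proof.
apply: (@energy_Cb (fun S => hat_e S b I i) energy) => o t t0; last exact: energy_bound.
- rewrite /hat_e; apply: continuous_add; first exact: (frame_continuous (perturbed_regular o)).
  by move=> x; exact: cst_continuous.
- by move=> x j; rewrite /hat_e (frame_periodic (perturbed_regular o)).
- exact: e_le.
Qed.

Lemma e_psi_apriori I : apriori M.+2 1 (fun o => e_psi o I).
Proof.
apply: (@energy_Cb (fun S => e_psi S I) energy) => o t t0; last exact: energy_bound.
- exact: (e_psi_continuous (perturbed_regular o)).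
- exact: (e_psi_periodic (perturbed_regular o)).
- exact: epsi_le.
Qed.

Lemma sup_Cb (X : fields R -> R -> 'rV[R]_3 -> R) :
  (forall o t, 0 <= t -> (CM_norm (N - 4) (X o t) <= (C0 * psize o * expR (- (2 * H * t)))%:E)%E) ->
  apriori M.+2 2 (fun o => X o).
Proof.
move=> HX; exists C0; first exact: ltW.
by move=> o t t0; apply: CM_normP; have := HX o t t0; rewrite (_ : N - 4 = M.+2)%N// hN; lia.
Qed.

Lemma hat_k_apriori I J : apriori M.+2 2 (fun o => hat_k o I J).
Proof.
apply: (@sup_Cb (fun S => hat_k S I J)) => o t t0; have [_] := pbounds o t0; apply: le_trans.
rewrite -addeA; apply: (@le_trans _ _ (sqrte (\sum_I \sum_J CM_norm (N - 4) (hat_k o I J t) ^+ 2))); last first.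
  by rewrite leeDl// adde_ge0// CM_norm_ge0.
have sq0 K L' : (0 <= CM_norm (N - 4) (hat_k o K L' t) ^+ 2)%E by rewrite expe_ge0// CM_norm_ge0.
rewrite -[leLHS]gee0_abs ?CM_norm_ge0// -sqrte_sqr lee_sqrt; last first.
  by do 2!(apply: sume_ge0 => ? _).
apply: (le_trans _ (@le_sum_term _ _ _ I _)) => [|i]; last by apply: sume_ge0 => ? _.
exact: (@le_sum_term _ _ (fun J => CM_norm (N - 4) (hat_k o I J t) ^+ 2)%E).
Qed.

Lemma hat_n_apriori : apriori M.+2 2 (fun o => hat_n o).
Proof.
apply: (@sup_Cb (fun S => hat_n S)) => o t t0; have [_] := pbounds o t0; apply: le_trans.
by rewrite -addeA addeCA leeDl// adde_ge0 ?CM_norm_ge0 ?sqrte_ge0.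
Qed.

Lemma hat_e0psi_apriori : apriori M.+2 2 (fun o => hat_e0psi o b).
Proof.
apply: (@sup_Cb (fun S => hat_e0psi S b)) => o t t0; have [_] := pbounds o t0; apply: le_trans.
by rewrite addeC leeDl// adde_ge0 ?CM_norm_ge0 ?sqrte_ge0.
Qed.
End Perturbed.

(** * Expansions of the frame, of e_I psi and of gamma *)

Section PerturbedA.
Context {R : realType}.
Variables (M N : nat) (b : flrw R) (C0 : R).
Hypotheses (hN : N = (M + 6)%N) (hL : 0 < Lambda b) (ha : 0 < a_init b)
  (hcoef : flrw_coef b) (hC0 : 0 < C0).
Local Notation H := (hubble b).
Local Notation L := (inv_scale_limit b).
Local Notation pert := (perturbed N b C0).
Local Notation OO := (@OO R 3 H _ (@psize R N b C0)).
Local Notation EX := (@EX R 3 H _ (@psize R N b C0)).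
Implicit Types (o : pert) (t : R) (x : 'rV[R]_3) (I J K B C D : 'I_3).

Let H0 : 0 < H := hubble_gt0 hL.
Let e01 : forall o, 0 <= psize o <= 1 := @psize01 R N b C0.
Local Notation OOW := (OO_W H0 e01).
Local Notation OOM := (OO_mul H0 e01).

Lemma hub_OO m : OO m 0 0 (fun _ t _ => hub b t).
Proof.
have s1 := sinh_coef_ge1 hL hcoef.
have K0 : 0 <= H * (sinh_coef b - 1) by rewrite mulr_ge0 ?(ltW H0)// subr_ge0.
apply: (@OO_time _ _ _ _ _ _ _ _ (H * (sinh_coef b - 1) + H)) => t t0.
rewrite !mul0r oppr0 expR0 mulr1 -{1}(subrK H (hub b t)).
apply: (le_trans (ler_normD _ _)); rewrite (ger0_norm (ltW H0)) lerD2r.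
apply: (le_trans (hub_bound hL hcoef (ltW t0))); rewrite ler_piMr// -expR0 ler_expR.
by rewrite oppr_le0 !mulr_ge0 ?(ltW H0)// ltW.
Qed.

Lemma hub_sub_OO m : OO m 0 6 (fun _ t _ => hub b t - H).
Proof.
apply: (@OO_time _ _ _ _ _ _ _ _ (H * (sinh_coef b - 1))) => t t0.
exact: (hub_bound hL hcoef (ltW t0)).
Qed.

Lemma dpsi_OO m : OO m 0 3 (fun _ t _ => dpsi b t).
Proof.
by apply: (@OO_time _ _ _ _ _ _ _ _ `|phi_init b|) => t t0; exact: dpsi_bound.
Qed.

Lemma scale_OO m : OO m 0 (-1) (fun _ t _ => scale b t).
Proof.
apply: (@OO_time _ _ _ _ _ _ _ _ (a_init b * (sinh_coef b + 1))) => t t0.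
rewrite gtr0_norm ?scale_gt0 ?(ltW t0)// mulN1r mulNr opprK.
exact: (scale_le hL ha hcoef (ltW t0)).
Qed.

Lemma inv_scale_OO m : OO m 0 1 (fun _ t _ => (scale b t)^-1).
Proof.
apply: (@OO_time _ _ _ _ _ _ _ _ (a_init b)^-1) => t t0.
rewrite gtr0_norm ?invr_gt0 ?scale_gt0 ?(ltW t0)// mul1r.
exact: (inv_scale_le hL ha hcoef (ltW t0)).
Qed.

Lemma inv_scale_sub_OO m : OO m 0 7 (fun _ t _ => (scale b t)^-1 - L * expR (- (1 * H * t))).
Proof.
apply: (@OO_time _ _ _ _ _ _ _ _ ((a_init b)^-1 * ((sinh_coef b - 1) / 2))) => t t0.
by rewrite mul1r; exact: (inv_scale_bound hL ha hcoef (ltW t0)).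
Qed.

Lemma hat_n_OO : OO M.+2 1 2 (fun o => hat_n o).
Proof. exact: (apriori_OO (hat_n_apriori hN hL ha hC0)). Qed.

Lemma hat_k_OO I J : OO M.+2 1 2 (fun o => hat_k o I J).
Proof. exact: (apriori_OO (hat_k_apriori hN hL ha hC0 I J)). Qed.

Lemma hat_e0psi_OO : OO M.+2 1 2 (fun o => hat_e0psi o b).
Proof. exact: (apriori_OO (hat_e0psi_apriori hN hL ha hC0)). Qed.

Lemma gam_OO I J B : OO M.+2 1 1 (fun o => gam o I J B).
Proof. exact: (apriori_OO (gam_apriori hN hL ha hC0 I J B)). Qed.

Lemma hat_e_OO I i : OO M.+2 1 1 (fun o => hat_e o b I i).
Proof. exact: (apriori_OO (hat_e_apriori hN hL ha hC0 I i)). Qed.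

Lemma e_psi_OO I : OO M.+2 1 1 (fun o => e_psi o I).
Proof. exact: (apriori_OO (e_psi_apriori hN hL ha hC0 I)). Qed.

Lemma frame_OO I i : OO M.+2 0 1 (fun o t x => frame o t x I i).
Proof.
have h1 := OO_scale (I == i)%:R (inv_scale_OO M.+2).
apply: OO_ext (OO_add (OOW (hat_e_OO I i) (leqnn _) (leq0n 1) (lexx _)) h1) => o t _ x /=.
by rewrite /hat_e subrK.
Qed.

Lemma lapseE o t x : lapse o t x = 1 + hat_n o t x.
Proof. by rewrite /hat_n addrC subrK. Qed.

Lemma trkE o t x : 0 < t -> trk o t x = - 3 * hub b t - hat_n o t x.
Proof.
move=> t0; rewrite -trk_flrwE// /hat_n (perturbed_gauge o x (ltW t0)).
by rewrite opprB addrCA subrr addr0.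
Qed.

(** The matrix A_IJ = n k_IJ + (a'/a) delta_IJ ([mk_dev]), with tr k eliminated by the gauge
    condition so that its decay is visible. *)
Definition dev I J o t x : R := (1 + hat_n o t x) * hat_k o I J t x
  - (I == J)%:R * (hat_n o t x * hub b t + 3^-1 * hat_n o t x + 3^-1 * (hat_n o t x * hat_n o t x)).

Lemma mk_dev I J o t x : 0 < t -> mk o I J t x = dev I J o t x - hub b t * (I == J)%:R.
Proof.
move=> t0; rewrite /mk /dev /hat_k trkE// lapseE; set d : R := (I == J)%:R; by field.
Qed.

Lemma nn_OO : OO M.+2 1 2 (fun o t x => hat_n o t x * hat_n o t x).
Proof. by apply: (OOM hat_n_OO hat_n_OO) => //; lra. Qed.

Lemma dev_OO I J : OO M.+2 1 2 (dev I J).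
Proof.
have h1 : OO M.+2 1 2 (fun o t x => hat_n o t x * hat_k o I J t x).
  by apply: (OOM hat_n_OO (hat_k_OO I J)) => //; lra.
have h2 : OO M.+2 1 2 (fun o t x => hat_n o t x * hub b t).
  by apply: (OOM hat_n_OO (hub_OO _)) => //; lra.
have h := OO_add (OO_add h2 (OO_scale 3^-1 hat_n_OO)) (OO_scale 3^-1 nn_OO).
apply: OO_ext (OO_sub (OO_add (hat_k_OO I J) h1) (OO_scale (I == J)%:R h)) => o t _ x /=.
by rewrite /dev; ring.
Qed.

Lemma renorm_derive (f : R -> R) (g t : R) : 0 < t ->
  is_derive t (1:R) f (- hub b t * f t + g) ->
  is_derive t (1:R) (fun t => scale b t * f t) (scale b t * g).
Proof.
move=> t0 df; have ds := is_derive_scale hL hcoef t0.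
apply: (is_derive_eq (is_deriveM ds df)); rewrite /GRing.scale /=; ring.
Qed.

(** The remainder of [f] is 1/a times the error in the limit of [a f], plus that limit times 1/a - L
    exp(- Ht). The factor L = lim exp(Ht)/a converts the limit of [a f] into that of exp(Ht) f. *)
Lemma renorm_EX m (f F : pert -> R -> 'rV[R]_3 -> R) :
  (forall o t x, 0 < t -> is_derive t (1:R) (fun t => scale b t * f o t x) (F o t x)) ->
  OO m 1 2 F -> OO m 1 1 f ->
  EX m 1 1 f (fun o x => L * flim (fun o t x => scale b t * f o t x) o x).
Proof.
move=> df FO fO; set v := fun o t x => scale b t * f o t x.
have vO : OO m 1 0 v by apply: (OOM (scale_OO m) fO) => //; lra.
have [vI _] := OO_int H0 e01 df (ltr0Sn R 1) FO vO.
have iO : OO m 1 0 (fun o _ => flim v o).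
  have := OO_sub vO (OOW vI (leqnn _) (leqnn _) (ler0n R 2)).
  by apply: OO_ext => o t _ x; rewrite opprB addrC subrK.
split=> //; first by have := OO_scale L iO.
have a1 : OO m 1 (1 + 2) (fun o t x => (scale b t)^-1 * (v o t x - flim v o x)).
  exact: (OOM (inv_scale_OO m) vI).
have a2 : OO m 1 (1 + 2) (fun o t x => flim v o x * ((scale b t)^-1 - L * expR (- (1 * H * t)))).
  by apply: (OOM iO (inv_scale_sub_OO m)) => //; lra.
apply: OO_ext (OO_add a1 a2) => o t t0 x /=; rewrite /v.
move: (scale_gt0 hL ha hcoef (ltW t0)) => /lt0r_neq0; set a := scale b t.
set l := flim _ o x => a0; field; exact: a0.
Qed.

Definition ehat_oo I i o x : R := L * flim (fun o t x => scale b t * hat_e o b I i t x) o x.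

Lemma hat_e_EX I i : EX M.+2 1 1 (fun o => hat_e o b I i) (ehat_oo I i).
Proof.
pose F o t x := \sum_C dev I C o t x * (scale b t * frame o t x C i).
apply: (@renorm_EX _ _ F); last exact: hat_e_OO; last first.
  apply: OO_sum => C.
  have fO : OO M.+2 0 0 (fun o t x => scale b t * frame o t x C i).
    by apply: (OOM (scale_OO _) (frame_OO C i)) => //; lra.
  by apply: (OOM (dev_OO I C) fO) => //; lra.
move=> o t x t0.
have D1 : is_derive t (1:R) (fun t => scale b t * frame o t x I i)
    (scale b t * \sum_C dev I C o t x * frame o t x C i).
  apply: renorm_derive => //.
  have := frame_evolution_mk (perturbed_regular o) (@perturbed_posdef _ _ _ _ o)
    (@perturbed_orthonormal _ _ _ _ o) (@perturbed_fermi _ _ _ _ o) I i x t0.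
  move=> D; apply: (is_derive_eq D); under eq_bigr do rewrite mk_dev// mulrBl -mulrA.
  by rewrite sumrB -mulr_sumr sum_delta_l; ring.
(* a times the background frame is the constant delta, so a e and a times the difference have the
   same derivative. *)
have D2 := is_deriveB D1 (@is_derive_cst _ _ _ ((I == i)%:R : R) t 1).
apply: (near_eq_is_derive _ (is_derive_eq D2 _)); last first.
  by rewrite subr0 mulr_sumr; apply: eq_bigr => C _; ring.
apply: near_pos => // r r0; rewrite !fctE /hat_e.
have a0 := lt0r_neq0 (scale_gt0 hL ha hcoef (ltW r0)); field; exact: a0.
Qed.

Definition e_oo I i o x : R := e_infty b (fun I i => ehat_oo I i o) I i x.

Lemma frame_EX I i : EX M.+2 0 1 (fun o t x => frame o t x I i) (e_oo I i).
Proof.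
have h : EX M.+2 0 1 (fun _ t _ => (I == i)%:R * (scale b t)^-1) (fun _ _ => (I == i)%:R * L).
  split; first exact: OO_scale (inv_scale_OO _); first exact: OO_cst.
  have h := OOW (inv_scale_sub_OO M.+2) (leqnn _) (leqnn _) (ltac:(lra) : 1 + 2 <= 7 :> R).
  by apply: OO_ext (OO_scale (I == i)%:R h) => o t _ x; ring.
apply: EX_ext (EX_add (EX_W H0 e01 (hat_e_EX I i) (leqnn _) (leq0n 1)) h) => [a t _|a] x //.
by rewrite /hat_e subrK.
Qed.

Definition epsi_oo I o x : R := L * flim (fun o t x => scale b t * e_psi o I t x) o x.

Lemma e_psi_EX I : EX M.+1 1 1 (fun o => e_psi o I) (epsi_oo I).
Proof.
(* [q] is n e_0 psi minus its background value, which is constant in x: the spatial derivative in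
   the equation sees only [q], small and decaying. This derivative costs the order M + 1 instead of
   M + 2. *)
pose q o t x := hat_n o t x * dpsi b t + hat_e0psi o b t x + hat_n o t x * hat_e0psi o b t x.
have qO : OO M.+2 1 2 q.
  apply: OO_add; [apply: OO_add|]; last by apply: (OOM hat_n_OO hat_e0psi_OO) => //; lra.
    by apply: (OOM hat_n_OO (dpsi_OO _)) => //; lra.
  exact: hat_e0psi_OO.
have qE o t x : 0 < t -> lapse o t x * e0_psi o t x = q o t x + dpsi b t.
  by move=> t0; rewrite lapseE /q /hat_e0psi derive1_psi_flrw//; ring.
have pq o t a x : 0 < t -> pd a (fun y => lapse o t y * e0_psi o t y) x = pd a (q o t) x.
  move=> t0; have -> : (fun y => lapse o t y * e0_psi o t y) = (fun y => q o t y + dpsi b t).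
    by apply/funext => y; exact: qE.
  have dq : derivable (q o t) x (delta_mx 0 a) by case/CkS: (OO_Ck o qO t0).
  by rewrite pdD// /pd derive_cst addr0.
pose F o t x := \sum_C dev I C o t x * (scale b t * e_psi o C t x)
  + \sum_a (scale b t * frame o t x I a) * pd a (q o t) x.
apply: (@renorm_EX _ _ F) (OOW (e_psi_OO I) (leqnSn _) (leqnn _) (lexx _)); last first.
  apply: OO_add; apply: OO_sum => C.
    have pO : OO M.+2 1 0 (fun o t x => scale b t * e_psi o C t x).
      by apply: (OOM (scale_OO _) (e_psi_OO C)) => //; lra.
    by apply: OOW (leqnSn _) (leqnn 1) (lexx 2); apply: (OOM (dev_OO I C) pO) => //; lra.
  have fO : OO M.+1 0 0 (fun o t x => scale b t * frame o t x I C).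
    by apply: (OOM (scale_OO _) (OOW (frame_OO I C) (leqnSn _) (leqnn _) (lexx _))) => //; lra.
  by apply: (OOM fO (OO_pd C qO)) => //; lra.
move=> o t x t0.
have -> : F o t x = scale b t * (\sum_C dev I C o t x * e_psi o C t x
    + \sum_a frame o t x I a * pd a (q o t) x).
  rewrite /F mulrDr !mulr_sumr; congr (_ + _); apply: eq_bigr => C _; ring.
apply: renorm_derive => //.
have := e_psi_evolution (perturbed_regular o) (@perturbed_posdef _ _ _ _ o)
  (@perturbed_orthonormal _ _ _ _ o) (@perturbed_fermi _ _ _ _ o) I x t0.
move=> D; apply: (is_derive_eq D); under eq_bigr do rewrite mk_dev// mulrBl -mulrA.
under [X in _ + X]eq_bigr do rewrite pq//.
by rewrite sumrB -mulr_sumr sum_delta_l; ring.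
Qed.

(* [e_I, e_J] = tors_IJK e_K. The evolution of these structure coefficients
   follows from that of the frame alone, and the Koszul formula recovers gamma. *)
Definition tors o I J K t x : R := gam o I J K t x - gam o J I K t x.
Definition tors_oo I J K o x : R := L * flim (fun o t x => scale b t * tors o I J K t x) o x.

Lemma tors_OO I J K : OO M.+2 1 1 (fun o => tors o I J K).
Proof. exact: (OO_sub (gam_OO I J K) (gam_OO J I K)). Qed.

Lemma tors_EX I J K : EX M.+1 1 1 (fun o => tors o I J K) (tors_oo I J K).
Proof.
have pm o t a I' J' x : 0 < t -> pd a (mk o I' J' t) x = pd a (dev I' J' o t) x.
  move=> t0; have -> : mk o I' J' t = (fun y => dev I' J' o t y + - (hub b t * (I' == J')%:R)).
    by apply/funext => y; rewrite mk_dev.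
  have dq : derivable (dev I' J' o t) x (delta_mx 0 a) by case/CkS: (OO_Ck o (dev_OO I' J') t0).
  by rewrite pdD// /pd derive_cst addr0.
pose F o t x := \sum_C dev I C o t x * (scale b t * tors o C J K t x)
  + \sum_C dev J C o t x * (scale b t * tors o I C K t x)
  - \sum_C (scale b t * tors o I J C t x) * dev C K o t x
  + \sum_a ((scale b t * frame o t x I a) * pd a (dev J K o t) x
      - (scale b t * frame o t x J a) * pd a (dev I K o t) x).
have sO I' J' K' : OO M.+2 1 0 (fun o t x => scale b t * tors o I' J' K' t x).
  by apply: (OOM (scale_OO _) (tors_OO I' J' K')) => //; exact: lexx.
have fO I' a : OO M.+1 0 0 (fun o t x => scale b t * frame o t x I' a).
  by apply: (OOM (scale_OO _) (OOW (frame_OO I' a) (leqnSn _) (leqnn _) (lexx _))) => //; exact: lexx.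
apply: (@renorm_EX _ _ F) (OOW (tors_OO I J K) (leqnSn _) (leqnn _) (lexx _)); last first.
  apply: OO_add; last first.
    by apply: OO_sum => a; apply: OO_sub;
      [apply: (OOM (fO I a) (OO_pd a (dev_OO J K)))|apply: (OOM (fO J a) (OO_pd a (dev_OO I K)))] => //; lra.
  apply: OOW (leqnSn _) (leqnn 1) (lexx 2); apply: OO_sub; [apply: OO_add|]; apply: OO_sum => C.
  - by apply: (OOM (dev_OO I C) (sO C J K)) => //; lra.
  - by apply: (OOM (dev_OO J C) (sO I C K)) => //; lra.
  - by apply: (OOM (sO I J C) (dev_OO C K)) => //; lra.
move=> o t x t0.
have -> : F o t x = scale b t * (\sum_C dev I C o t x * tors o C J K t x
  + \sum_C dev J C o t x * tors o I C K t x
  - \sum_C tors o I J C t x * dev C K o t x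
  + \sum_a (frame o t x I a * pd a (dev J K o t) x - frame o t x J a * pd a (dev I K o t) x)).
  rewrite /F !(mulrDr, mulrN, mulr_sumr); congr (_ + _ - _ + _); apply: eq_bigr => C _; ring.
apply: renorm_derive => //.
have := torsion_evolution (perturbed_regular o) (@perturbed_posdef _ _ _ _ o)
  (@perturbed_orthonormal _ _ _ _ o) (@perturbed_fermi _ _ _ _ o) I J K x t0.
move=> D; rewrite /tors; apply: (is_derive_eq D).
(* The background part of [mk] contributes - a'/a, - a'/a and + a'/a times the structure coefficient
   in the three sums: in total - a'/a, which the renormalization by a absorbs. *)
have e1 : \sum_C mk o I C t x * (gam o C J K t x - gam o J C K t x)
   = \sum_C dev I C o t x * (gam o C J K t x - gam o J C K t x)
     - hub b t * (gam o I J K t x - gam o J I K t x).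
  rewrite -(sum_delta_l (fun C => gam o C J K t x - gam o J C K t x) I) mulr_sumr -sumrB.
  by apply: eq_bigr => C _; rewrite mk_dev//; ring.
have e2 : \sum_C mk o J C t x * (gam o I C K t x - gam o C I K t x)
   = \sum_C dev J C o t x * (gam o I C K t x - gam o C I K t x)
     - hub b t * (gam o I J K t x - gam o J I K t x).
  rewrite -(sum_delta_l (fun C => gam o I C K t x - gam o C I K t x) J) mulr_sumr -sumrB.
  by apply: eq_bigr => C _; rewrite mk_dev//; ring.
have e3 : \sum_C (gam o I J C t x - gam o J I C t x) * mk o C K t x
   = \sum_C (gam o I J C t x - gam o J I C t x) * dev C K o t x
     - hub b t * (gam o I J K t x - gam o J I K t x).
  rewrite -(sum_delta_l (fun C => gam o I J C t x - gam o J I C t x) K) mulr_sumr -sumrB.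
  by apply: eq_bigr => C _; rewrite mk_dev// eq_sym; ring.
have e4 : \sum_a (frame o t x I a * pd a (mk o J K t) x - frame o t x J a * pd a (mk o I K t) x)
   = \sum_a (frame o t x I a * pd a (dev J K o t) x - frame o t x J a * pd a (dev I K o t) x).
  by apply: eq_bigr => a _; rewrite !pm.
by rewrite e1 e2 e3 e4; ring.
Qed.

Definition koszul_oo I J B o x : R :=
  2^-1 * (tors_oo I J B o x + tors_oo B I J o x - tors_oo J B I o x).
(* Antisymmetrized in the last two indices so that the antisymmetry of gamma is
   inherited without appealing to the uniqueness of limits. *)
Definition gam_oo I J B o x : R := 2^-1 * (koszul_oo I J B o x - koszul_oo I B J o x).

Lemma gam_oo_antisym I J B o x : gam_oo I J B o x = - gam_oo I B J o x.
Proof. by rewrite /gam_oo; ring. Qed.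

Lemma gam_EX I J B : EX M.+1 1 1 (fun o => gam o I J B) (gam_oo I J B).
Proof.
have k I' J' B' : EX M.+1 1 1 (fun o => gam o I' J' B') (koszul_oo I' J' B').
  apply: EX_ext (EX_scale 2^-1 (EX_sub (EX_add (tors_EX I' J' B') (tors_EX B' I' J')) (tors_EX J' B' I'))).
    move=> o t t0 x; rewrite /tors.
    have as' I1 J1 B1 := gam_antisym (perturbed_regular o) (@perturbed_posdef _ _ _ _ o)
      (@perturbed_orthonormal _ _ _ _ o) I1 J1 B1 x (ltW t0).
    by rewrite (as' I' B' J') (as' B' J' I') (as' J' B' I'); field.
  by move=> o x.
apply: EX_ext (EX_scale 2^-1 (EX_sub (k I J B) (k I B J))) => [a t t0|a] x //.
rewrite (gam_antisym (perturbed_regular a) (@perturbed_posdef _ _ _ _ a)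
  (@perturbed_orthonormal _ _ _ _ a) I B J x (ltW t0)); by field.
Qed.

End PerturbedA.

(** * Expansions of k, of e_0 psi and of the lapse *)

Section PerturbedB.
Context {R : realType}.
Variables (M N : nat) (b : flrw R) (C0 : R).
Hypotheses (hN : N = (M + 6)%N) (hL : 0 < Lambda b) (ha : 0 < a_init b)
  (hcoef : flrw_coef b) (hC0 : 0 < C0).
Local Notation H := (hubble b).
Local Notation L := (inv_scale_limit b).
Local Notation pert := (perturbed N b C0).
Local Notation OO := (@OO R 3 H _ (@psize R N b C0)).
Local Notation EX := (@EX R 3 H _ (@psize R N b C0)).
Implicit Types (o : pert) (t : R) (x : 'rV[R]_3) (I J K B C D : 'I_3).

Let H0 : 0 < H := hubble_gt0 hL.
Let e01 : forall o, 0 <= psize o <= 1 := @psize01 R N b C0.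
Local Notation OOW := (OO_W H0 e01).
Local Notation OOM := (OO_mul H0 e01).

Local Notation e_oo := (@e_oo R N b C0).
Local Notation gam_oo := (@gam_oo R N b C0).
Local Notation epsi_oo := (@epsi_oo R N b C0).

Let frE I i : EX M 0 1 (fun o t x => frame o t x I i) (e_oo I i).
Proof. by apply: (EX_W H0 e01 (frame_EX hN hL ha hcoef hC0 I i)); lia. Qed.
Let gE I J B : EX M 1 1 (fun o => gam o I J B) (gam_oo I J B).
Proof. by apply: (EX_W H0 e01 (gam_EX hN hL ha hcoef hC0 I J B)); lia. Qed.
Let pE I : EX M 1 1 (fun o => e_psi o I) (epsi_oo I).
Proof. by apply: (EX_W H0 e01 (e_psi_EX hN hL ha hcoef hC0 I)); lia. Qed.
Let dgE a I J B : EX M 1 1 (fun o t => pd a (gam o I J B t)) (fun o => pd a (gam_oo I J B o)).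
Proof. exact: (EX_pd a (gam_EX hN hL ha hcoef hC0 I J B)). Qed.
Let dpE a I : EX M 1 1 (fun o t => pd a (e_psi o I t)) (fun o => pd a (epsi_oo I o)).
Proof. exact: (EX_pd a (e_psi_EX hN hL ha hcoef hC0 I)). Qed.
Let nM : OO M 1 2 (fun o => hat_n o).
Proof. by apply: OOW (hat_n_OO hN hL ha hC0) _ _ _; rewrite ?lexx//; lia. Qed.
Let kM I J : OO M 1 2 (fun o => hat_k o I J).
Proof. by apply: OOW (hat_k_OO hN hL ha hC0 I J) _ _ _; rewrite ?lexx//; lia. Qed.
Let pM : OO M 1 2 (fun o => hat_e0psi o b).
Proof. by apply: OOW (hat_e0psi_OO hN hL ha hC0) _ _ _; rewrite ?lexx//; lia. Qed.

Let EXM (e1 e2 : nat) f g finf ginf : EX M e1 1 f finf -> EX M e2 1 g ginf -> (1 <= e1 + e2)%N ->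
  EX M 1 2 (fun o t x => f o t x * g o t x) (fun o x => finf o x * ginf o x).
Proof. by move=> Hf Hg e12; apply: (EX_mul H0 e01 Hf Hg e12); ring. Qed.

Definition src_oo I J o x : R :=
  \sum_C \sum_a e_oo C a o x * pd a (gam_oo I J C o) x
  - \sum_C \sum_a e_oo I a o x * pd a (gam_oo C J C o) x
  - \sum_C \sum_D gam_oo C I D o x * gam_oo D J C o x
  - \sum_C \sum_D gam_oo I J D o x * gam_oo C C D o x
  - epsi_oo I o x * epsi_oo J o x.

Lemma src_EX I J : EX M 1 2 (fun o => src o I J) (src_oo I J).
Proof.
apply: EX_sub; last exact: EXM (pE I) (pE J) _.
apply: EX_sub; last by do 2!(apply: EX_sum => ?); exact: EXM (gE _ _ _) (gE _ _ _) _.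
apply: EX_sub; last by do 2!(apply: EX_sum => ?); exact: EXM (gE _ _ _) (gE _ _ _) _.
by apply: EX_sub; do 2!(apply: EX_sum => ?); exact: EXM (frE _ _) (dgE _ _ _ _) _.
Qed.

Definition wave o t x : R := \sum_C \sum_a frame o t x C a * pd a (e_psi o C t) x
  - \sum_C \sum_D gam o C C D t x * e_psi o D t x.
Definition wave_oo o x : R := \sum_C \sum_a e_oo C a o x * pd a (epsi_oo C o) x
  - \sum_C \sum_D gam_oo C C D o x * epsi_oo D o x.

Lemma wave_EX : EX M 1 2 wave wave_oo.
Proof.
apply: EX_sub; do 2!(apply: EX_sum => ?); first exact: EXM (frE _ _) (dpE _ _) _.
exact: EXM (gE _ _ _) (pE _) _.
Qed.

Lemma F_e0psiE o x : F_e0psi b (fun I i => e_oo I i o) (fun I J B => gam_oo I J B o)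
  (fun I => epsi_oo I o) x = H^-1 * wave_oo o x.
Proof. by []. Qed.

(** The trace-free part of the source, which drives [hat_k]; its profile divided by H is [F_k]
    ([F_kE]). *)
Definition tsrc I J o t x : R := src o I J t x - 3^-1 * (I == J)%:R * \sum_K src o K K t x.
Definition tsrc_oo I J o x : R := src_oo I J o x - 3^-1 * (I == J)%:R * \sum_K src_oo K K o x.

Lemma tsrc_EX I J : EX M 1 2 (tsrc I J) (tsrc_oo I J).
Proof.
apply: EX_sub; first exact: src_EX.
by apply: EX_scale; apply: EX_sum => K; exact: src_EX.
Qed.

(** By antisymmetry of [dg] the two derivative terms, signs included, have the same trace. Hence the
    factor 2, and the coefficient 2/3 in [F_k]. *)
Lemma trace_quadratic (e : 'I_3 -> 'I_3 -> R) (g : 'I_3 -> 'I_3 -> 'I_3 -> R)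
    (dg : 'I_3 -> 'I_3 -> 'I_3 -> 'I_3 -> R) (p : 'I_3 -> R) :
  (forall a I J B, dg a I J B = - dg a I B J) ->
  \sum_K (\sum_C \sum_a e C a * dg a K K C - \sum_C \sum_a e K a * dg a C K C
    - \sum_C \sum_D g C K D * g D K C - \sum_C \sum_D g K K D * g C C D - p K * p K)
  = 2 * (\sum_C \sum_D \sum_a e C a * dg a D D C)
    - (\sum_C \sum_D \sum_K (g C K D * g D K C + g K K D * g C C D))
    - \sum_C p C * p C.
Proof.
move=> dgA; have swap (f : 'I_3 -> 'I_3 -> R) : \sum_K \sum_C f K C = \sum_C \sum_K f K C.
  exact: exchange_big.
rewrite !sumrB (swap (fun K C => \sum_a e C a * dg a K K C)).
have -> : \sum_K \sum_C \sum_a e K a * dg a C K C = - \sum_C \sum_D \sum_a e C a * dg a D D C.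
  rewrite -sumrN; apply: eq_bigr => K _; rewrite -sumrN; apply: eq_bigr => C _.
  by rewrite -sumrN; apply: eq_bigr => a _; rewrite dgA mulrN.
have -> : \sum_C \sum_D \sum_K (g C K D * g D K C + g K K D * g C C D)
  = \sum_K \sum_C \sum_D g C K D * g D K C + \sum_K \sum_C \sum_D g K K D * g C C D.
  rewrite (swap (fun K C => \sum_D g C K D * g D K C)) (swap (fun K C => \sum_D g K K D * g C C D)).
  rewrite -big_split; apply: eq_bigr => C _.
  rewrite (swap (fun K D => g C K D * g D K C)) (swap (fun K D => g K K D * g C C D)).
  by rewrite -big_split; apply: eq_bigr => D _; rewrite -big_split.
ring.
Qed.

Lemma trace_src_oo o x : \sum_K src_oo K K o x
  = 2 * (\sum_C \sum_D \sum_a e_oo C a o x * pd a (gam_oo D D C o) x)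
    - (\sum_C \sum_D \sum_E (gam_oo C E D o x * gam_oo D E C o x
                            + gam_oo E E D o x * gam_oo C C D o x))
    - \sum_C epsi_oo C o x * epsi_oo C o x.
Proof.
have dgA a I J B : pd a (gam_oo I J B o) x = - pd a (gam_oo I B J o) x.
  have -> : gam_oo I J B o = (fun y => -1 * gam_oo I B J o y).
    by apply/funext => y; rewrite gam_oo_antisym mulN1r.
  have [_ gO _] := gam_EX hN hL ha hcoef hC0 I B J.
  rewrite pdZ; last by case/CkS: (OO_Ck o gO ltr01).
  by rewrite mulN1r.
exact: (trace_quadratic (fun C a => e_oo C a o x) (fun I J B => gam_oo I J B o x)
  (fun C => epsi_oo C o x) dgA).
Qed.

Lemma F_kE I J o x : F_k b (fun I i => e_oo I i o) (fun I J B => gam_oo I J B o)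
  (fun I => epsi_oo I o) I J x = H^-1 * tsrc_oo I J o x.
Proof.
rewrite /F_k /tsrc_oo trace_src_oo /src_oo; congr (_ * _).
have alg (d T1 T2 T3 T4 P U V W : R) : T1 - T2 - 2 / 3 * d * U - T3 - T4 + 3^-1 * d * V - P + 3^-1 * d * W
  = T1 - T2 - T3 - T4 - P - 3^-1 * d * (2 * U - V - W) by field.
exact: alg.
Qed.

(* e^{3Ht} (phi - F e^{-2Ht}) has an integrable time derivative. *)
Lemma profile m (phi E : pert -> R -> 'rV[R]_3 -> R) (finf : pert -> 'rV[R]_3 -> R) :
  (forall o t x, 0 < t -> is_derive t (1:R) (fun t => phi o t x)
     (- (3 * H) * phi o t x + H * finf o x * expR (- (2 * H * t)) + E o t x)) ->
  OO m 1 2 phi -> OO m 1 0 (fun o _ => finf o) -> OO m 1 4 E ->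
  let G o t x := expR (3 * H * t) * (phi o t x - finf o x * expR (- (2 * H * t))) in
  [/\ OO m 1 1 (fun o t x => G o t x - flim G o x), OO m 1 0 (fun o _ => flim G o) &
    OO m 1 4 (fun o t x => phi o t x - finf o x * expR (- (2 * H * t))
                           - flim G o x * expR (- (3 * H * t)))].
Proof.
move=> dphi phiO fO EO G.
have e3 : OO m 0 (-3) (fun _ t _ => expR (3 * H * t)).
  by apply: OO_ext (OO_exp _ _ m (-3)) => o t _ x; rewrite !mulNr opprK.
have dG o t x : 0 < t -> is_derive t (1:R) (fun t => G o t x) (expR (3 * H * t) * E o t x).
  move=> t0; have D1 := is_derive_expM (3 * H) t; have D2 := is_derive_expM (- (2 * H)) t.
  have D3 := is_deriveM D1 (is_deriveB (dphi o t x t0) (is_deriveZ (finf o x) D2)).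
  have -> : (fun t => G o t x) = (fun t => expR (3 * H * t))
      * ((fun t => phi o t x) - finf o x *: (fun t => expR (- (2 * H) * t))).
    by apply/funext => r; rewrite /G !fctE mulNr.
  apply: (is_derive_eq D3).
  transitivity (expR (3 * H * t) * (- (3 * H) * phi o t x + H * finf o x * expR (- (2 * H * t))
      + E o t x - finf o x * (- (2 * H) * expR (- (2 * H) * t)))
    + (phi o t x - finf o x * expR (- (2 * H) * t)) * (3 * H * expR (3 * H * t))); first by [].
  rewrite (_ : expR (- (2 * H) * t) = expR (- (2 * H * t))); last by rewrite mulNr.
  by ring.
have gO : OO m 1 1 (fun o t x => expR (3 * H * t) * E o t x).
  by apply: (OOM e3 EO) => //; lra.
have GO : OO m 1 (-3) G.
  have h : OO m 1 0 (fun o t x => phi o t x - finf o x * expR (- (2 * H * t))).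
    apply: OO_sub; first by apply: OOW phiO _ _ _ => //; lra.
    by apply: (OOM fO (OO_exp _ _ m 2)) => //; lra.
  by apply: (OOM e3 h) => //; lra.
have [GI _] := OO_int H0 e01 dG ltr01 gO GO.
have e2 : OO m 0 (-1) (fun o t x => expR (1 * H * t)).
  by apply: OO_ext (OO_exp _ _ m (-1)) => o t _ x; rewrite !mulNr opprK.
have rO : OO m 1 4 (fun o t x => phi o t x - finf o x * expR (- (2 * H * t))
                           - flim G o x * expR (- (3 * H * t))).
  have h : OO m 1 4 (fun o t x => expR (- (3 * H * t)) * (G o t x - flim G o x)).
    by apply: (OOM (OO_exp _ _ m 3) GI) => //; lra.
  apply: OO_ext h => o t _ x; rewrite mulrBr /G mulrA -expRD addNr expR0; ring.
split=> //.
(* The bound on [G] grows like exp(3Ht). As the limit does not depend on t, reading this bound at t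
   = 1 suffices. *)
have h1 : OO m 1 (-3) (fun o _ => flim G o).
  have := OO_sub GO (OOW GI (leqnn _) (leqnn _) (ltac:(lra) : -3 <= 1)).
  by apply: OO_ext => o t _ x; rewrite opprB addrC subrK.
have [K K0 HK] := h1; exists (K * expR (3 * H)); first by rewrite mulr_ge0 ?expR_ge0.
move=> o t t0; have := HK o 1 ltr01; rewrite !mul0r oppr0 expR0 !mulr1 mulNr opprK.
by apply: CbW => //; rewrite mulrAC.
Qed.

(** The power of eps is 0 because the background part - 3 (a'/a - H) decays without being small. *)
Let lapse_trk_OO : OO M 0 2 (fun o t x => lapse o t x * trk o t x + 3 * H).
Proof.
have h1 : OO M 1 2 (fun o t x => hat_n o t x * hub b t).
  by apply: (OOM nM (hub_OO N C0 hL hcoef M)) => //; lra.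
have h2 : OO M 1 2 (fun o t x => hat_n o t x * hat_n o t x) by apply: (OOM nM nM) => //; lra.
have h3 := OO_add (OO_add nM (OO_scale 3 h1)) h2.
have h4 : OO M 0 2 (fun _ t _ => - 3 * (hub b t - H)).
  by apply: OO_scale; apply: OOW (hub_sub_OO N C0 hL hcoef M) _ _ _ => //; lra.
apply: OO_ext (OO_sub h4 (OOW h3 (leqnn _) (leq0n 1) (lexx _))) => o t t0 x /=.
by rewrite trkE// lapseE; ring.
Qed.

Lemma lapse_grad_OO I : OO M.+1 1 3 (fun o => lapse_grad o I).
Proof.
apply: OO_sum => a.
have h := OO_pd a (hat_n_OO hN hL ha hC0).
have f : OO M.+1 0 1 (fun o t x => frame o t x I a).
  by apply: OOW (frame_OO hN hL ha hcoef hC0 I a) _ _ _; rewrite ?lexx//; lia.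
have g : OO M.+1 1 3 (fun o t x => frame o t x I a * pd a (hat_n o t) x).
  by apply: (OOM f h) => //; lra.
apply: OO_ext g => o t t0 x; congr (_ * _).
have dn : derivable (hat_n o t) x (delta_mx 0 a).
  by case/CkS: (OO_Ck o (hat_n_OO hN hL ha hC0) t0).
have -> : lapse o t = (fun y => 1 + hat_n o t y) by apply/funext => y; rewrite lapseE.
have E := @pdD R 3 a (hat_n o t) (fun=> 1) x dn (derivable_cst _ _ _).
rewrite {3}/pd derive_cst addr0 in E; rewrite -E.
by congr (pd a _ x); apply/funext => y; rewrite addrC.
Qed.

(** Minus the Hessian of the lapse on the slice, as it occurs in [kk_evolution]. Each frame vector
    contributes a factor exp(- Ht), whence the rate 4. *)
Definition hess I J o t x : R := - (\sum_a frame o t x I a * pd a (lapse_grad o J t) x)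
  + \sum_K gam o I J K t x * lapse_grad o K t x.

Lemma hess_OO I J : OO M 1 4 (hess I J).
Proof.
apply: OO_add.
  apply: OO_opp; apply: OO_sum => a; have [f _ _] := frE I a.
  by apply: (OOM f (OO_pd a (lapse_grad_OO J))) => //; lra.
apply: OO_sum => K; have [g _ _] := gE I J K.
have l : OO M 1 3 (fun o => lapse_grad o K).
  by apply: OOW (lapse_grad_OO K) _ _ _; rewrite ?lexx//; lia.
by apply: (OOM g l) => //; lra.
Qed.

Lemma kk_derive I J o t x : 0 < t -> is_derive t (1:R) (fun t => kk o I J t x)
  (lapse o t x * (trk o t x * kk o I J t x + src o I J t x - Lambda b * (I == J)%:R) + hess I J o t x).
Proof.
move=> t0; have D := kk_evolution (perturbed_regular o) (@perturbed_posdef _ _ _ _ o)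
  (@perturbed_orthonormal _ _ _ _ o) (@perturbed_fermi _ _ _ _ o) (@perturbed_einstein _ _ _ _ o) I J x t0.
by apply: (is_derive_eq D); rewrite /hess [RHS]addrA.
Qed.

Lemma trk_derive o t x : 0 < t -> is_derive t (1:R) (fun t => trk o t x)
  (lapse o t x * (trk o t x ^+ 2 + \sum_K src o K K t x - 3 * Lambda b) + \sum_K hess K K o t x).
Proof.
move=> t0.
have -> : (fun t => trk o t x) = \sum_K (fun t => kk o K K t x).
  by apply/funext => s; rewrite fct_sumE.
have D := is_derive_sum (fun K : 'I_3 => kk_derive K K o x t0).
apply: (is_derive_eq D); rewrite big_split /= -mulr_sumr; congr (_ * _ + _).
rewrite sumrB big_split /= -mulr_sumr expr2; congr (_ + _ - _).
under eq_bigr do rewrite eqxx mulr1.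
by rewrite sumr_const card_ord mulr_natl.
Qed.

Definition k_oo I J := flim (fun o t x => expR (3 * H * t) *
  (hat_k o I J t x - H^-1 * tsrc_oo I J o x * expR (- (2 * H * t)))).

Lemma hat_k_profile I J :
  let G o t x := expR (3 * H * t) *
     (hat_k o I J t x - H^-1 * tsrc_oo I J o x * expR (- (2 * H * t))) in
  [/\ OO M 1 1 (fun o t x => G o t x - k_oo I J o x), OO M 1 0 (fun o _ => k_oo I J o) &
    OO M 1 4 (fun o t x => hat_k o I J t x - H^-1 * tsrc_oo I J o x * expR (- (2 * H * t))
                           - k_oo I J o x * expR (- (3 * H * t)))].
Proof.
have [ts1 ts2 ts3] := tsrc_EX I J.
(* The cosmological constant is pure trace and drops out. Besides the damping and the profile there
   remain products of two factors of rate 2, the remainder of [tsrc] and the Hessian. *)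
pose E o t x := (lapse o t x * trk o t x + 3 * H) * hat_k o I J t x + hat_n o t x * tsrc I J o t x
  + (tsrc I J o t x - tsrc_oo I J o x * expR (- (2 * H * t)))
  + (hess I J o t x - 3^-1 * (I == J)%:R * \sum_K hess K K o t x).
have EO : OO M 1 4 E.
  apply: OO_add; last first.
    by apply: OO_sub; [exact: hess_OO|apply: OO_scale; apply: OO_sum => K; exact: hess_OO].
  apply: OO_add; last by apply: OOW ts3 _ _ _ => //; lra.
  apply: OO_add; first by apply: (OOM lapse_trk_OO (kM I J)) => //; lra.
  by apply: (OOM nM ts1) => //; lra.
apply: (@profile M (fun o => hat_k o I J) E (fun o x => H^-1 * tsrc_oo I J o x)) => //.
  move=> o t x t0; have D1 := kk_derive I J o x t0; have D2 := trk_derive o x t0.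
  have D := is_deriveB D1 (is_deriveZ (3^-1 * (I == J)%:R) D2).
  apply: (is_derive_eq D); rewrite /GRing.scale /= mulVKf ?(lt0r_neq0 H0)// /E /hat_k /tsrc lapseE.
  by field.
exact: OO_scale.
Qed.

Definition e0psi_oo := flim (fun o t x => expR (3 * H * t) *
  (hat_e0psi o b t x - H^-1 * wave_oo o x * expR (- (2 * H * t)))).

Lemma hat_e0psi_profile :
  let G o t x := expR (3 * H * t) *
     (hat_e0psi o b t x - H^-1 * wave_oo o x * expR (- (2 * H * t))) in
  [/\ OO M 1 1 (fun o t x => G o t x - e0psi_oo o x), OO M 1 0 (fun o _ => e0psi_oo o) &
    OO M 1 4 (fun o t x => hat_e0psi o b t x - H^-1 * wave_oo o x * expR (- (2 * H * t))
                           - e0psi_oo o x * expR (- (3 * H * t)))].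
Proof.
have [ws1 ws2 ws3] := wave_EX.
have h1 : OO M 1 2 (fun o t x => hat_n o t x * hub b t).
  by apply: (OOM nM (hub_OO N C0 hL hcoef M)) => //; lra.
have h2 : OO M 1 2 (fun o t x => hat_n o t x * hat_n o t x) by apply: (OOM nM nM) => //; lra.
have h3 := OO_add (OO_add nM (OO_scale 3 h1)) h2.
(* The term with [dpsi] is what the background equation leaves: by the gauge condition n tr k + 3
   a'/a is minus its first factor. *)
pose E o t x := (lapse o t x * trk o t x + 3 * H) * hat_e0psi o b t x
  - (hat_n o t x + 3 * (hat_n o t x * hub b t) + hat_n o t x * hat_n o t x) * dpsi b t
  + hat_n o t x * wave o t x
  + (wave o t x - wave_oo o x * expR (- (2 * H * t)))
  + \sum_C lapse_grad o C t x * e_psi o C t x.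
have EO : OO M 1 4 E.
  apply: OO_add; last first.
    apply: OO_sum => C; have [p _ _] := pE C.
    have l : OO M 1 3 (fun o => lapse_grad o C).
      by apply: OOW (lapse_grad_OO C) _ _ _; rewrite ?lexx//; lia.
    by apply: (OOM l p) => //; lra.
  apply: OO_add; last by apply: OOW ws3 _ _ _ => //; lra.
  apply: OO_add; last by apply: (OOM nM ws1) => //; lra.
  apply: OO_sub; first by apply: (OOM lapse_trk_OO pM) => //; lra.
  by apply: (OOM h3 (dpsi_OO N C0 hL hcoef M)) => //; lra.
apply: (@profile M (fun o => hat_e0psi o b) E (fun o x => H^-1 * wave_oo o x)) => //.
  move=> o t x t0; have D1 := e0_psi_evolution (perturbed_regular o) (@perturbed_posdef _ _ _ _ o)
    (@perturbed_orthonormal _ _ _ _ o) (@perturbed_fermi _ _ _ _ o) (@perturbed_einstein _ _ _ _ o) x t0.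
  have D := is_deriveB D1 (is_derive_dpsi_flrw hL ha hcoef t0).
  apply: (is_derive_eq D); rewrite mulVKf ?(lt0r_neq0 H0)// /E /hat_e0psi derive1_psi_flrw//.
  rewrite trkE// lapseE /wave.
  ring.
exact: OO_scale.
Qed.

(** The balance - 2H n = - 6H n - s for a lapse perturbation proportional to exp(- 2Ht), with s the
    trace of the profile; 4 = 6 - 2. *)
Definition n_oo o x : R := - (4 * H)^-1 * \sum_K src_oo K K o x.

(* As n - 1 = tr k_FLRW - tr k, the lapse is governed by the trace of the
   evolution equation of k. Only the equation (a'/a)' = 3 H^2 - 3 (a'/a)^2 of the
   background enters, which holds whatever the coefficient of sinh. *)
Lemma hat_n_profile :
  [/\ OO M 1 2 (fun o t x => expR (2 * H * t) * hat_n o t x - n_oo o x),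
    OO M 1 0 (fun o _ => n_oo o) &
    OO M 1 4 (fun o t x => hat_n o t x - n_oo o x * expR (- (2 * H * t)))].
Proof.
pose s o t x := \sum_K src o K K t x; pose s_oo o x := \sum_K src_oo K K o x.
have [s1 s2 s3] : EX M 1 2 s s_oo by apply: EX_sum => K; exact: src_EX.
have h0 := hub_sub_OO N C0 hL hcoef M.
have nh : OO M 1 8 (fun o t x => hat_n o t x * (hub b t - H)) by apply: (OOM nM h0) => //; lra.
have nn : OO M 1 4 (fun o t x => hat_n o t x * hat_n o t x) by apply: (OOM nM nM) => //; lra.
have hb := hub_OO N C0 hL hcoef M.
(* Substituting tr k = - 3 a'/a - (n - 1), the difference 9 (a'/a)^2 - 9 H^2 cancels against the
   background except where multiplied by n - 1. Every term left has rate at least 4. *)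
pose E o t x := - (s o t x - s_oo o x * expR (- (2 * H * t))) - hat_n o t x * s o t x
  - 6 * (hat_n o t x * (hub b t - H)) - hat_n o t x * hat_n o t x
  - 9 * (hat_n o t x * (hub b t - H) * (hub b t + H))
  - 6 * (hat_n o t x * hat_n o t x * hub b t) - hat_n o t x * hat_n o t x * hat_n o t x
  - \sum_K hess K K o t x.
have EO : OO M 1 4 E.
  apply: OO_sub; last by apply: OO_sum => K; exact: hess_OO.
  apply: OO_sub; last by apply: (OOM nn nM) => //; lra.
  apply: OO_sub; last by apply: OO_scale; apply: (OOM nn hb) => //; lra.
  apply: OO_sub; last first.
    by apply: OO_scale; apply: (OOM nh (OO_add hb (OO_cst _ _ M H))) => //; lra.
  apply: OO_sub => //.
  apply: OO_sub; last by apply: OO_scale; apply: OOW nh _ _ _ => //; lra.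
  apply: OO_sub; last by apply: (OOM nM s1) => //; lra.
  by apply: OO_opp; apply: OOW s3 _ _ _ => //; lra.
have dn o t x : 0 < t -> is_derive t (1:R) (fun t => hat_n o t x)
    (- (6 * H) * hat_n o t x - s_oo o x * expR (- (2 * H * t)) + E o t x).
  move=> t0; have D := is_deriveB (is_derive_trk_flrw hL ha hcoef t0) (trk_derive o x t0).
  apply: (near_eq_is_derive _ (is_derive_eq D _)).
    by apply: near_pos => // r r0; rewrite !fctE /hat_n (perturbed_gauge o x (ltW r0)).
  rewrite -/(s o t x) /E lapseE trkE// -(hubble_sq hL); ring.
have n_O : OO M 1 0 (fun o _ => n_oo o) by exact: OO_scale.
have e2 : OO M 0 (-2) (fun _ t _ => expR (2 * H * t)).
  by apply: OO_ext (OO_exp _ _ M (-2)) => o t _ x; rewrite !mulNr opprK.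
pose z o t x := expR (2 * H * t) * hat_n o t x - n_oo o x.
have zO0 : OO M 1 0 z.
  by apply: OO_sub => //; apply: (OOM e2 nM) => //; lra.
have FO : OO M 1 2 (fun o t x => expR (2 * H * t) * E o t x) by apply: (OOM e2 EO) => //; lra.
have dz o t x : 0 < t -> is_derive t (1:R) (fun t => z o t x)
    (- (4 * H) * z o t x + expR (2 * H * t) * E o t x).
  move=> t0; have D := is_deriveM (is_derive_expM (2 * H) t) (dn o t x t0).
  have D' := is_deriveB D (@is_derive_cst _ _ _ (n_oo o x : R) t 1).
  apply: (is_derive_eq D'); rewrite /GRing.scale /= subr0 /z /n_oo -/(s_oo o x) expRN.
  by field; rewrite (lt0r_neq0 H0) lt0r_neq0// expR_gt0.
(* The weight exp(2Ht) lowers the damping from 6H to 4H, still above the rate 2 of the weighted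
   error. *)
have zO := OO_damped H0 e01 (ltac:(lra) : 2 < 4 :> R) (ler0n R 2) dz FO zO0.
split=> //.
have h : OO M 1 4 (fun o t x => expR (- (2 * H * t)) * z o t x).
  by apply: (OOM (OO_exp _ _ M 2) zO) => //; lra.
apply: OO_ext h => o t _ x; rewrite /z mulrBr mulrA -expRD addNr expR0; ring.
Qed.

End PerturbedB.

Section LargeConstants.
Context {R : realType}.

(** Quantifying over all larger constants makes it possible to merge finitely many estimates, in
    particular over frame indices, into one constant. *)
Definition large_enough (Q : R -> Prop) := exists K, forall C, K <= C -> Q C.

Lemma large_forall (n : nat) (Q : 'I_n -> R -> Prop) :
  (forall i, large_enough (Q i)) -> large_enough (fun C => forall i, Q i C).
Proof.
move=> /boolp.choice[K HK]; exists (\sum_i `|K i|) => C KC i; apply: HK.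
apply: le_trans KC; rewrite (bigD1 i)//=; apply: (le_trans (ler_norm _)).
by rewrite lerDl sumr_ge0.
Qed.

End LargeConstants.

(** * Estimates for all t >= 0, renormalized limits and periodicity of the profiles *)

Section PerturbedC.
Context {R : realType}.
Variables (M N : nat) (b : flrw R) (C0 : R).
Hypotheses (hN : N = (M + 6)%N) (hL : 0 < Lambda b) (ha : 0 < a_init b)
  (hcoef : flrw_coef b) (hC0 : 0 < C0).
Local Notation H := (hubble b).
Local Notation L := (inv_scale_limit b).
Local Notation pert := (perturbed N b C0).
Local Notation OO := (@OO R 3 H _ (@psize R N b C0)).
Local Notation EX := (@EX R 3 H _ (@psize R N b C0)).
Implicit Types (o : pert) (t : R) (x : 'rV[R]_3) (I J B : 'I_3).

Let H0 : 0 < H := hubble_gt0 hL.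
Let e01 : forall o, 0 <= psize o <= 1 := @psize01 R N b C0.
Local Notation OOW := (OO_W H0 e01).
Local Notation OOM := (OO_mul H0 e01).

Local Notation e_oo := (@e_oo R N b C0).
Local Notation gam_oo := (@gam_oo R N b C0).
Local Notation epsi_oo := (@epsi_oo R N b C0).
Local Notation ehat_oo := (@ehat_oo R N b C0).

(** The time 0 lies outside of [OO] and is covered by the second assumption; the threshold is the
    sum of both constants times the number of multi-indices. *)
Lemma large_bound m (k : R) (g : pert -> R -> 'rV[R]_3 -> R) :
  OO m 1 k g -> OO m 1 0 (fun o _ => g o 0) ->
  large_enough (fun C => forall o t, 0 <= t ->
    (CM_norm m (g o t) <= (C * psize o * expR (- (k * H * t)))%:E)%E).
Proof.
move=> [K K0 HK] [K' K'0 HK']; pose B : R := nb_iota (d:=3) m.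
have B0 : 0 <= B by rewrite ler0n.
exists (B * (K + K')) => C KC o t; have /andP[e0 _] := e01 o.
have le_e (a : R) : a <= K + K' -> forall c, 0 <= c -> B * (a * psize o ^+ 1 * c) <= C * psize o * c.
  move=> aK c c0; rewrite expr1 !mulrA; apply: ler_wpM2r => //; apply: ler_wpM2r => //.
  by apply: le_trans KC; rewrite ler_wpM2l.
rewrite le_eqVlt => /orP[/eqP <-|t0].
  have := Cb_CM_norm (HK' o 1 ltr01) => /le_trans; apply.
  by rewrite lee_fin mulr0 mul0r mul0r; apply: le_e; rewrite ?expR_ge0// lerDr.
have := Cb_CM_norm (HK o t t0) => /le_trans; apply.
by rewrite lee_fin; apply: le_e; rewrite ?expR_ge0// lerDl.
Qed.

Lemma large_limit m (g : pert -> 'rV[R]_3 -> R) : OO m 1 0 (fun o _ => g o) ->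
  large_enough (fun C => forall o, (CM_norm m (g o) <= (C * psize o)%:E)%E).
Proof.
move=> gO; have [K HK] := @large_bound m 0 (fun o _ => g o) gO gO.
exists K => C KC o; have := HK C KC o 0 (lexx _).
by rewrite mulr0 oppr0 expR0 mulr1.
Qed.

Lemma OO_cvg0 m e (k : R) (g : pert -> R -> 'rV[R]_3 -> R) : OO m e k g -> 0 < k ->
  forall o, CM_norm m (g o t) @[t --> +oo] --> 0%E.
Proof.
move=> [K K0 HK] k0 o; have kH : 0 < k * H by exact: mulr_gt0.
pose B : R := nb_iota (d:=3) m * (K * psize o ^+ e).
have up : (fun t : R => (B * expR (- (k * H * t)))%:E) @ +oo --> (0:R)%:E.
  apply: cvg_EFin; first by apply: nearW.
  rewrite -[X in _ --> X](mulr0 B); apply: cvgM; first exact: cvg_cst.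
  have lim : (fun t : R => k * H * t) @ +oo --> +oo by apply: (gt0_cvgMry kH); exact: cvg_id.
  exact: (cvg_comp _ _ lim (@cvgr_expR R)).
have lo : \forall t \near +oo, (0 <= CM_norm m (g o t) <= (B * expR (- (k * H * t)))%:E)%E.
  exists 0; split; first exact: real0.
  move=> t t0; apply/andP; split; first exact: CM_norm_ge0.
  by have := Cb_CM_norm (HK o t t0) => /le_trans; apply; rewrite lee_fin /B !mulrA.
exact: (squeeze_cvge lo (cvg_cst _) up).
Qed.

Lemma EX_expansion m (f : pert -> R -> 'rV[R]_3 -> R) finf : EX m 1 1 f finf -> apriori m 1 f ->
  (large_enough (fun C => forall o,
     [/\ forall t, 0 <= t -> (CM_norm m (fun x => f o t x - finf o x * expR (- (H * t)))%R
          <= (C * psize o * expR (- (3 * H * t)))%:E)%E &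
         (CM_norm m (finf o) <= (C * psize o)%:E)%E])) /\
  forall o, CM_norm m (fun x => expR (H * t) * f o t x - finf o x) @[t --> +oo] --> 0%E.
Proof.
move=> [f1 f2 f3] /apriori_0 f0.
(* At time 0 the exponentials equal 1, so bounds on [f] and on its profile are enough. *)
have d0 : OO m 1 0 (fun o _ x => f o 0 x - finf o x * expR (- (H * 0))).
  by apply: OO_ext (OO_sub f0 f2) => o t _ x; rewrite mulr0 oppr0 expR0 mulr1.
have d3 : OO m 1 3 (fun o t x => f o t x - finf o x * expR (- (H * t))).
  have h := OOW f3 (leqnn _) (leqnn _) (ltac:(lra) : 3 <= 1 + 2 :> R).
  by apply: OO_ext h => o t _ x; rewrite mul1r.
have [K HK] := large_bound d3 d0; have [K' HK'] := large_limit f2.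
split.
  exists (`|K| + `|K'|) => C KC o; split.
    apply: HK; apply: le_trans KC; apply: (le_trans (ler_norm _)); by rewrite lerDl.
  by apply: HK'; apply: le_trans KC; apply: (le_trans (ler_norm _)); rewrite lerDr.
apply: (@OO_cvg0 m 1 2); last by [].
have e1 : OO m 0 (-1) (fun _ t _ => expR (H * t)).
  by apply: OO_ext (OO_exp _ _ m (-1)) => o t _ x; rewrite mulN1r mulNr opprK.
have h : OO m 1 2 (fun o t x => expR (H * t) * (f o t x - finf o x * expR (- (H * t)))).
  by apply: (OOM e1 d3) => //; lra.
apply: OO_ext h => o t _ x; rewrite mulrBr mulrCA -expRD subrr expR0; ring.
Qed.

Lemma z3_periodic_sum (n : nat) (F : 'I_n -> 'rV[R]_3 -> R) :
  (forall i, z3_periodic (F i)) -> z3_periodic (fun x => \sum_i F i x).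
Proof. by move=> HF x i; apply: eq_bigr => j _; exact: HF. Qed.

Lemma z3_periodic_sub (f g : 'rV[R]_3 -> R) :
  z3_periodic f -> z3_periodic g -> z3_periodic (fun x => f x - g x).
Proof. by move=> Hf Hg x i; rewrite Hf Hg. Qed.

Lemma z3_periodic_mul (f g : 'rV[R]_3 -> R) :
  z3_periodic f -> z3_periodic g -> z3_periodic (fun x => f x * g x).
Proof. by move=> Hf Hg x i; rewrite Hf Hg. Qed.

Lemma z3_periodic_cst (c : R) : z3_periodic (fun _ : 'rV[R]_3 => c).
Proof. by []. Qed.

Lemma ehat_oo_C I i o : C_torus M.+2 (ehat_oo I i o).
Proof.
have [_ h _] := hat_e_EX hN hL ha hcoef hC0 I i.
split; last exact: (OO_Ck o h ltr01).
move=> x j; congr (_ * _); apply: flim_periodic => o' t y k t0.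
by rewrite /hat_e (frame_periodic (perturbed_regular o')).
Qed.

Lemma epsi_oo_C I o : C_torus M.+1 (epsi_oo I o).
Proof.
have [_ h _] := e_psi_EX hN hL ha hcoef hC0 I.
split; last exact: (OO_Ck o h ltr01).
move=> x j; congr (_ * _); apply: flim_periodic => o' t y k t0.
by rewrite (e_psi_periodic (perturbed_regular o')).
Qed.

Lemma gam_oo_C I J B o : C_torus M.+1 (gam_oo I J B o).
Proof.
have [_ h _] := gam_EX hN hL ha hcoef hC0 I J B.
split; last exact: (OO_Ck o h ltr01).
have pt I' J' B' x j : tors_oo I' J' B' o (x + delta_mx 0 j) = tors_oo I' J' B' o x.
  congr (_ * _); apply: flim_periodic => o' t y k t0.
  by rewrite /tors !(gam_periodic (perturbed_regular o') (@perturbed_orthonormal _ _ _ _ o') _ _ _ (ltW t0)).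
by move=> x j; rewrite /gam_oo /koszul_oo !pt.
Qed.

Lemma e_oo_periodic I i o : z3_periodic (e_oo I i o).
Proof. by move=> x j; rewrite /e_oo /e_infty (ehat_oo_C I i o).1. Qed.

Lemma src_oo_periodic I J o : z3_periodic (src_oo I J o).
Proof.
have pe I' i := @e_oo_periodic I' i o.
have pg I' J' B' := (gam_oo_C I' J' B' o).1; have pd' a I' J' B' := periodic_pd a (pg I' J' B').
do ![apply: z3_periodic_sub]; first 2 last.
- by do 2!(apply: z3_periodic_sum => ?); exact: z3_periodic_mul.
- by do 2!(apply: z3_periodic_sum => ?); exact: z3_periodic_mul.
- by apply: z3_periodic_mul; exact: (epsi_oo_C _ o).1.
- by do 2!(apply: z3_periodic_sum => ?); exact: z3_periodic_mul.
- by do 2!(apply: z3_periodic_sum => ?); exact: z3_periodic_mul.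
Qed.

Lemma wave_oo_periodic o : z3_periodic (wave_oo o).
Proof.
apply: z3_periodic_sub; do 2!(apply: z3_periodic_sum => ?); apply: z3_periodic_mul.
- exact: e_oo_periodic.
- exact: periodic_pd (epsi_oo_C _ o).1.
- exact: (gam_oo_C _ _ _ o).1.
- exact: (epsi_oo_C _ o).1.
Qed.

Lemma n_oo_C o : C_torus M (n_oo o).
Proof.
have [_ h _] := hat_n_profile hN hL ha hcoef hC0.
split; last exact: (OO_Ck o h ltr01).
apply: z3_periodic_mul; first exact: z3_periodic_cst.
by apply: z3_periodic_sum => K; exact: src_oo_periodic.
Qed.

Lemma tsrc_oo_periodic I J o : z3_periodic (tsrc_oo I J o).
Proof.
apply: z3_periodic_sub; first exact: src_oo_periodic.
apply: z3_periodic_mul; first exact: z3_periodic_cst.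
by apply: z3_periodic_sum => K; exact: src_oo_periodic.
Qed.

Lemma k_oo_C I J o : C_torus M (@k_oo R N b C0 I J o).
Proof.
have [_ h _] := hat_k_profile hN hL ha hcoef hC0 I J.
split; last exact: (OO_Ck o h ltr01).
move=> x j; apply: flim_periodic => o' t y k t0; rewrite tsrc_oo_periodic /hat_k /trk.
have pk K K' := @kk_periodic R o' (perturbed_regular o') K K' t.
by rewrite pk (z3_periodic_sum (fun K => pk K K)).
Qed.

Lemma e0psi_oo_C o : C_torus M (@e0psi_oo R N b C0 o).
Proof.
have [_ h _] := hat_e0psi_profile hN hL ha hcoef hC0.
split; last exact: (OO_Ck o h ltr01).
move=> x j; apply: flim_periodic => o' t y k t0.
by rewrite wave_oo_periodic /hat_e0psi (e0_psi_periodic (perturbed_regular o')).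
Qed.

Lemma expansion2 m (f : pert -> R -> 'rV[R]_3 -> R) (F finf : pert -> 'rV[R]_3 -> R) :
  apriori m 2 f -> OO m 1 0 (fun o _ => F o) -> OO m 1 0 (fun o _ => finf o) ->
  OO m 1 4 (fun o t x => f o t x - F o x * expR (- (2 * H * t)) - finf o x * expR (- (3 * H * t))) ->
  large_enough (fun C => forall o,
     [/\ forall t, 0 <= t -> (CM_norm m (fun x => f o t x - F o x * expR (- (2 * H * t))
            - finf o x * expR (- (3 * H * t)))%R
          <= (C * psize o * expR (- (4 * H * t)))%:E)%E &
         (CM_norm m (finf o) <= (C * psize o)%:E)%E]).
Proof.
move=> /apriori_0 f0 FO fO d4.
have d0 : OO m 1 0 (fun o _ x => f o 0 x - F o x * expR (- (2 * H * 0))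
    - finf o x * expR (- (3 * H * 0))).
  by apply: OO_ext (OO_sub (OO_sub f0 FO) fO) => o t _ x; rewrite !mulr0 oppr0 expR0 !mulr1.
have [K HK] := large_bound d4 d0; have [K' HK'] := large_limit fO.
exists (`|K| + `|K'|) => C KC o; split.
  apply: HK; apply: le_trans KC; apply: (le_trans (ler_norm _)); by rewrite lerDl.
by apply: HK'; apply: le_trans KC; apply: (le_trans (ler_norm _)); rewrite lerDr.
Qed.

Lemma hat_n_expansion : large_enough (fun C => forall o,
     [/\ forall t, 0 <= t -> (CM_norm M (fun x => hat_n o t x - n_oo o x * expR (- (2 * H * t)))%R
          <= (C * psize o * expR (- (4 * H * t)))%:E)%E &
         (CM_norm M (n_oo o) <= (C * psize o)%:E)%E]).
Proof.
have [_ nO n4] := hat_n_profile hN hL ha hcoef hC0.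
have n0 := OOW (apriori_0 (hat_n_apriori hN hL ha hC0)) (ltac:(lia) : (M <= M.+2)%N) (leqnn 1) (lexx 0).
have d0 : OO M 1 0 (fun o _ x => hat_n o 0 x - n_oo o x * expR (- (2 * H * 0))).
  by apply: OO_ext (OO_sub n0 nO) => o t _ x; rewrite mulr0 oppr0 expR0 mulr1.
have [K HK] := large_bound n4 d0; have [K' HK'] := large_limit nO.
exists (`|K| + `|K'|) => C KC o; split.
  apply: HK; apply: le_trans KC; apply: (le_trans (ler_norm _)); by rewrite lerDl.
by apply: HK'; apply: le_trans KC; apply: (le_trans (ler_norm _)); rewrite lerDr.
Qed.

Lemma hat_k_expansion I J : large_enough (fun C => forall o,
     [/\ forall t, 0 <= t -> (CM_norm M (fun x => hat_k o I J t x
            - H^-1 * tsrc_oo I J o x * expR (- (2 * H * t)) - k_oo I J o x * expR (- (3 * H * t)))%R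
          <= (C * psize o * expR (- (4 * H * t)))%:E)%E &
         (CM_norm M (k_oo I J o) <= (C * psize o)%:E)%E]).
Proof.
have [_ kO k4] := hat_k_profile hN hL ha hcoef hC0 I J.
have [_ tO _] := tsrc_EX hN hL ha hcoef hC0 I J.
apply: (@expansion2 M (fun o => hat_k o I J)) kO k4; last exact: OO_scale.
have [K K0 HK] := hat_k_apriori hN hL ha hC0 I J; exists K => // o t t0.
by apply: CbW (HK o t t0) => //; lia.
Qed.

Lemma hat_e0psi_expansion : large_enough (fun C => forall o,
     [/\ forall t, 0 <= t -> (CM_norm M (fun x => hat_e0psi o b t x
            - H^-1 * wave_oo o x * expR (- (2 * H * t)) - e0psi_oo o x * expR (- (3 * H * t)))%R
          <= (C * psize o * expR (- (4 * H * t)))%:E)%E &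
         (CM_norm M (e0psi_oo o) <= (C * psize o)%:E)%E]).
Proof.
have [_ pO p4] := hat_e0psi_profile hN hL ha hcoef hC0.
have [_ wO _] := wave_EX hN hL ha hcoef hC0.
apply: (@expansion2 M (fun o => hat_e0psi o b)) pO p4; last exact: OO_scale.
have [K K0 HK] := hat_e0psi_apriori hN hL ha hC0; exists K => // o t t0.
by apply: CbW (HK o t t0) => //; lia.
Qed.

Lemma apriori_W m m' (j : R) (f : pert -> R -> 'rV[R]_3 -> R) : (m' <= m)%N ->
  apriori m j f -> apriori m' j f.
Proof. by move=> mm [K K0 HK]; exists K => // o t t0; apply: CbW (HK o t t0). Qed.

Definition hat_e_expansion I i := EX_expansion (hat_e_EX hN hL ha hcoef hC0 I i)
  (hat_e_apriori hN hL ha hC0 I i).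
Definition gam_expansion I J B := EX_expansion (gam_EX hN hL ha hcoef hC0 I J B)
  (apriori_W (leqnSn _) (gam_apriori hN hL ha hC0 I J B)).
Definition e_psi_expansion I := EX_expansion (e_psi_EX hN hL ha hcoef hC0 I)
  (apriori_W (leqnSn _) (e_psi_apriori hN hL ha hC0 I)).

Lemma perturbed_expansion : exists2 C : R, 0 < C & forall o,
  let e := fun I i => e_oo I i o in let g := fun I J B => gam_oo I J B o in
  let p := fun I => epsi_oo I o in
  let Fk := F_k b e g p in let F0 := F_e0psi b e g p in
  let eps := psize o in
  [/\ forall t : R, 0 <= t ->
        [/\ (CM_norm M (fun x => hat_n o t x - n_oo o x * expR (- (2 * H * t)))%R
              <= (C * eps * expR (- (4 * H * t)))%:E)%E,
            forall I i,
             (CM_norm M.+2 (fun x => hat_e o b I i t x - ehat_oo I i o x * expR (- (H * t)))%R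
              <= (C * eps * expR (- (3 * H * t)))%:E)%E,
            forall I J B,
             (CM_norm M.+1 (fun x => hat_gam o I J B t x - gam_oo I J B o x * expR (- (H * t)))%R
              <= (C * eps * expR (- (3 * H * t)))%:E)%E
          & [/\ forall I J,
                 (CM_norm M (fun x => hat_k o I J t x
                     - Fk I J x * expR (- (2 * H * t)) - k_oo I J o x * expR (- (3 * H * t)))%R
                  <= (C * eps * expR (- (4 * H * t)))%:E)%E,
                (CM_norm M (fun x => hat_e0psi o b t x
                     - F0 x * expR (- (2 * H * t)) - e0psi_oo o x * expR (- (3 * H * t)))%R
                  <= (C * eps * expR (- (4 * H * t)))%:E)%E
              & forall I,
                 (CM_norm M.+1 (fun x => hat_epsi o I t x - epsi_oo I o x * expR (- (H * t)))%R
                  <= (C * eps * expR (- (3 * H * t)))%:E)%E]],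
      [/\ CM_norm M (fun x => expR (2 * H * t) * hat_n o t x - n_oo o x)
            @[t --> +oo] --> 0%E,
          forall I i,
            CM_norm M.+2 (fun x => expR (H * t) * hat_e o b I i t x - ehat_oo I i o x)
            @[t --> +oo] --> 0%E,
          forall I J B,
            CM_norm M.+1 (fun x => expR (H * t) * hat_gam o I J B t x - gam_oo I J B o x)
            @[t --> +oo] --> 0%E
        & [/\ forall I J,
                CM_norm M (fun x => expR (3 * H * t) *
                  (hat_k o I J t x - Fk I J x * expR (- (2 * H * t))) - k_oo I J o x)
                @[t --> +oo] --> 0%E,
              CM_norm M (fun x => expR (3 * H * t) *
                  (hat_e0psi o b t x - F0 x * expR (- (2 * H * t))) - e0psi_oo o x)
                @[t --> +oo] --> 0%E
            & forall I,
                CM_norm M.+1 (fun x => expR (H * t) * hat_epsi o I t x - epsi_oo I o x)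
                @[t --> +oo] --> 0%E]]
    & [/\ (CM_norm M (n_oo o) <= (C * eps)%:E)%E,
          forall I i, (CM_norm M.+2 (ehat_oo I i o) <= (C * eps)%:E)%E,
          forall I J B, (CM_norm M.+1 (gam_oo I J B o) <= (C * eps)%:E)%E
        & [/\ forall I J, (CM_norm M (k_oo I J o) <= (C * eps)%:E)%E,
              (CM_norm M (e0psi_oo o) <= (C * eps)%:E)%E
            & forall I, (CM_norm M.+1 (epsi_oo I o) <= (C * eps)%:E)%E]]].
Proof.
have [K1 H1] := hat_n_expansion.
have [K2 H2] := large_forall (fun I => large_forall (fun i => (hat_e_expansion I i).1)).
have [K3 H3] := large_forall (fun I => large_forall (fun J => large_forall (fun B => (gam_expansion I J B).1))).
have [K4 H4] := large_forall (fun I => large_forall (fun J => hat_k_expansion I J)).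
have [K5 H5] := hat_e0psi_expansion.
have [K6 H6] := large_forall (fun I => (e_psi_expansion I).1).
(* [C] exceeds the six thresholds, and the summand 1 makes it positive. *)
pose C := 1 + (`|K1| + `|K2| + `|K3| + `|K4| + `|K5| + `|K6|).
have n_ge (k : R) := normr_ge0 k; have n_le (k : R) := ler_norm k.
have C1 : K1 <= C by rewrite /C; have := n_le K1; have := n_ge K2; have := n_ge K3;
  have := n_ge K4; have := n_ge K5; have := n_ge K6; lra.
have C2 : K2 <= C by rewrite /C; have := n_le K2; have := n_ge K1; have := n_ge K3;
  have := n_ge K4; have := n_ge K5; have := n_ge K6; lra.
have C3 : K3 <= C by rewrite /C; have := n_le K3; have := n_ge K2; have := n_ge K1;
  have := n_ge K4; have := n_ge K5; have := n_ge K6; lra.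
have C4 : K4 <= C by rewrite /C; have := n_le K4; have := n_ge K2; have := n_ge K3;
  have := n_ge K1; have := n_ge K5; have := n_ge K6; lra.
have C5 : K5 <= C by rewrite /C; have := n_le K5; have := n_ge K2; have := n_ge K3;
  have := n_ge K4; have := n_ge K1; have := n_ge K6; lra.
have C6 : K6 <= C by rewrite /C; have := n_le K6; have := n_ge K2; have := n_ge K3;
  have := n_ge K4; have := n_ge K5; have := n_ge K1; lra.
have C0' : 0 < C by rewrite /C; have := n_ge K1; have := n_ge K2; have := n_ge K3;
  have := n_ge K4; have := n_ge K5; have := n_ge K6; lra.
clearbody C; exists C => // o e g p Fk F0 eps.
have {}H1 := H1 C C1 o; have {}H2 I i := H2 C C2 I i o; have {}H3 I J B := H3 C C3 I J B o.
have {}H4 I J := H4 C C4 I J o; have {}H5 := H5 C C5 o; have {}H6 I := H6 C C6 I o.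
have FkE I J : Fk I J = (fun x => H^-1 * tsrc_oo I J o x).
  by apply/funext => x; exact: (F_kE hN hL ha hcoef hC0).
have F0E : F0 = (fun x => H^-1 * wave_oo o x) by apply/funext => x; exact: F_e0psiE.
clearbody Fk F0.
split.
- move=> t t0; split.
  + exact: H1.1.
  + by move=> I i; exact: (H2 I i).1.
  + by move=> I J B; exact: (H3 I J B).1.
  split.
  + by move=> I J; rewrite FkE; exact: (H4 I J).1.
  + by rewrite F0E; exact: H5.1.
  + by move=> I; exact: (H6 I).1.
- split.
  + by have [h _ _] := hat_n_profile hN hL ha hcoef hC0; apply: (OO_cvg0 h).
  + by move=> I i; exact: (hat_e_expansion I i).2.
  + by move=> I J B; exact: (gam_expansion I J B).2.
  split.
  + move=> I J; rewrite FkE.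
    by have [h _ _] := hat_k_profile hN hL ha hcoef hC0 I J; apply: (OO_cvg0 h).
  + by rewrite F0E; have [h _ _] := hat_e0psi_profile hN hL ha hcoef hC0; apply: (OO_cvg0 h).
  + by move=> I; exact: (e_psi_expansion I).2.
split; [exact: H1.2|by move=> I i; exact: (H2 I i).2|by move=> I J B; exact: (H3 I J B).2|].
by split; [move=> I J; exact: (H4 I J).2|exact: H5.2|move=> I; exact: (H6 I).2].
Qed.

End PerturbedC.

(* C0 is the constant in the decay estimates satisfied by the perturbed global
   solution; it depends only on N and the background, so that eps0 and C do. *)
Theorem theorem1p3 (R : realType) (N : nat) (hN : (6 <= N)%N) (b : flrw R)
  (hLambda : 0 < Lambda b) (ha : 0 < a_init b) (hcoef : flrw_coef b)
  (C0 : R) (hC0 : 0 < C0) :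
  exists eps0 C : R, [/\ 0 < eps0, 0 < C &
  forall (D : initial_data R) (S : fields R) (eps : R),
    data_ok (Lambda b) D -> gauge_solution S b D ->
    0 <= eps -> initial_energy S b N = (eps ^+ 2)%:E -> eps <= eps0 ->
    global_bounds S b N C0 eps ->
  let H := hubble b in
  exists (n_oo : 'rV[R]_3 -> R) (k_oo : 'I_3 -> 'I_3 -> 'rV[R]_3 -> R)
    (e0psi_oo : 'rV[R]_3 -> R)
    (gam_oo : 'I_3 -> 'I_3 -> 'I_3 -> 'rV[R]_3 -> R)
    (epsi_oo : 'I_3 -> 'rV[R]_3 -> R)
    (ehat_oo : 'I_3 -> 'I_3 -> 'rV[R]_3 -> R),
  let e_oo := e_infty b ehat_oo in
  let Fk := F_k b e_oo gam_oo epsi_oo in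
  let F0 := F_e0psi b e_oo gam_oo epsi_oo in
  [/\ [/\ C_torus (N - 6) n_oo,
          forall I J, C_torus (N - 6) (k_oo I J),
          C_torus (N - 6) e0psi_oo
        & [/\ forall I J B, C_torus (N - 5) (gam_oo I J B),
              forall I, C_torus (N - 5) (epsi_oo I)
            & forall I i, C_torus (N - 4) (ehat_oo I i)]],
      forall t : R, 0 <= t ->
        [/\ (CM_norm (N - 6) (fun x => hat_n S t x - n_oo x * expR (- (2 * H * t)))%R
              <= (C * eps * expR (- (4 * H * t)))%:E)%E,
            forall I i,
             (CM_norm (N - 4) (fun x => hat_e S b I i t x - ehat_oo I i x * expR (- (H * t)))%R
              <= (C * eps * expR (- (3 * H * t)))%:E)%E,
            forall I J B,
             (CM_norm (N - 5) (fun x => hat_gam S I J B t x - gam_oo I J B x * expR (- (H * t)))%R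
              <= (C * eps * expR (- (3 * H * t)))%:E)%E
          & [/\ forall I J,
                 (CM_norm (N - 6) (fun x => hat_k S I J t x
                     - Fk I J x * expR (- (2 * H * t)) - k_oo I J x * expR (- (3 * H * t)))%R
                  <= (C * eps * expR (- (4 * H * t)))%:E)%E,
                (CM_norm (N - 6) (fun x => hat_e0psi S b t x
                     - F0 x * expR (- (2 * H * t)) - e0psi_oo x * expR (- (3 * H * t)))%R
                  <= (C * eps * expR (- (4 * H * t)))%:E)%E
              & forall I,
                 (CM_norm (N - 5) (fun x => hat_epsi S I t x - epsi_oo I x * expR (- (H * t)))%R
                  <= (C * eps * expR (- (3 * H * t)))%:E)%E]],
      [/\ CM_norm (N - 6) (fun x => expR (2 * H * t) * hat_n S t x - n_oo x)
            @[t --> +oo] --> 0%E,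
          forall I i,
            CM_norm (N - 4) (fun x => expR (H * t) * hat_e S b I i t x - ehat_oo I i x)
            @[t --> +oo] --> 0%E,
          forall I J B,
            CM_norm (N - 5) (fun x => expR (H * t) * hat_gam S I J B t x - gam_oo I J B x)
            @[t --> +oo] --> 0%E
        & [/\ forall I J,
                CM_norm (N - 6) (fun x => expR (3 * H * t) *
                  (hat_k S I J t x - Fk I J x * expR (- (2 * H * t))) - k_oo I J x)
                @[t --> +oo] --> 0%E,
              CM_norm (N - 6) (fun x => expR (3 * H * t) *
                  (hat_e0psi S b t x - F0 x * expR (- (2 * H * t))) - e0psi_oo x)
                @[t --> +oo] --> 0%E
            & forall I,
                CM_norm (N - 5) (fun x => expR (H * t) * hat_epsi S I t x - epsi_oo I x)
                @[t --> +oo] --> 0%E]]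
    & [/\ (CM_norm (N - 6) n_oo <= (C * eps)%:E)%E,
          forall I i, (CM_norm (N - 4) (ehat_oo I i) <= (C * eps)%:E)%E,
          forall I J B, (CM_norm (N - 5) (gam_oo I J B) <= (C * eps)%:E)%E
        & [/\ forall I J, (CM_norm (N - 6) (k_oo I J) <= (C * eps)%:E)%E,
              (CM_norm (N - 6) e0psi_oo <= (C * eps)%:E)%E
            & forall I, (CM_norm (N - 5) (epsi_oo I) <= (C * eps)%:E)%E]]]].
Proof.
pose M := (N - 6)%N; have NE : N = (M + 6)%N by rewrite subnK.
have -> : (N - 5 = M.+1)%N by rewrite NE; lia.
have -> : (N - 4 = M.+2)%N by rewrite NE; lia.
rewrite -/M; clearbody M.
have [C Cpos HC] := perturbed_expansion NE hLambda ha hcoef hC0.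
(* [eps0] is 1: beyond the assumed global bounds, smallness enters only through the comparison of
   powers of eps. *)
exists 1, C; split=> // D S eps _ gS eps0 _ eps1 bS H.
have eps01 : 0 <= eps <= 1 by rewrite eps0.
pose o := Perturbed eps01 (ex_intro _ D gS) bS.
exists (n_oo o), (fun I J => k_oo I J o), (e0psi_oo o), (fun I J B => gam_oo I J B o),
  (fun I => epsi_oo I o), (fun I i => ehat_oo I i o) => e_oo' Fk F0.
have [h1 h2 h3] := HC o; split; [|exact: h1|exact: h2|exact: h3].
split.
- exact: (n_oo_C NE hLambda ha hcoef hC0).
- by move=> I J; exact: (k_oo_C NE hLambda ha hcoef hC0).
- exact: (e0psi_oo_C NE hLambda ha hcoef hC0).
split.
- by move=> I J B; exact: (gam_oo_C NE hLambda ha hcoef hC0).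
- by move=> I; exact: (epsi_oo_C NE hLambda ha hcoef hC0).
- by move=> I i; exact: (ehat_oo_C NE hLambda ha hcoef hC0).
Qed.
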